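(* Let $\Phi$ be a stationary point process in $\mathbb{R}^d$ of unit intensity such that for every $j\ge1$ the joint intensity $\rho^{(j)}$ is almost everywhere continuous, scaling functions $f^j,g^j_\rho$ for $\rho^{(j)}$ (as defined in the context) exist with $g^j_\rho$ almost everywhere continuous, and $f^{j+1}=O(f^j)$ as $r\to0$. Then the following hold for $k\ge1$. (1) If $r_n\to0$ and $r_n^{d(2k+1)}f^{2k+2}(r_n)=o(n^{-1})$, then $\beta_k(R(\Phi_n,r_n))=0$ w.h.p. (2) Let $\Phi$ be negatively associated. Assume further that $\mu_0(\Phi,O_k)>0$ and $\gamma_\beta(\Phi,O_k)>0$ for all $k\ge1$ and all $\beta>0$. If $r_n^{d(2k+1)}f^{2k+2}(r_n)=\omega(n^{-1})$ and $r_n^d=O(1)$, then $\beta_k(R(\Phi_n,r_n))\neq0$ w.h.p.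
   Context: A point process $\Phi$ in $\mathbb{R}^d$ is a random locally finite counting measure, identified with its random set of points; $\Phi(B)$ is the number of points in $B$. $\Phi^{(k)}$ is the set of ordered $k$-tuples of pairwise distinct points of $\Phi$; the $k$th joint intensity $\rho^{(k)}$ is the Lebesgue density of the intensity measure $\alpha^{(k)}$ of $\Phi^{(k)}$. Standing assumptions: point processes are simple and all joint intensities exist. Stationary means translation invariant in law; unit intensity means $\rho^{(1)}\equiv1$. The reduced Palm distribution $\mathbb{P}^!_{\mathbf{x}}$ at $\mathbf{x}=(x_1,\ldots,x_k)$ is determined, for $\alpha^{(k)}$-a.e. $\mathbf{x}$, by $\mathbb{E}\{\sum_{X\in\Phi^{(k)}}u(\Phi,X)\}=\int\mathbb{E}^!_{\mathbf{x}}\{u(\Phi\cup\{x_1,\ldots,x_k\},\mathbf{x})\}\rho^{(k)}(\mathbf{x})\,d\mathbf{x}$ for bounded measurable $u\ge0$ with compact support in the second variable (translation-covariant version). $W_n=[-n^{1/d}/2,n^{1/d}/2]^d$, $\Phi_n=\Phi\cap W_n$; $B_x(r)$ is the ball of radius $r$ centred at $x$, $B_{\mathbf{x}}(r)=\bigcup_iB_{x_i}(r)$. W.h.p. means with probability tending to $1$ as $n\to\infty$. For positive sequences, $a_n=\omega(b_n)$ means $a_n/b_n\to\infty$. $\Phi$ is negatively associated if $\mathrm{Cov}(f(\Phi(B_1),\ldots,\Phi(B_k)),g(\Phi(B_{k+1}),\ldots,\Phi(B_l)))\le0$ for all bounded Borel $B_1,\ldots,B_l$ with $(B_1\cup\cdots\cup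 B_k)\cap(B_{k+1}\cup\cdots\cup B_l)=\varnothing$ and all increasing bounded continuous $f,g$. Scaling functions for $\rho^{(j)}$: if $\rho^{(j)}(0,\ldots,0)=0$, functions $f^j:\mathbb{R}_+\to\mathbb{R}_+$ and $g^j_\rho:(B_0(j))^j\to\mathbb{R}_+$ with $\rho^{(j)}(r\mathbf{y})=\Theta(f^j(r))$ and $\lim_{r\to0}\rho^{(j)}(r\mathbf{y})/f^j(r)=g^j_\rho(\mathbf{y})$ for all $\mathbf{y}=(0,y_2,\ldots,y_j)$; if $\rho^{(j)}(0,\ldots,0)>0$, $f^j\equiv1$ and $g^j_\rho\equiv\rho^{(j)}(0,\ldots,0)$. For a finite point set $P$ and $\varepsilon>0$, the Vietoris–Rips complex $R(P,\varepsilon)$ has as $m$-simplices the subsets $\{x_{i_0},\ldots,x_{i_m}\}\subset P$ with $B_{x_{i_l}}(\varepsilon/2)\cap B_{x_{i_{l'}}}(\varepsilon/2)\ne\varnothing$ for all pairs. $\beta_k$ is the $k$th Betti number (homology over $\mathbb{Z}_2$). The geometric graph $G(P,r)$ has vertex set $P$ and edges between distinct points at distance $\le r$. $O_k$ is the graph on $2k+2$ vertices $\pm e_1,\ldots,\pm e_{k+1}$, all pairs being adjacent except antipodal ones. For a connected graph $\Gamma$ on $j\ge2$ vertices, with $\mathbf{y}=(0,y_2,\ldots,y_j)$, $d\mathbf{y}=dy_2\cdots dy_j$ and $h_\Gamma(\mathbf{y})=\mathbf{1}[G(\{0,y_2,\ldots,y_j\},1)\simeq\Gamma]$, $$\mu_0(\Phi,\Gamma)=\frac1{j!}\int_{\mathbb{R}^{d(j-1)}}h_\Gamma(\mathbf{y})g^j_\rho(\mathbf{y})\,d\mathbf{y},$$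 $$\gamma_\beta(\Phi,\Gamma)=\frac{\beta^{j-1}}{j!}\int_{\mathbb{R}^{d(j-1)}}h_\Gamma(\mathbf{y})\rho^{(j)}(\beta^{1/d}\mathbf{y})\,\mathbb{P}^!_{\beta^{1/d}\mathbf{y}}\{\Phi(B_{\beta^{1/d}\mathbf{y}}(\beta^{1/d}))=0\}\,d\mathbf{y}.$$
   Formalization: ρ^(j) is a translation-invariant version; ρ^(j)(ry)=Θ(f^j(r)) means an upper bound uniform in y and a lower bound for the supremum over y; these bounds and the limit are required also when ρ^(j)(0,…,0)>0, since otherwise changing ρ^(j) on the diagonal falsifies part (2). *)

(* Defs.v *)
From HB Require Import structures.
From mathcomp Require Import all_boot all_order all_algebra finmap.
From mathcomp Require Import all_classical all_reals all_analysis.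
From mathcomp Require Import measurable_realfun.

Set Implicit Arguments.
Unset Strict Implicit.
Unset Printing Implicit Defensive.

Import Order.TTheory GRing.Theory Num.Theory.
Import numFieldNormedType.Exports.

Local Open Scope classical_set_scope.
Local Open Scope ring_scope.

(* Points of R^d are row vectors, and k-tuples of points are matrices in
   'M[R]_(k, d) whose rows are the points.  Matrices carry the library's
   (product) topology and here its Borel sigma-algebra. *)

Definition mx_display (R : realType) (m n : nat) : measure_display.
Proof. exact: (sigma_display (@open 'M[R]_(m, n))). Qed.

Section borel_matrix.
Variables (R : realType) (m n : nat).

Let mx_measurable : set (set 'M[R]_(m, n)) := <<s @open 'M[R]_(m, n) >>.

Let mx_measurable0 : mx_measurable set0.
Proof. exact: sigma_algebra0. Qed.

Let mx_measurableC A : mx_measurable A -> mx_measurable (~` A).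
Proof. exact: sigma_algebraC. Qed.

Let mx_measurable_bigcup (F : (set 'M[R]_(m, n))^nat) :
  (forall i, mx_measurable (F i)) -> mx_measurable (\bigcup_i F i).
Proof. exact: sigma_algebra_bigcup. Qed.

HB.instance Definition _ := @isMeasurable.Build (mx_display R m n)
  'M[R]_(m, n) mx_measurable mx_measurable0 mx_measurableC
  mx_measurable_bigcup.

End borel_matrix.

Lemma measurable_mxE (R : realType) (m n : nat) :
  @measurable _ 'M[R]_(m, n) = <<s @open 'M[R]_(m, n) >>.
Proof. by []. Qed.

Section lebesgue_tuple.
Variable R : realType.
Local Notation M := (measurableTypeR R).

Definition tuple_cons n (p : M * n.-tuple M) : n.+1.-tuple M :=
  [tuple of p.1 :: p.2].

Definition tuple_uncons n (t : n.+1.-tuple M) : M * n.-tuple M :=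
  (tnth t ord0, [tuple of behead t]).

Lemma measurable_tuple_cons n : measurable_fun setT (@tuple_cons n).
Proof. exact: (measurable_cons measurable_fst measurable_snd). Qed.

Lemma measurable_tuple_uncons n : measurable_fun setT (@tuple_uncons n).
Proof.
apply: measurable_fun_pair; first exact: measurable_tnth.
exact: measurable_behead.
Qed.

Lemma tuple_consK n : cancel (@tuple_cons n) (@tuple_uncons n).
Proof. by move=> [x t]; congr pair; apply: val_inj. Qed.

Section step.
Variables (n : nat) (mu : {sigma_finite_measure set (n.-tuple M) -> \bar R}).

Definition lebesgue_cons : set (n.+1.-tuple M) -> \bar R :=
  pushforward (@lebesgue_measure R \x mu)%E (@tuple_cons n).

Let mcons := @measurable_tuple_cons n.

Let lc0 : lebesgue_cons set0 = 0%E.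
Proof. exact: measure0. Qed.

Let lc_ge0 A : (0 <= lebesgue_cons A)%E.
Proof. exact: measure_ge0. Qed.

Let lc_sigma_additive : semi_sigma_additive lebesgue_cons.
Proof. exact: measure_semi_sigma_additive. Qed.

HB.instance Definition _ := isMeasure.Build _ _ _ lebesgue_cons
  lc0 lc_ge0 lc_sigma_additive.

Let lc_sigma_finite : sigma_finite setT lebesgue_cons.
Proof.
have [F TF Foo] : sigma_finite setT (@lebesgue_measure R \x mu)%E.
  have /sigma_finiteP[F [TF ndF Foo]] := sigma_finiteT (@lebesgue_measure R).
  have /sigma_finiteP[G [TG ndG Goo]] := sigma_finiteT mu.
  exists (fun k => F k `*` G k).
    rewrite -setXTT TF TG predeqE => -[x y]; split.
      move=> [/= [k _ Fkx] [l _ Gly]]; exists (maxn k l) => //; split.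
      - by move: x Fkx; exact/subsetPset/ndF/leq_maxl.
      - by move: y Gly; exact/subsetPset/ndG/leq_maxr.
    by move=> [k _ []/= ? ?]; split; exists k.
  move=> k; have [? ?] := Foo k; have [? ?] := Goo k.
  split; first exact: measurableX.
  by rewrite product_measure1E// lte_mul_pinfty// ge0_fin_numE.
exists (fun k => @tuple_uncons n @^-1` F k).
  by rewrite -preimage_bigcup -TF preimage_setT.
move=> k; have [mF Fk] := Foo k; split.
  by rewrite -[X in measurable X]setTI; exact: measurable_tuple_uncons.
rewrite /lebesgue_cons /pushforward -comp_preimage.
rewrite (_ : _ @^-1` F k = F k)//.
by apply/seteqP; split => p /=; rewrite tuple_consK.
Qed.

HB.instance Definition _ := Measure_isSigmaFinite.Build _ _ _ lebesgue_cons
  lc_sigma_finite.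

End step.

Let dirac_sigma_finite : sigma_finite setT (@dirac _ (0.-tuple M) [tuple] R).
Proof. by apply: fin_num_fun_sigma_finite; rewrite ?measure0. Qed.

Fixpoint lebesgue_tuple n : {sigma_finite_measure set (n.-tuple M) -> \bar R} :=
  match n with
  | 0 => @dirac _ (0.-tuple M) [tuple] R
  | n'.+1 => lebesgue_cons (lebesgue_tuple n')
  end.

Lemma lebesgue_tuple_box n (A : 'I_n -> set M) :
  (forall i, measurable (A i)) ->
  lebesgue_tuple n [set t | forall i, A i (tnth t i)] =
  (\prod_(i < n) @lebesgue_measure R (A i))%E.
Proof.
elim: n A => [|n IH] A mA /=.
  by rewrite big_ord0 diracE mem_set// => -[].
rewrite big_ord_recl -IH// -product_measure1E//=; last first.
  rewrite (_ : mkset _ = \bigcap_(i in [set: 'I_n])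
      ((@tnth _ M)^~ i @^-1` A (lift ord0 i))).
    apply: fin_bigcap_measurable => // i _.
    by rewrite -[X in measurable X]setTI; exact: measurable_tnth.
  by apply/seteqP; split => [t At i _|t At i]; [exact: At|exact: At].
rewrite /lebesgue_cons /pushforward; congr (product_measure1 _ _ _).
apply/seteqP; split => [[x t] /= At|[x t] /= [Ax At] i].
  by split=> [|i]; [exact: At ord0|have := At (lift ord0 i); rewrite tnthS].
by case: (unliftP ord0 i) => [k ->|->//]; rewrite tnthS.
Qed.

End lebesgue_tuple.

Section lebesgue_matrix.
Variables (R : realType) (m n : nat).
Local Notation M := (measurableTypeR R).

Definition tuple_mx (t : (m * n).-tuple M) : 'M[R]_(m, n) :=
  \matrix_(i, j) tnth t (mxvec_index i j).

Definition mx_tuple (X : 'M[R]_(m, n)) : (m * n).-tuple M :=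
  [tuple mxvec X ord0 k | k < m * n].

Lemma tuple_mxK : cancel tuple_mx mx_tuple.
Proof.
move=> t; apply: eq_from_tnth => k; rewrite tnth_mktuple.
by case/mxvec_indexP: k => i j; rewrite mxvecE mxE.
Qed.

Lemma measurable_tuple_mx : measurable_fun setT tuple_mx.
Proof.
apply: (measurability (@open 'M[R]_(m, n))) => //.
move=> _ [U oU <-]; rewrite setTI.
pose q (a : 'M[rat]_(m, n)) : 'M[R]_(m, n) := map_mx ratr a.
pose D := [set ae : 'M[rat]_(m, n) * nat |
  ball (q ae.1) (ae.2.+1%:R^-1) `<=` U].
have -> : U = \bigcup_(ae in D) ball (q ae.1) (ae.2.+1%:R^-1).
  apply/seteqP; split => [X UX|X [ae Dae]]; last exact: Dae.
  have /nbhs_ballP[e /= e0 eU] := open_nbhs_nbhs (conj oU UX).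
  pose k := Num.truncn (2 / e).
  have k0 : 0 < k.+1%:R^-1 :> R by rewrite invr_gt0.
  have ke : k.+1%:R^-1 * 2 <= e :> R.
    rewrite mulrC ler_pdivrMr// mulrC -ler_pdivrMr//.
    exact/ltW/truncnS_gt.
  have aX i j : exists a : rat, `|X i j - ratr a| < k.+1%:R^-1.
    have [|a] := @rat_in_itvoo R (X i j) (X i j + k.+1%:R^-1).
      by rewrite ltrDl.
    rewrite in_itv/= => /andP[Xa aX]; exists a.
    by rewrite distrC gtr0_norm ?subr_gt0// ltrBlDl.
  pose a : 'M[rat]_(m, n) := \matrix_(i, j) projT1 (cid (aX i j)).
  have aXE i j : `|X i j - ratr (a i j)| < k.+1%:R^-1.
    by rewrite mxE; exact: projT2 (cid (aX i j)).
  exists (a, k) => /=.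
    move=> Y [_ aY]; apply: eU; split => // i j.
    rewrite /ball/= (le_lt_trans (ler_distD (ratr (a i j)) _ _))//.
    rewrite (lt_le_trans _ ke)// mulr2n mulrDr mulr1 ltrD//.
    by have := aY i j; rewrite mxE.
  split; first by rewrite invr_gt0.
  by move=> i j; rewrite /ball/= mxE distrC.
rewrite preimage_bigcup bigcup_mkcond.
apply: countable_bigcupT_measurable; first exact: countableP.
move=> -[a k]; case: ifPn => _ //=.
have k0 : 0 < k.+1%:R^-1 :> R by rewrite invr_gt0.
rewrite (_ : _ @^-1` _ = \bigcap_(i in [set: 'I_m]) \bigcap_(j in [set: 'I_n])
  ((@tnth _ M)^~ (mxvec_index i j) @^-1` ball (ratr (a i j) : R) k.+1%:R^-1)).
  apply: fin_bigcap_measurable => // i _; apply: fin_bigcap_measurable => // j _.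
  rewrite -[X in measurable X]setTI; apply: measurable_tnth => //.
  exact: measurable_ball.
apply/seteqP; split => [t [_ at_] i _ j _|t at_].
  by have := at_ i j; rewrite !mxE.
by split => // i j; have := at_ i I j I; rewrite !mxE.
Qed.

Lemma measurable_mx_entry (i : 'I_m) (j : 'I_n) :
  measurable_fun setT (fun X : 'M[R]_(m, n) => X i j).
Proof.
apply: (measurability _ (RGenOpens.measurableE R)) => //.
move=> _ [_ [x [y ->]] <-]; rewrite setTI; apply: sub_sigma_algebra.
apply: open_comp => [X _|]; first exact: coord_continuous.
exact: interval_open.
Qed.

Lemma measurable_mx_tuple : measurable_fun setT mx_tuple.
Proof.
apply/measurable_fun_tnthP => k.
case/mxvec_indexP: k => i j.
rewrite (_ : _ \o _ = fun X : 'M[R]_(m, n) => X i j) ?funeqE => [|X /=].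
  exact: measurable_mx_entry.
by rewrite tnth_mktuple mxvecE.
Qed.

Definition lebesgue_mx : set 'M[R]_(m, n) -> \bar R :=
  pushforward (lebesgue_tuple R (m * n)) tuple_mx.

Let mtuple_mx := measurable_tuple_mx.

Let lm0 : lebesgue_mx set0 = 0%E.
Proof. exact: measure0. Qed.

Let lm_ge0 A : (0 <= lebesgue_mx A)%E.
Proof. exact: measure_ge0. Qed.

Let lm_sigma_additive : semi_sigma_additive lebesgue_mx.
Proof. exact: measure_semi_sigma_additive. Qed.

HB.instance Definition _ := isMeasure.Build _ _ _ lebesgue_mx
  lm0 lm_ge0 lm_sigma_additive.

Let lm_sigma_finite : sigma_finite setT lebesgue_mx.
Proof.
have [F TF Foo] := sigma_finiteT (lebesgue_tuple R (m * n)).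
exists (fun k => mx_tuple @^-1` F k).
  by rewrite -preimage_bigcup -TF preimage_setT.
move=> k; have [mF Fk] := Foo k; split.
  by rewrite -[X in measurable X]setTI; exact: measurable_mx_tuple.
rewrite /lebesgue_mx /pushforward -comp_preimage.
rewrite (_ : _ @^-1` F k = F k)//.
by apply/seteqP; split => p /=; rewrite tuple_mxK.
Qed.

HB.instance Definition _ := Measure_isSigmaFinite.Build _ _ _ lebesgue_mx
  lm_sigma_finite.

Lemma lebesgue_mx_box (A : 'I_m -> 'I_n -> set R) :
  (forall i j, measurable (A i j)) ->
  lebesgue_mx [set X | forall i j, A i j (X i j)] =
  (\prod_(i < m) \prod_(j < n) @lebesgue_measure R (A i j))%E.
Proof.
move=> mA; pose B k := let ij := enum_val (cast_ord (esym (mxvec_cast m n)) k) in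
  A ij.1 ij.2.
have BE i j : B (mxvec_index i j) = A i j.
  by rewrite /B /mxvec_index cast_ordK enum_rankK.
rewrite /lebesgue_mx /pushforward pair_bigA /=.
rewrite (_ : _ @^-1` _ = [set t | forall k, B k (tnth t k)]).
  rewrite lebesgue_tuple_box => [|k]; last exact: mA.
  rewrite (reindex _ (curry_mxvec_bij m n))/=.
  by apply: eq_bigr => -[i j] _ /=; rewrite BE.
apply/seteqP; split => [t At k|t Bt i j].
  by case/mxvec_indexP: k => i j; have := At i j; rewrite mxE BE.
by have := Bt (mxvec_index i j); rewrite mxE BE.
Qed.

End lebesgue_matrix.

Arguments lebesgue_mx R m n : clear implicits.

Section geometry.
Variables (R : realType) (d : nat).
Implicit Types (x y : 'rV[R]_d).

(* The library's norm on row vectors is the sup norm. *)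
Definition enorm x : R := Num.sqrt (\sum_i x ord0 i ^+ 2).

(* Closed balls: with these the 1-skeleton of the Vietoris-Rips complex at
   scale r is the geometric graph at scale r. *)
Definition eball x (r : R) : set 'rV[R]_d := [set y | enorm (y - x) <= r].

Definition eballs k (X : 'M[R]_(k, d)) (r : R) : set 'rV[R]_d :=
  \bigcup_(i in [set: 'I_k]) eball (row i X) r.

Definition window (n : nat) : set 'rV[R]_d :=
  [set x | forall i, - (n%:R `^ d%:R^-1) / 2 <= x ord0 i <= n%:R `^ d%:R^-1 / 2].

Definition translate_mx k x (X : 'M[R]_(k, d)) : 'M[R]_(k, d) :=
  \matrix_(i < k) (row i X + x).

End geometry.

(* Simple locally finite counting measures are represented by their supports. *)
Record config (R : realType) (d : nat) := Config {
  points :> set 'rV[R]_d ;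
  config_locally_finite : forall B, bounded_set B -> finite_set (points `&` B) }.

Section config.
Variables (R : realType) (d : nat).
Implicit Types (phi : config R d) (B : set 'rV[R]_d) (x : 'rV[R]_d).

Definition npoints phi B : nat := #|` fset_set (phi `&` B)|.

Lemma config0_locally_finite B :
  bounded_set B -> finite_set ((set0 : set 'rV[R]_d) `&` B).
Proof. by rewrite set0I. Qed.

Definition config0 : config R d := Config config0_locally_finite.

HB.instance Definition _ := gen_eqMixin (config R d).
HB.instance Definition _ := gen_choiceMixin (config R d).
HB.instance Definition _ := isPointed.Build (config R d) config0.

Definition config_counts : set (set (config R d)) :=
  [set E | exists B n, [/\ measurable B, bounded_set B &
                           E = [set phi | npoints phi B = n]]].

Definition config_display : measure_display.
Proof. exact: (sigma_display config_counts). Qed.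

Let cfg_measurable0 : <<s config_counts >> set0.
Proof. exact: sigma_algebra0. Qed.

Let cfg_measurableC A : <<s config_counts >> A -> <<s config_counts >> (~` A).
Proof. exact: sigma_algebraC. Qed.

Let cfg_measurable_bigcup (F : (set (config R d))^nat) :
  (forall i, <<s config_counts >> (F i)) ->
  <<s config_counts >> (\bigcup_i F i).
Proof. exact: sigma_algebra_bigcup. Qed.

HB.instance Definition _ := @isMeasurable.Build config_display (config R d)
  <<s config_counts >> cfg_measurable0 cfg_measurableC cfg_measurable_bigcup.

Definition rows k (X : 'M[R]_(k, d)) : set 'rV[R]_d := [set row i X | i in [set: 'I_k]].

Lemma translate_locally_finite x phi B :
  bounded_set B -> finite_set ([set y + x | y in phi] `&` B).
Proof.
move=> bB; have bBx : bounded_set [set y | B (y + x)].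
  have [M [Mr BM]] := bB; exists (M + `|x|); split; first exact: num_real.
  move=> r Mxr y /= Byx; have := BM (r - `|x|); rewrite ltrBrDr => /(_ Mxr _ Byx) /=.
  by rewrite lerBrDr; apply: le_trans; rewrite -{1}(addrK x y) ler_normB.
have := finite_image (fun y => y + x) (config_locally_finite phi bBx).
apply: sub_finite_set => _ [[y phiy <-] By]; exists y => //.
Qed.

Definition translate x phi : config R d :=
  Config (@translate_locally_finite x phi).

Lemma add_rows_locally_finite k (X : 'M[R]_(k, d)) phi B :
  bounded_set B -> finite_set ((phi `|` rows X) `&` B).
Proof.
move=> bB; rewrite setIUl finite_setU; split.
  exact: config_locally_finite.
by apply: finite_setIl; apply: finite_image; exact: finite_finset.
Qed.

Definition add_rows k (X : 'M[R]_(k, d)) phi : config R d :=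
  Config (@add_rows_locally_finite k X phi).

Definition factorial_power k phi : set 'M[R]_(k, d) :=
  [set X | injective (fun i => row i X) /\ forall i, points phi (row i X)].

End config.

Arguments factorial_power {R d} k phi.

Section point_process.
Context {R : realType} {d : nat} {dT : measure_display}.
Context {T : measurableType dT}.
Variables (P : probability T R) (Phi : {mfun T >-> config R d}).

Definition stationary : Prop := forall x (E : set (config R d)),
  measurable E -> P [set w | E (translate x (Phi w))] = P [set w | E (Phi w)].

Definition joint_intensity k (rho : 'M[R]_(k, d) -> R) : Prop :=
  [/\ measurable_fun setT rho, forall X, 0 <= rho X &
    forall A : set 'M[R]_(k, d), measurable A ->
      (\int[P]_w counting (factorial_power k (Phi w) `&` A) =
       \int[lebesgue_mx R k d]_(X in A) (rho X)%:E)%E].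

(* Selects a version of the joint intensity: a density is only defined almost
   everywhere, whereas the scaling functions evaluate it on the null set of
   tuples whose first point is the origin. *)
Definition translation_invariant k (rho : 'M[R]_(k, d) -> R) : Prop :=
  forall x X, rho (translate_mx x X) = rho X.

(* The union [add_rows X phi] is a union of supports, so the first clause alone
   cannot tell the reduced Palm distribution from the ordinary one; the second
   clause says that a reduced Palm configuration contains no row of X, for
   almost every X with respect to rho(X) dX.  The last clause selects the
   translation-covariant version. *)
Definition reduced_palm k (rho : 'M[R]_(k, d) -> R)
    (palm : R.-pker 'M[R]_(k, d) ~> config R d) : Prop :=
  [/\ forall u : config R d * 'M[R]_(k, d) -> R,
        measurable_fun setT u -> (forall p, 0 <= u p) ->
        (exists C, forall p, u p <= C) ->
        (exists2 K, compact K & forall phi X, ~ K X -> u (phi, X) = 0) ->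
        (\int[P]_w (\esum_(X in factorial_power k (Phi w)) (u (Phi w, X))%:E) =
         \int[lebesgue_mx R k d]_X
           ((\int[palm X]_phi (u (add_rows X phi, X))%:E) * (rho X)%:E))%E,
      {ae lebesgue_mx R k d, forall X, 0 < rho X ->
        palm X [set phi : config R d | points phi `&` rows X = set0] = 1%E} &
      forall x X (E : set (config R d)), measurable E ->
        palm (translate_mx x X) E = palm X [set phi | E (translate x phi)]].

Definition coordinate_increasing l (f : 'rV[R]_l -> R) : Prop :=
  forall x y : 'rV[R]_l, (forall i, x ord0 i <= y ord0 i) -> f x <= f y.

Definition counts l (B : 'I_l -> set 'rV[R]_d) (w : T) : 'rV[R]_l :=
  \row_i (npoints (Phi w) (B i))%:R.

Definition negatively_associated : Prop :=
  forall k l (B : 'I_k -> set 'rV[R]_d) (C : 'I_l -> set 'rV[R]_d)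
    (f : 'rV[R]_k -> R) (g : 'rV[R]_l -> R),
  (forall i, measurable (B i) /\ bounded_set (B i)) ->
  (forall i, measurable (C i) /\ bounded_set (C i)) ->
  (\bigcup_(i in [set: 'I_k]) B i) `&` (\bigcup_(i in [set: 'I_l]) C i) = set0 ->
  coordinate_increasing f -> bounded_fun f -> continuous f ->
  coordinate_increasing g -> bounded_fun g -> continuous g ->
  (covariance P (f \o counts B) (g \o counts C) <= 0)%E.

End point_process.

Section scaling.
Variables (R : realType) (d j : nat).

Definition ae_continuous k (rho : 'M[R]_(k, d) -> R) : Prop :=
  {ae lebesgue_mx R k d, forall X, {for X, continuous rho}}.

(* (y_2, ..., y_{j+1}) |-> (0, y_2, ..., y_{j+1}) *)
Definition anchor (Z : 'M[R]_(j, d)) : 'M[R]_(j.+1, d) :=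
  col_mx (0 : 'rV[R]_d) Z.

Definition anchored_ball : set 'M[R]_(j.+1, d) :=
  [set Y | row ord0 Y = 0 /\ forall i, enorm (row i Y) <= j.+1%:R].

(* rho (r Y) = Theta (f r) as r -> 0, uniformly in the anchored tuple Y: the
   upper bound holds for all Y in the domain of g, and the lower bound for the
   supremum over Y.  It cannot hold for each Y, since rho 0 = 0 at Y = 0, and
   more generally rho may vanish at tuples with repeated points.
   When 0 < rho 0, the bounds and the limit follow from continuity of rho at 0,
   but not from its almost everywhere continuity. *)
Definition scaling_functions (rho : 'M[R]_(j.+1, d) -> R)
    (f : R -> R) (g : 'M[R]_(j.+1, d) -> R) : Prop :=
  [/\ forall r, 0 <= r -> 0 <= f r,
      forall Y, anchored_ball Y -> 0 <= g Y,
      (exists2 C, 0 < C & \forall r \near 0^'+,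
          forall Y, anchored_ball Y -> rho (r *: Y) <= C * f r) /\
        (exists2 c, 0 < c & \forall r \near 0^'+,
          exists2 Y, anchored_ball Y & c * f r <= rho (r *: Y)),
      forall Y, anchored_ball Y -> rho (r *: Y) / f r @[r --> 0^'+] --> g Y &
      0 < rho 0 -> (forall r, 0 <= r -> f r = 1) /\
                   (forall Y, anchored_ball Y -> g Y = rho 0)].

(* As a function of (y_2, ..., y_{j+1}); the tuples (0, y_2, ..., y_{j+1}) form
   a null set of (j+1)-tuples. *)
Definition scaling_ae_continuous (g : 'M[R]_(j.+1, d) -> R) : Prop :=
  {ae lebesgue_mx R j d, forall Z, anchored_ball (anchor Z) ->
     g (anchor Z') @[Z' --> within (anchor @^-1` anchored_ball) (nbhs Z)]
       --> g (anchor Z)}.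

End scaling.

Section complexes.

Section betti.
Variables (V : finType) (K : {set {set V}}).

(* [c] counts vertices: these are the simplices of dimension c - 1. *)
Definition faces c : {set {set V}} := [set s in K | #|s| == c].

(* Acts on row vectors, from c-dimensional to (c-1)-dimensional chains; signs
   are irrelevant over F_2.  [boundary 0] has no columns, as simplices are
   nonempty, so that [betti 0] is the unreduced one. *)
Definition boundary c : 'M['F_2]_(#|faces c.+1|, #|faces c|) :=
  \matrix_(i, j) ((enum_val j : {set V}) \subset (enum_val i : {set V}))%:R.

Definition betti k : nat :=
  (\rank (kermx (boundary k)) - \rank (boundary k.+1))%N.

End betti.

Variables (R : realType) (d : nat).

Definition rips (Q : {fset 'rV[R]_d}) (e : R) : {set {set Q}} :=
  [set s : {set Q} | (s != finset.set0) &&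
    [forall x in s, forall y in s,
      `[< (eball (val x) (e / 2) `&` eball (val y) (e / 2)) !=set0 >]]].

Definition geometric_graph (Q : {fset 'rV[R]_d}) (r : R) : rel Q :=
  [rel x y | (x != y) && (enorm (val x - val y) <= r)].

Definition graph_iso (V W : finType) (e : rel V) (e' : rel W) : Prop :=
  exists2 s : V -> W, bijective s & forall x y, e' (s x) (s y) = e x y.

(* (i, true) and (i, false) stand for e_i and - e_i. *)
Definition cross_polytope k : rel ('I_k.+1 * bool) :=
  [rel x y | x.1 != y.1].

End complexes.

Section graph_functionals.
Variables (R : realType) (d j : nat) (V : finType) (Gamma : rel V).

Definition row_fset (Y : 'M[R]_(j.+1, d)) : {fset 'rV[R]_d} :=
  [fset row i Y | i in 'I_j.+1]%fset.

Definition graph_indicator (Z : 'M[R]_(j, d)) : R :=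
  (`[< graph_iso Gamma (@geometric_graph R d (row_fset (anchor Z)) 1) >])%:R.

Definition mu0 (g : 'M[R]_(j.+1, d) -> R) : \bar R :=
  ((j.+1`!%:R^-1)%:E *
   \int[lebesgue_mx R j d]_Z (graph_indicator Z * g (anchor Z))%:E)%E.

Definition gamma_beta (beta : R) (rho : 'M[R]_(j.+1, d) -> R)
    (palm : R.-pker 'M[R]_(j.+1, d) ~> config R d) : \bar R :=
  let b := beta `^ d%:R^-1 in
  ((beta ^+ j / j.+1`!%:R)%:E *
   \int[lebesgue_mx R j d]_Z
     ((graph_indicator Z * rho (b *: anchor Z))%:E *
      palm (b *: anchor Z)
        [set phi | npoints phi (eballs (b *: anchor Z) b) = 0%N]))%E.

End graph_functionals.

Section rips_betti.
Context {R : realType} {d : nat} {dT : measure_display}.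
Context {T : measurableType dT}.

Definition rips_betti (Phi : T -> config R d) (k n : nat) (r : R) (w : T) : nat :=
  betti (rips (fset_set (Phi w `&` window n)) r) k.

End rips_betti.

(* Main.v *)
Require Import Defs.
From HB Require Import structures.
From mathcomp Require Import all_boot all_order all_algebra finmap.
From mathcomp Require Import all_classical all_reals all_analysis.
From mathcomp Require Import measurable_realfun ring lra zify.

(** Both parts rest on one combinatorial fact.  A Vietoris-Rips complex is the
    clique complex of its geometric graph, and a clique complex whose k-th Betti
    number does not vanish has at least 2k+2 vertices in one connected
    component; the boundary of the cross-polytope O_k is the extremal case.

    Vanishing.  If beta_k is not zero, then 2k+2 distinct points of the process
    in the window lie within distance O(r) of the first of them
    ([betti_rips_cluster]).  The expected number of such tuples is the integral
    of the joint intensity over the clusters, which the scaling function bounds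
    by C n r^(d(2k+1)) f(r) ([intensity_le], [lebesgue_mx_spread_window]), and
    Markov's inequality concludes ([betti_eq0_whp]).

    Nonvanishing.  Conversely 2k+2 points whose geometric graph is O_k, with no
    other point near them, carry a nonzero class ([betti_rips_octahedron]).  A
    template consists of 2k+2 small balls such that every choice of one point
    from each is such a configuration, and of a region around them; it is hit
    when each ball is occupied and the region contains no further point.
    Disjoint translates of the region are packed into the window.  Being hit is
    not a monotone event, but its indicator is a difference of indicators of two
    increasing events: each ball is occupied or the region is overcrowded, and
    the region is overcrowded.  Negative association makes each of these two
    families of events negatively correlated, so that the variances are at most
    of the order of the means; a second moment argument
    ([second_moment_bound]) then bounds the probability that no translate is hit,
    and hence that beta_k = 0, by O(q L^d / (n p^2)), where p is the probability
    of a hit, q the probability that the region contains at least 2k+2 points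
    and L the width of the region ([betti_eq0_cell_bound]).

    It remains to bound p from below and q from above.

    For small r the template is r times a fixed one, placed where the limit g of
    the rescaled intensity is positive; it exists because mu_0 > 0 and g is
    continuous almost everywhere ([sparse_template]).  Then q is at most a
    factorial moment of order r^(d(2k+2)) f(r), while Fatou's lemma bounds the
    integral of the intensity over the template from below by the same order
    ([ball_intensity_lower]); surplus points contribute the next factorial
    moment, which is smaller by a factor r^d since f^(j+1) = O(f^j).  Hence
    P(beta_k = 0) = O(1 / (n r^(d(2k+1)) f(r))) ([sparse_regime_bound]).

    For r near a fixed b > 0 it is enough that p > 0, since q <= 1.  If all
    templates with rational centres had p = 0, the defining formula of Palm
    distributions would make the Palm void probability vanish at almost every
    octahedral tuple, against gamma_beta > 0 ([positive_template]).  Compactness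
    of segments makes the resulting bound O(1/n) uniform away from 0
    ([thermodynamic_bound]), and the two regimes together cover every bounded
    sequence of scales ([betti_neq0_whp]). *)

Set Implicit Arguments.
Unset Strict Implicit.
Unset Printing Implicit Defensive.

Import Order.TTheory GRing.Theory Num.Theory.
Import numFieldNormedType.Exports.

Local Open Scope classical_set_scope.
Local Open Scope ring_scope.

(** * Neighbourhoods of zero on the right *)

Lemma near_right0P (R : realType) (Q : R -> Prop) :
  (\forall r \near 0^'+, Q r) -> exists2 e, 0 < e & forall r, 0 < r < e -> Q r.
Proof.
move=> /nbhs_ballP[e /= e0 eQ]; exists e => // r /andP[r0 re].
by apply: eQ => //=; rewrite /ball/= sub0r normrN gtr0_norm.
Qed.

Lemma near_right0_scale (R : realType) (b : R) (Q : R -> Prop) : 0 < b ->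
  (\forall r \near 0^'+, Q r) -> \forall r \near 0^'+, Q (b * r).
Proof.
move=> b0 /near_right0P[e e0 eQ]; near=> r; apply: eQ.
rewrite mulr_gt0//= mulrC -ltr_pdivlMr//.
by near: r; apply: nbhs_right_lt; rewrite divr_gt0.
Unshelve. all: by end_near. Qed.

Lemma near_right0_lt (R : realType) (a b c : R) : a < c -> \forall e \near 0^'+, a + b * e < c.
Proof.
move=> ac; have b1 : 0 < `|b| + 1 by rewrite ltr_wpDl.
have ca : 0 < (c - a) / (`|b| + 1) by rewrite divr_gt0 ?subr_gt0.
near=> e.
have e0 : 0 < e by near: e; exact: nbhs_right_gt.
have : e < (c - a) / (`|b| + 1) by near: e; exact: nbhs_right_lt.
rewrite ltr_pdivlMr// => h.
rewrite -ltrBrDl; apply: le_lt_trans h; rewrite mulrC ler_pM2l//.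
by rewrite (le_trans (ler_norm b))// lerDl.
Unshelve. all: by end_near. Qed.

(** * Homology over F_2 by functions on vertex sets *)

Section Chains.
Variable V : finType.
Implicit Types (c z : {set V} -> 'F_2) (s t S : {set V}) (u v x y : V).

Lemma F2_addrr (a : 'F_2) : a + a = 0.
Proof. by rewrite addrr_pchar2// pchar_Fp. Qed.

Lemma F2_eq (a b : 'F_2) : (a + b = 0) -> a = b.
Proof. by move=> ab; rewrite -[a]addr0 -(F2_addrr b) addrA ab add0r. Qed.

(** The boundary over F_2 of a chain given by a function on all vertex sets: the
    coefficient of t collects the sets obtained from t by adding one vertex.
    Such functions can be restricted, coned and transported along bijections
    without any indexing of faces. *)
Definition bd c t : 'F_2 := \sum_(v | v \notin t) c (v |: t).

Lemma bdD c c' t : bd (fun s => c s + c' s) t = bd c t + bd c' t.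
Proof. exact: big_split. Qed.

(** The terms at (u, v) and (v, u) cancel in characteristic two. *)
Lemma sum_symmetric0 (p : rel V) (F : V -> V -> 'F_2) :
  symmetric p -> irreflexive p -> (forall u v, F u v = F v u) ->
  \sum_u \sum_(v | p u v) F u v = 0.
Proof.
move=> ps pi Fs; rewrite pair_big_dep /=.
rewrite (bigID (fun q : V * V => (enum_rank q.1 < enum_rank q.2)%N))/=.
rewrite [X in _ + X](_ : _ = \sum_(i : V * V | p i.1 i.2 &&
  (enum_rank i.1 < enum_rank i.2)%N) F i.1 i.2); first exact: F2_addrr.
rewrite (reindex_inj (h := fun q : V * V => (q.2, q.1)))/=; last first.
  by move=> [a b] [a' b'] [-> ->].
apply: eq_big => [[a b]|[a b] _]/=; last by rewrite Fs.
rewrite ps; case pab: (p a b) => //=.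
rewrite -leqNgt leq_eqVlt.
case: eqP => //= /val_inj/enum_rank_inj ab.
by move: pab; rewrite ab pi.
Qed.

Lemma bd_bd c t : bd (bd c) t = 0.
Proof.
rewrite /bd (big_mkcond (fun v => v \notin t))/=.
rewrite -[RHS](@sum_symmetric0 (fun u v => [&& u \notin t, v \notin t & u != v])
  (fun u v => c (v |: (u |: t)))).
- apply: eq_bigr => u _; case: ifPn => /= ut; last first.
    by rewrite big_pred0.
  by apply: eq_bigl => v; rewrite in_setU1 negb_or andbC eq_sym.
- by move=> u v; rewrite eq_sym andbCA.
- by move=> u; rewrite eqxx /= !andbF.
- by move=> u v; rewrite finset.setUCA.
Qed.

Definition chain_on (K : {set {set V}}) n c :=
  forall s, s \notin faces K n -> c s = 0.

(** Links [bd] with the incidence matrix of the complex: the sets covering t are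
    the v |: t with v outside t. *)
Lemma bd_faces (K : {set {set V}}) n c t : chain_on K n.+1 c -> #|t| = n ->
  bd c t = \sum_(s in faces K n.+1) c s * (t \subset s)%:R.
Proof.
move=> cK tn.
rewrite [RHS](bigID (fun s => t \subset s))/= [X in _ + X]big1 ?addr0; last first.
  by move=> s /andP[_ /negPf->]; rewrite mulr0.
rewrite [RHS](_ : _ = \sum_(s : {set V} | (t \subset s) && (#|s| == n.+1)) c s).
  pose h v := v |: t; rewrite [RHS](eq_bigl (mem [set h v | v in ~: t]%SET)).
    rewrite big_imset/=; first by apply: eq_bigl => v; rewrite inE.
    move=> u v; rewrite !inE /h => ut vt /setP/(_ u).
    by rewrite !inE eqxx/= => /esym/orP[/eqP//|]; rewrite (negPf ut).
  move=> s /=; apply/idP/imsetP => [/andP[ts /eqP sn]|[v]].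
    have /cards1P[v vE] : #|s :\: t| == 1%N.
      by rewrite cardsD (finset.setIidPr ts) sn tn subSnn.
    exists v; first by have := set11 v; rewrite -vE !inE => /andP[].
    by rewrite /h -vE finset.setUC -{1}(finset.setIidPr ts) finset.setID.
  by rewrite inE /h => vt ->; rewrite finset.subsetUr cardsU1 vt tn /=.
rewrite [RHS]big_mkcond [LHS]big_mkcond; apply: eq_bigr => s _.
case sK: (s \in faces K n.+1); rewrite /=.
  move: sK; rewrite inE => /andP[sK sn]; rewrite sn andbT.
  by case: ifP => // ->; rewrite mulr1.
by rewrite cK ?sK//; case: ifP.
Qed.

Section MatrixChains.
Variables (K : {set {set V}}) (n : nat).

Definition row_chain (w : 'rV['F_2]_#|faces K n|) : {set V} -> 'F_2 :=
  fun s => \sum_(i | enum_val i == s) w 0 i.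

Definition chain_row c : 'rV['F_2]_#|faces K n| := \row_i c (enum_val i).

Lemma row_chain_enum_val w i : row_chain w (enum_val i) = w 0 i.
Proof.
by rewrite /row_chain (big_pred1 i)// => k; rewrite (inj_eq enum_val_inj).
Qed.

Lemma row_chain_on w : chain_on K n (row_chain w).
Proof.
move=> s sK; rewrite /row_chain big_pred0// => i.
by apply/negbTE; apply: contraNneq sK => <-; exact: enum_valP.
Qed.

Lemma row_chainK w : chain_row (row_chain w) = w.
Proof. by apply/rowP => i; rewrite mxE row_chain_enum_val. Qed.

End MatrixChains.

Lemma chain_row_boundary (K : {set {set V}}) n c : chain_on K n.+1 c ->
  chain_row K n.+1 c *m boundary K n = chain_row K n (bd c).
Proof.
move=> cK; apply/rowP => j; rewrite !mxE.
have jn : #|enum_val j : {set V}| = n.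
  by have := enum_valP j; rewrite inE => /andP[_ /eqP].
rewrite (bd_faces cK jn) [RHS]big_enum_val.
by apply: eq_bigr => i _; rewrite !mxE.
Qed.

Lemma boundary_boundary (K : {set {set V}}) n :
  (forall s t, s \in K -> t != finset.set0 -> t \subset s -> t \in K) ->
  (0 < n)%N -> boundary K n.+1 *m boundary K n = 0.
Proof.
move=> Kc n0; apply/row_matrixP => i; rewrite row0 row_mul.
rewrite -[row i _](@row_chainK K n.+1).
pose c := row_chain (delta_mx 0 i : 'rV['F_2]_#|faces K n.+2|).
have cK : chain_on K n.+2 c by exact: row_chain_on.
have -> : row i (boundary K n.+1) = chain_row K n.+1 (bd c).
  by rewrite -chain_row_boundary// row_chainK rowE.
have bK : chain_on K n.+1 (bd c).
  move=> s sK; rewrite /bd big1// => v vs; apply: cK.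
  apply: contra sK; rewrite !inE => /andP[vsK].
  rewrite cardsU1 vs add1n eqSS => sn; rewrite sn andbT.
  apply: (Kc _ _ vsK); last exact: finset.subsetUr.
  by rewrite -cards_eq0 (eqP sn).
have -> : row_chain (chain_row K n.+1 (bd c)) = bd c.
  apply/funext => s; have [sK|sK] := boolP (s \in faces K n.+1).
    have -> : s = enum_val (enum_rank_in sK s) by rewrite enum_rankK_in.
    by rewrite row_chain_enum_val mxE.
  by rewrite (@row_chain_on K n.+1 _ _ sK) bK.
rewrite chain_row_boundary//; apply/rowP => j; rewrite !mxE.
exact: bd_bd.
Qed.

(** Trades ranks of matrices for an explicit class, a cycle that is not a boundary.
    Closure under nonempty subsets makes the composite of two boundary maps zero,
    so that the difference of ranks is a codimension. *)
Lemma betti_neq0P (K : {set {set V}}) k :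
  (forall s t, s \in K -> t != finset.set0 -> t \subset s -> t \in K) ->
  (0 < k)%N ->
  betti K k <> 0%N <-> exists z, [/\ chain_on K k.+1 z,
    (forall t, #|t| = k -> bd z t = 0) &
    forall c, chain_on K k.+2 c -> ~ (forall s, #|s| = k.+1 -> bd c s = z s)].
Proof.
move=> Kc k0.
have sub : (boundary K k.+1 <= kermx (boundary K k))%MS.
  by apply/sub_kermxP; exact: boundary_boundary.
split => [b0|[z [zK z0 nz]]].
  have nsub : ~~ (kermx (boundary K k) <= boundary K k.+1)%MS.
    apply/negP => sub'; apply: b0; rewrite /betti; apply/eqP.
    by rewrite subn_eq0 mxrankS.
  have [i ni] : exists i, ~~ (row i (kermx (boundary K k)) <= boundary K k.+1)%MS.
    by apply/existsP; rewrite -negb_forall; apply: contra nsub => /forallP ?; apply/row_subP.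
  set w := row i _ in ni.
  have w0 : w *m boundary K k = 0 by apply/sub_kermxP/row_sub.
  exists (row_chain w); split; first exact: row_chain_on.
  - move=> t tk; have [tK|tK] := boolP (t \in faces K k).
      have := chain_row_boundary (@row_chain_on K k.+1 w).
      rewrite row_chainK w0 => /rowP/(_ (enum_rank_in tK t)).
      by rewrite !mxE enum_rankK_in.
    rewrite /bd big1// => v vt; apply: row_chain_on; apply: contra tK.
    rewrite !inE => /andP[vtK _]; rewrite tk eqxx andbT.
    apply: (Kc _ _ vtK); last exact: finset.subsetUr.
    by rewrite -finset.cards_eq0 tk -lt0n.
  - move=> c cK cw; apply/negP: ni; rewrite negbK.
    rewrite -(row_chainK w); apply/submxP; exists (chain_row K k.+2 c).
    rewrite chain_row_boundary//; apply/rowP => j; rewrite !mxE cw//.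
    by have := enum_valP j; rewrite inE => /andP[_ /eqP].
rewrite /betti; apply/eqP; rewrite subn_eq0 -ltnNge ltn_neqAle mxrankS// andbT.
apply/eqP => rk.
have : (kermx (boundary K k) <= boundary K k.+1)%MS.
  by have [_ <-] := mxrank_leqif_sup sub; rewrite rk.
move=> kersub.
have : (chain_row K k.+1 z <= kermx (boundary K k))%MS.
  apply/sub_kermxP; rewrite chain_row_boundary//; apply/rowP => j.
  by rewrite !mxE z0//; have := enum_valP j; rewrite inE => /andP[_ /eqP].
move=> /submx_trans/(_ kersub)/submxP[D zD].
apply: (nz (row_chain D)); first exact: row_chain_on.
move=> s sk; have [sK|sK] := boolP (s \in faces K k.+1).
  have := chain_row_boundary (@row_chain_on K k.+2 D).
  rewrite row_chainK -zD => /rowP/(_ (enum_rank_in sK s)).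
  by rewrite !mxE enum_rankK_in.
rewrite zK// /bd big1// => v vs; apply: row_chain_on; apply: contra sK.
rewrite !inE => /andP[vsK _]; rewrite sk eqxx andbT.
apply: (Kc _ _ vsK); last exact: finset.subsetUr.
by rewrite -cards_eq0 sk.
Qed.

End Chains.

(** * Clique complexes *)

Definition clique_complex (V : finType) (e : rel V) : {set {set V}} :=
  [set s : {set V} | (s != finset.set0) &&
    [forall x in s, forall y in s, e x y]]%SET.

Section CliqueComplex.
Variables (V : finType) (e : rel V).
Hypotheses (er : reflexive e) (es : symmetric e).
Implicit Types (c z : {set V} -> 'F_2) (s t S : {set V}) (u v x y : V).
Local Notation K := (clique_complex e).

Definition clique s := [forall x in s, forall y in s, e x y].

Lemma cliqueP s : reflect {in s &, forall x y, e x y} (clique s).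
Proof.
apply: (iffP forall_inP) => [h x y xs ys|h x xs].
  by move/forall_inP: (h x xs) => /(_ y ys).
by apply/forall_inP => y ys; exact: h.
Qed.

Lemma clique_sub s t : t \subset s -> clique s -> clique t.
Proof.
move=> /fintype.subsetP ts /cliqueP cs; apply/cliqueP => x y xt yt.
by apply: cs; exact: ts.
Qed.

Lemma clique_complex_sub s t :
  s \in K -> t != finset.set0 -> t \subset s -> t \in K.
Proof.
rewrite !inE => /andP[_ cs] -> ts; exact: clique_sub cs.
Qed.

Lemma cliqueU1 v s : {in s, forall u, e v u} -> clique s -> clique (v |: s).
Proof.
move=> vs /cliqueP cs; apply/cliqueP => x y.
move=> /finset.setU1P[->|xs] /finset.setU1P[->|ys]; rewrite ?er//.
- exact: vs.
- by rewrite es; exact: vs.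
- exact: cs.
Qed.

Lemma clique_faces n s : (0 < n)%N ->
  (s \in faces K n) = clique s && (#|s| == n).
Proof.
move=> n0; rewrite 2!inE -/(clique s) -finset.cards_eq0.
by case: (eqVneq #|s| n) => [->|]; rewrite ?andbF// -lt0n n0 andbT.
Qed.

Definition clique_chain n S c :=
  forall s, c s != 0 -> [/\ s \subset S, clique s & #|s| = n].

Lemma clique_chain_on n c : (0 < n)%N ->
  chain_on K n c <-> clique_chain n finset.setT c.
Proof.
move=> n0; split => [cK s|cc s sK].
  rewrite finset.subsetT; have [|/cK->//] := boolP (s \in faces K n).
    by rewrite clique_faces// => /andP[cs /eqP].
apply/eqP; apply: contraNT sK => /cc[_ cs sn].
by rewrite clique_faces// cs sn eqxx.
Qed.

Definition cone v c s := if v \in s then c (s :\ v) else 0.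
Definition link v z s := if v \in s then 0 else z (v |: s).

Lemma bd_cone v c t : (forall s, v \in s -> c s = 0) ->
  bd (cone v c) t = if v \in t then bd c (t :\ v) else c t.
Proof.
move=> cv; case: ifPn => vt; rewrite /bd.
  rewrite [RHS](bigD1 v) ?finset.setD11//= finset.setD1K// (cv t vt) add0r.
  apply: eq_big => [u|u ut].
    rewrite !inE; case: eqVneq => [->|uv]; first by rewrite vt.
    by rewrite /= andbT.
  rewrite /cone finset.in_setU1 vt orbT; congr c.
  apply/setP => x; rewrite !inE; case: (eqVneq x u) => // ->.
  by rewrite /= andbT; apply: contraNneq ut => ->.
rewrite (bigD1 v)//= /cone finset.setU11 finset.setU1K// big1 ?addr0// => u /andP[ut uv].
by rewrite finset.in_setU1 eq_sym (negPf uv) (negPf vt).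
Qed.

Lemma bd_link v z t : (forall s, bd z s = 0) -> bd (link v z) t = 0.
Proof.
move=> z0; rewrite /bd /link.
have [vt|vt] := boolP (v \in t).
  by rewrite big1// => u ut; rewrite finset.in_setU1 vt orbT.
rewrite (bigD1 v)//= finset.setU11 add0r -[RHS](z0 (v |: t)).
apply: eq_big => [u|u /andP[ut uv]].
  by rewrite finset.in_setU1 negb_or andbC.
by rewrite finset.in_setU1 eq_sym (negPf uv) (negPf vt) finset.setUCA.
Qed.

(** Cliques with n vertices are simplices of dimension n-1, so this says that 2n
    vertices are needed for a class in that dimension.  Choose v in S.  If v is
    adjacent to all of S, then the cycle is bounded by a cone.  Otherwise the
    neighbours of v form a set of at most #|S| - 2 < 2(n-1) vertices, in which
    the link of v, a cycle one dimension lower, bounds by induction on n; adding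
    the boundary of the cone with apex v over the bounding chain moves the cycle
    off v, and induction on S applies. *)
Lemma small_cycle_bounds n S z : (#|S| < n.*2)%N ->
  clique_chain n S z -> (forall t, bd z t = 0) ->
  exists2 c, clique_chain n.+1 S c & forall t, bd c t = z t.
Proof.
elim: n S z => [//|n IHn] S.
have [m Sm] := ubnP #|S|; elim: m S Sm => // m IHm S Sm z Sn zc z0.
have [S0|[v vS]] := finset.set_0Vmem S.
  exists (fun=> 0) => [s|t]; first by rewrite eqxx.
  rewrite /bd big1//; apply/esym/eqP; apply/negP => /negP/zc[].
  by rewrite S0 finset.subset0 => /eqP -> _; rewrite cards0.
have DS : #|S :\ v|.+1 = #|S| by rewrite (cardsD1 v S) vS.
pose N := [set u in S :\ v | e v u]%SET.
have NS : N \subset S :\ v by apply/fintype.subsetP => u; rewrite inE => /andP[].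
have lkc : clique_chain n N (link v z).
  move=> s; rewrite /link; case: ifPn => [_|vs]; first by rewrite eqxx.
  move=> /zc[sS sc]; rewrite cardsU1 vs add1n => -[sn]; split => //.
    apply/fintype.subsetP => u us; rewrite !inE (fintype.subsetP sS) ?finset.in_setU1 ?us ?orbT//.
    rewrite andbT; apply/andP; split; first by apply: contraNneq vs => <-.
    by move/cliqueP: sc; apply; rewrite ?finset.setU11// finset.in_setU1 us orbT.
  by apply: clique_sub sc; exact: finset.subsetUr.
(* If v is adjacent to all of S, then z is the boundary of the cone over the part of z off v. *)
have [NE|NP] := eqVneq N (S :\ v).
  exists (cone v (fun s => if v \in s then 0 else z s)).
    move=> s; rewrite /cone; case: ifPn => [vs|]; last by rewrite eqxx.
    rewrite finset.setD11 => /zc[sS sc sn]; have sE := finset.setD1K vs.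
    split; last by rewrite (cardsD1 v s) vs sn.
      rewrite -sE; apply/fintype.subsetP => u /finset.setU1P[->//|].
      exact: fintype.subsetP.
    rewrite -sE; apply: cliqueU1 => // u us.
    have : u \in S :\ v.
      rewrite inE (fintype.subsetP sS)// andbT.
      by move: us; rewrite !inE => /andP[].
    by rewrite -NE inE => /andP[].
  move=> t; rewrite bd_cone; last by move=> s ->.
  case: ifPn => vt; last by rewrite (negPf vt).
  rewrite /bd (bigD1 v) ?finset.setD11//= finset.setU11 add0r.
  have := z0 (t :\ v); rewrite /bd (bigD1 v) ?finset.setD11//= => /F2_eq.
  rewrite finset.setD1K// => ->.
  apply: eq_bigr => u /andP[ut uv].
  by rewrite finset.in_setU1 eq_sym (negPf uv) finset.setD11.
have NS1 : (#|N|.+1 < #|S|)%N.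
  by rewrite -DS ltnS; apply: proper_card; rewrite finset.properEneq NP.
have [|c' c'c c'E] := IHn N _ _ lkc (fun t => bd_link v t z0).
  by move: Sn NS1; rewrite doubleS; lia.
have c'v s : v \in s -> c' s = 0.
  move=> vs; apply/eqP; apply/negP => /negP/c'c[/fintype.subsetP/(_ _ vs)].
  by rewrite !inE eqxx.
(* The cycle z' is homologous to z and vanishes on the cliques through v. *)
pose z' t := z t + bd (cone v c') t.
have z'E t : z' t = if v \in t then 0 else z t + c' t.
  rewrite /z' bd_cone//; case: ifPn => // vt.
  by rewrite c'E /link finset.setD11 finset.setD1K// F2_addrr.
have coneS s : cone v c' s != 0 -> [/\ s \subset S, clique s & #|s| = n.+2].
  rewrite /cone; case: ifPn => [vs|]; last by rewrite eqxx.
  move=> /c'c[sN sc sn]; have sE := finset.setD1K vs; split.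
  - rewrite -sE finset.subUset finset.sub1set vS (fintype.subset_trans sN)//.
    by rewrite (fintype.subset_trans NS)// finset.subD1set.
  - rewrite -sE; apply: cliqueU1 => // u /(fintype.subsetP sN).
    by rewrite inE => /andP[].
  - by rewrite (cardsD1 v s) vs sn.
have [||||c'' c''c c''E] := IHm (S :\ v) _ z'.
- by rewrite -ltnS DS.
- by apply: leq_trans Sn; rewrite -DS ltnS.
- move=> s; rewrite z'E; case: ifPn => [_|vs]; first by rewrite eqxx.
  have [zs0|/zc[sS sc sn] _] := eqVneq (z s) 0.
    rewrite zs0 add0r => /c'c[sN sc sn]; split => //.
    exact: fintype.subset_trans NS.
  by split => //; rewrite finset.subsetD1 sS.
- by move=> t; rewrite bdD z0 bd_bd addr0.
exists (fun s => c'' s + cone v c' s).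
  move=> s; have [c0|/c''c[sS sc sn] _] := eqVneq (c'' s) 0.
    by rewrite c0 add0r => /coneS.
  by split => //; rewrite (fintype.subset_trans sS)// finset.subD1set.
by move=> t; rewrite bdD c''E /z' -addrA F2_addrr addr0.
Qed.

Definition component x := [set y | connect e x y]%SET.

(** A clique lies in one component, so a cycle splits into cycles supported on
    components, and each of these bounds. *)
Lemma small_components_bound n z : (1 < n)%N ->
  (forall x, (#|component x| < n.*2)%N) ->
  clique_chain n finset.setT z -> (forall t, bd z t = 0) ->
  exists2 c, clique_chain n.+1 finset.setT c & forall t, bd c t = z t.
Proof.
move=> n1 small zc z0.
have cs : connect_sym e by exact: sym_connect_sym.
pose C x := [set y | fingraph.root e y == x]%SET.
have CS x : (#|C x| < n.*2)%N.
  apply: leq_ltn_trans (small x); apply/subset_leq_card/fintype.subsetP => y.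
  by rewrite !inE => /eqP <-; rewrite cs connect_root.
have cliqueC s x y : clique s -> x \in s -> y \in s -> fingraph.root e x = fingraph.root e y.
  move=> /cliqueP sc xs ys; apply/eqP; rewrite root_connect//.
  exact/connect1/sc.
pose zC x s := if s \subset C x then z s else 0.
have zCc x : clique_chain n (C x) (zC x).
  by move=> s; rewrite /zC; case: ifPn => [sC /zc[]|_]; rewrite ?eqxx.
have zC0 x t : bd (zC x) t = 0.
  have [tC|tC] := boolP (t \subset C x); last first.
    rewrite /bd big1// => v _; rewrite /zC ifN//; apply: contra tC.
    by apply: fintype.subset_trans; exact: finset.subsetUr.
  have [t0|[y yt]] := finset.set_0Vmem t.
    rewrite /bd big1// => v vt; rewrite /zC; case: ifPn => // _.
    apply/eqP; apply/negP => /negP/zc[_ _].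
    by rewrite t0 finset.setU0 cards1 => n1'; rewrite -n1' in n1.
  rewrite -[RHS](z0 t); apply: eq_bigr => v vt; rewrite /zC; case: ifPn => //.
  move=> vtC; apply/esym/eqP; apply/negP => /negP/zc[_ vc _].
  move/negP: vtC; apply; apply/fintype.subsetP => u uvt.
  rewrite inE (cliqueC _ _ y vc uvt) ?finset.in_setU1 ?yt ?orbT//.
  by have := fintype.subsetP tC _ yt; rewrite inE.
have /choice[c Hc] : forall x, exists c, clique_chain n.+1 (C x) c /\
    forall t, bd c t = zC x t.
  by move=> x; have [c ? ?] := small_cycle_bounds (CS x) (zCc x) (zC0 x); exists c.
exists (fun s => \sum_x c x s).
  move=> s; rewrite finset.subsetT => sn0.
  have [x cx] : exists x, c x s != 0.
    apply/existsP; apply: contraNT sn0; rewrite negb_exists => /forallP h.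
    by rewrite big1// => x _; apply/eqP; have := h x; rewrite negbK.
  by have [_ ? ?] := (Hc x).1 s cx.
move=> t; rewrite /bd exchange_big/=.
rewrite (eq_bigr (fun x => zC x t)); last by move=> x _; exact: (Hc x).2.
have [zt0|/zc[_ tc tn]] := eqVneq (z t) 0.
  by rewrite big1// => x _; rewrite /zC zt0 if_same.
have [y yt] : exists y, y \in t by apply/card_gt0P; rewrite tn; lia.
rewrite (bigD1 (fingraph.root e y))//= big1 ?addr0 => [|x xy]; rewrite /zC.
  rewrite ifT//; apply/fintype.subsetP => u ut.
  by rewrite inE (cliqueC _ _ _ tc ut yt).
rewrite ifN//; apply: contra xy => /fintype.subsetP/(_ _ yt).
by rewrite inE eq_sym.
Qed.

Lemma betti_clique_component k : (0 < k)%N -> betti K k <> 0%N ->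
  exists x, (2 * k + 2 <= #|component x|)%N.
Proof.
move=> k0 /(betti_neq0P clique_complex_sub k0)[z [zK z0 nz]].
apply: contrapT => nlarge.
have small x : ~~ (2 * k + 2 <= #|component x|)%N.
  by apply/negP => large; apply: nlarge; exists x.
have zc : clique_chain k.+1 finset.setT z by apply/clique_chain_on.
have [||t|c cc cz] := @small_components_bound k.+1 z _ _ zc.
- by rewrite ltnS.
- by move=> x; have := small x; rewrite -ltnNge; lia.
- have [/eqP tk|tk] := boolP (#|t| == k); first exact: z0.
  rewrite /bd big1// => v vt; apply/eqP; apply/negP => /negP/zc[_ _].
  by rewrite cardsU1 vt => -[] /eqP; apply/negP.
- apply: (nz c); first exact/clique_chain_on.
  by move=> s _; exact: cz.
Qed.

(** A set of vertices that contains x and is smaller than its component has an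
    outgoing edge, along which a potential D such as the distance to x increases
    by at most r. *)
Lemma component_walk (R : realType) (D : V -> R) (r : R) x m : 0 <= r -> D x <= 0 ->
  (forall y u, e y u -> D u <= D y + r) -> (m < #|component x|)%N ->
  exists s : seq V, [/\ uniq (x :: s), size s = m & forall y, y \in s -> D y <= m%:R * r].
Proof.
move=> r0 Dx De; elim: m => [_|m IH mx]; first by exists [::].
have [s [us sm sD]] := IH (ltnW mx).
have [y [u [ys ue uC]]] : exists y u, [/\ y \in x :: s, e y u & u \notin x :: s].
  apply: contrapT => nex.
  have : component x \subset x :: s.
    apply/fintype.subsetP => u; rewrite inE => /connectP[p pp ->].
    suff walk q y : path e y q -> y \in x :: s -> last y q \in x :: s.
      by apply: walk => //; rewrite mem_head.
    elim: q y => //= a q IHq y /andP[ya qa] ys; apply: IHq qa _.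
    by apply: contrapT => /negP an; apply: nex; exists y, a.
  move/subset_leq_card; rewrite (card_uniqP us)/= sm.
  by rewrite leqNgt mx.
exists (rcons s u); split; rewrite ?size_rcons ?sm//.
  by rewrite -rcons_cons rcons_uniq uC us.
have Du : D u <= m.+1%:R * r.
  apply: (le_trans (De _ _ ue)); rewrite -natr1 mulrDl mul1r lerD2r.
  move: ys; rewrite inE => /orP[/eqP ->|/sD//].
  by rewrite (le_trans Dx)// mulr_ge0.
move=> a; rewrite mem_rcons inE => /orP[/eqP->//|/sD /le_trans->//].
by rewrite ler_wpM2r// ler_nat.
Qed.

Section Octahedron.
Variables (k : nat) (h : 'I_k.+1 * bool -> V).
Hypotheses (h_inj : injective h)
  (h_adj : forall p q, e (h p) (h q) = (p == q) || (p.1 != q.1))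
  (h_iso : forall v, v \notin codom h -> forall p, ~~ e v (h p)).

Definition facet s := (s \subset codom h) &&
  [forall i, (h (i, true) \in s) (+) (h (i, false) \in s)].

Lemma facetE s : facet s -> s = [set h (i, h (i, true) \in s) | i : 'I_k.+1]%SET.
Proof.
move=> /andP[sh /forallP sx]; apply/setP => v; apply/idP/finset.imsetP => [vs|[i _ ->]].
  have /codomP[[i b] vE] := fintype.subsetP sh _ vs.
  exists i => //; rewrite vE; congr h; congr pair.
  by move: (sx i); rewrite vE in vs; case: b vs {vE} => [->//|->]; rewrite addbT; case: (_ \in _).
by move: (sx i); case hi: (h (i, true) \in s); rewrite // addFb.
Qed.

Lemma card_facet s : facet s -> #|s| = k.+1.
Proof.
move=> /facetE ->; rewrite finset.card_imset ?card_ord// => i i' /h_inj.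
by case.
Qed.

Lemma facet_clique s : facet s -> clique s.
Proof.
move=> /facetE sE; apply/cliqueP => x y; rewrite sE.
move=> /finset.imsetP[i _ ->] /finset.imsetP[i' _ ->]; rewrite h_adj/=.
by have [->|] := eqVneq i i'; rewrite ?eqxx ?orbT.
Qed.

(** Each ridge lies on exactly two facets, exchanged by an antipodal pair. *)
Lemma facetU1 t i b : h (i, b) \notin t -> facet (h (i, b) |: t) ->
  h (i, ~~ b) \notin t /\ facet (h (i, ~~ b) |: t).
Proof.
move=> ht /andP[sh /forallP sx].
have ht' : h (i, ~~ b) \notin t.
  move: (sx i); rewrite !finset.in_setU1 !(inj_eq h_inj) !xpair_eqE eqxx/=.
  by case: b ht {sh sx} => /negPf -> /=; rewrite ?orbF ?addbT ?addTb.
split => //; apply/andP; split.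
  apply/fintype.subsetP => v /finset.setU1P[->|vt]; first exact: codom_f.
  by apply: (fintype.subsetP sh); rewrite finset.in_setU1 vt orbT.
apply/forallP => i'; move: (sx i').
rewrite !finset.in_setU1 !(inj_eq h_inj) !xpair_eqE.
have [->|//] := eqVneq i' i.
by case: b ht ht' {sh sx} => /= /negPf -> /negPf ->.
Qed.

(** The sum of all facets is a cycle, as ridges lie on two facets.  If it were a
    boundary, then the facet formed by the positive vertices would extend to a
    larger clique; but the added vertex can neither be a negative vertex, which
    is antipodal to a positive one, nor lie outside the octahedron. *)
Lemma betti_octahedron : (0 < k)%N -> betti K k <> 0%N.
Proof.
move=> k0; apply/(betti_neq0P clique_complex_sub k0).
exists (fun s => (facet s)%:R); split.
- move=> s sK; rewrite (_ : facet s = false)//; apply/negbTE.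
  by apply: contra sK => sf; rewrite clique_faces// card_facet// eqxx facet_clique.
- move=> t _; have [v /andP[vt vf]|none] := pickP (fun v => (v \notin t) && facet (v |: t)); last first.
    by rewrite /bd big1// => v vt; have := none v; rewrite vt/= => ->.
  have /codomP[[i b] vE] : v \in codom h.
    by move: vf => /andP[/fintype.subsetP vf _]; apply: vf; rewrite finset.setU11.
  rewrite vE in vt vf.
  have [vt' vf'] := facetU1 vt vf.
  rewrite /bd (bigD1 (h (i, b)))//= (bigD1 (h (i, ~~ b)))/=; last first.
    by rewrite vt' (inj_eq h_inj) xpair_eqE eqxx/=; case: (b).
  rewrite vf vf' addrA F2_addrr add0r big1// => u /andP[/andP[ut u1] u2].
  rewrite (_ : facet _ = false)//; apply/negP => /andP[_ /forallP/(_ i)].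
  rewrite !finset.in_setU1.
  have -> : h (i, true) \in t = false.
    by case: b vt vt' {vE vf vf' u1 u2} => /negPf ? /negPf ?.
  have -> : h (i, false) \in t = false.
    by case: b vt vt' {vE vf vf' u1 u2} => /negPf ? /negPf ?.
  by rewrite !orbF; case: b {vt vf vt' vf' vE} u1 u2 => /=;
    rewrite ![u == _]eq_sym => /negPf -> /negPf ->.
move=> c cK; pose s := [set h (i, true) | i : 'I_k.+1]%SET.
have hs i b : (h (i, b) \in s) = b.
  apply/finset.imsetP/idP => [[i' _ /h_inj[_ ->//]]|->]; last by exists i.
have sf : facet s.
  apply/andP; split; last by apply/forallP => i; rewrite !hs.
  by apply/fintype.subsetP => v /finset.imsetP[i _ ->]; exact: codom_f.
move=> /(_ s (card_facet sf)); rewrite sf /bd big1 => [/eqP|v vs].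
  by rewrite eq_sym oner_eq0.
apply: cK; apply/negP; rewrite clique_faces// => /andP[/cliqueP vc _].
have adj i : e v (h (i, true)).
  by apply: vc; rewrite ?finset.setU11// finset.in_setU1 hs orbT.
have [/codomP[[i b] vE]|/h_iso/(_ (ord0, true))] := boolP (v \in codom h).
  move: vs (adj i); rewrite vE hs h_adj xpair_eqE !eqxx/= orbF.
  by move=> /negPf ->.
by rewrite adj.
Qed.

End Octahedron.
End CliqueComplex.

Lemma betti_clique_iso (V V' : finType) (e : rel V) (e' : rel V') (h : V -> V') k :
  bijective h -> (forall x y, e' (h x) (h y) = e x y) -> (0 < k)%N ->
  betti (clique_complex e) k <> 0%N -> betti (clique_complex e') k <> 0%N.
Proof.
move=> [g hK gK] he k0.
have imK : cancel (fun s : {set V} => h @: s)%SET (fun s : {set V'} => g @: s)%SET.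
  by move=> s; rewrite -finset.imset_comp (finset.eq_imset _ hK) finset.imset_id.
have imK' : cancel (fun s : {set V'} => g @: s)%SET (fun s : {set V} => h @: s)%SET.
  by move=> s; rewrite -finset.imset_comp (finset.eq_imset _ gK) finset.imset_id.
have h_inj := can_inj hK; have g_inj := can_inj gK.
have hf n (s : {set V}) : (h @: s \in faces (clique_complex e') n)%SET =
    (s \in faces (clique_complex e) n).
  rewrite !inE finset.card_imset// -!finset.cards_eq0 finset.card_imset//; congr (_ && _ && _).
  apply/cliqueP/cliqueP => sc x y xs ys.
    by rewrite -he; apply: sc; exact: finset.imset_f.
  by case/finset.imsetP: xs => a a_s ->; case/finset.imsetP: ys => b b_s ->; rewrite he; exact: sc.
have gf n (s : {set V'}) : (g @: s \in faces (clique_complex e) n)%SET =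
    (s \in faces (clique_complex e') n).
  by rewrite -hf imK'.
have bdg (c : {set V} -> 'F_2) t : bd (fun s : {set V'} => c (g @: s)%SET) t = bd c (g @: t)%SET.
  rewrite /bd [RHS](reindex g (onW_bij _ (Bijective gK hK)))/=; apply: eq_big => v.
    by rewrite (finset.mem_imset _ _ g_inj).
  by move=> _; rewrite finset.imsetU1.
have bdh (c : {set V'} -> 'F_2) t : bd (fun s : {set V} => c (h @: s)%SET) t = bd c (h @: t)%SET.
  rewrite /bd [RHS](reindex h (onW_bij _ (Bijective hK gK)))/=; apply: eq_big => v.
    by rewrite (finset.mem_imset _ _ h_inj).
  by move=> _; rewrite finset.imsetU1.
move=> /(betti_neq0P (@clique_complex_sub _ e) k0)[z [zK z0 nz]].
apply/(betti_neq0P (@clique_complex_sub _ e') k0).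
exists (fun s : {set V'} => z (g @: s)%SET); split => [s sK|t tk|c cK cE].
- by apply: zK; rewrite gf.
- by rewrite bdg z0// finset.card_imset.
- apply: (nz (fun s : {set V} => c (h @: s)%SET)) => [s sK|s sk].
    by apply: cK; rewrite hf.
  by rewrite bdh cE ?finset.card_imset// imK.
Qed.

(** * Vietoris-Rips complexes as clique complexes *)

Section EuclideanNorm.
Variables (R : realType) (d : nat).
Implicit Types (x y z : 'rV[R]_d).

Lemma enorm_ge0 x : 0 <= enorm x.
Proof. exact: sqrtr_ge0. Qed.

Lemma enorm_sqr x : enorm x ^+ 2 = \sum_i x ord0 i ^+ 2.
Proof. by rewrite sqr_sqrtr// sumr_ge0// => i _; rewrite sqr_ge0. Qed.

Lemma enormN x : enorm (- x) = enorm x.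
Proof. by congr Num.sqrt; apply: eq_bigr => i _; rewrite mxE sqrrN. Qed.

Lemma enormB x y : enorm (x - y) = enorm (y - x).
Proof. by rewrite -enormN opprB. Qed.

Lemma enorm0 : enorm (0 : 'rV[R]_d) = 0.
Proof. by rewrite /enorm big1 ?sqrtr0// => i _; rewrite mxE expr0n. Qed.

Lemma enormZ a x : enorm (a *: x) = `|a| * enorm x.
Proof.
rewrite /enorm -sqrtr_sqr -sqrtrM ?sqr_ge0//; congr Num.sqrt.
by rewrite mulr_sumr; apply: eq_bigr => i _; rewrite mxE exprMn.
Qed.

Lemma coord_le_enorm x i : `|x ord0 i| <= enorm x.
Proof.
rewrite -sqrtr_sqr ler_sqrt ?sumr_ge0// => [|j _]; last exact: sqr_ge0.
by rewrite (bigD1 i)//= lerDl sumr_ge0// => j _; exact: sqr_ge0.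
Qed.

Lemma enorm_eq0 x : enorm x = 0 -> x = 0.
Proof.
move=> x0; apply/rowP => i; apply/eqP; rewrite mxE -normr_le0 -x0.
exact: coord_le_enorm.
Qed.

Lemma enorm_le_coord x (M : R) :
  0 <= M -> (forall i, `|x ord0 i| <= M) -> enorm x <= d%:R * M.
Proof.
move=> M0 xM; rewrite -(@ler_pXn2r _ 2) ?nnegrE ?enorm_ge0 ?mulr_ge0//.
rewrite enorm_sqr exprMn.
apply: (@le_trans _ _ (d%:R * M ^+ 2)).
  rewrite -[X in X%:R]card_ord -sum1_card natr_sum mulr_suml ler_sum// => i _.
  by rewrite mul1r -real_normK ?num_real// lerXn2r ?nnegrE.
by rewrite ler_wpM2r ?sqr_ge0// -natrX ler_nat; nia.
Qed.

Lemma enorm_dot x y : \sum_i x ord0 i * y ord0 i <= enorm x * enorm y.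
Proof.
set a := enorm x; set b := enorm y.
have [/enorm_eq0 ->|a0] := eqVneq a 0.
  rewrite big1 ?mulr_ge0 ?enorm_ge0// => i _.
  by rewrite mxE mul0r.
have [/enorm_eq0 ->|b0] := eqVneq b 0.
  rewrite big1 ?mulr_ge0 ?enorm_ge0// => i _.
  by rewrite mxE mulr0.
have ab : 0 < a * b by rewrite mulr_gt0// lt_def ?a0 ?b0 enorm_ge0.
have : 0 <= \sum_i (b * x ord0 i - a * y ord0 i) ^+ 2.
  by rewrite sumr_ge0// => i _; exact: sqr_ge0.
have -> : \sum_i (b * x ord0 i - a * y ord0 i) ^+ 2 =
    b ^+ 2 * a ^+ 2 + a ^+ 2 * b ^+ 2 - 2 * (a * b) * \sum_i x ord0 i * y ord0 i.
  rewrite !enorm_sqr !mulr_sumr -big_split/= -sumrB; apply: eq_bigr => i _.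
  by rewrite -!enorm_sqr -/b -/a; ring.
move=> h; rewrite -(ler_pM2l ab); nra.
Qed.

Lemma enormD x y : enorm (x + y) <= enorm x + enorm y.
Proof.
rewrite -(@ler_pXn2r _ 2) ?nnegrE ?addr_ge0 ?enorm_ge0//.
rewrite sqrrD !enorm_sqr.
have -> : \sum_i (x + y) ord0 i ^+ 2 =
    \sum_i x ord0 i ^+ 2 + (\sum_i x ord0 i * y ord0 i) *+ 2 + \sum_i y ord0 i ^+ 2.
  by rewrite -sumrMnl -!big_split/=; apply: eq_bigr => i _; rewrite mxE sqrrD.
by rewrite lerD2r lerD2l lerMn2r/= enorm_dot.
Qed.

Lemma enorm_triangle y x z : enorm (x - z) <= enorm (x - y) + enorm (y - z).
Proof. by rewrite (le_trans _ (enormD _ _))// addrA subrK. Qed.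

Lemma eball_meet x y (e : R) : 0 <= e ->
  (eball x (e / 2) `&` eball y (e / 2)) !=set0 <-> enorm (x - y) <= e.
Proof.
move=> e0; split=> [[z [xz yz]]|xy].
  rewrite (le_trans (enorm_triangle z _ _))// [leRHS]splitr lerD//.
  by rewrite enormB.
exists (2^-1 *: (x + y)); split; rewrite /eball/=.
  rewrite (_ : _ - x = 2^-1 *: (y - x)).
    by rewrite enormZ gtr0_norm// enormB mulrC ler_wpM2r.
  by apply/rowP => i; rewrite !mxE; field.
rewrite (_ : _ - y = 2^-1 *: (x - y)).
  by rewrite enormZ gtr0_norm// mulrC ler_wpM2r.
by apply/rowP => i; rewrite !mxE; field.
Qed.

End EuclideanNorm.

Section RipsPoints.
Variables (R : realType) (d : nat).
Implicit Types (Q : {fset 'rV[R]_d}) (r : R) (x y z : 'rV[R]_d).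

Definition close Q r : rel Q := fun x y : Q => enorm (val x - val y) <= r.

Lemma close_refl Q r : 0 <= r -> reflexive (close (Q := Q) r).
Proof. by move=> r0 x; rewrite /close subrr enorm0. Qed.

Lemma close_sym Q r : symmetric (close (Q := Q) r).
Proof. by move=> x y; rewrite /close enormB. Qed.

Lemma rips_clique Q r : 0 <= r -> rips Q r = clique_complex (close (Q := Q) r).
Proof.
move=> r0; pose meet (x y : Q) :=
  `[< (eball (val x) (r / 2) `&` eball (val y) (r / 2)) !=set0 >].
rewrite -[LHS]/(clique_complex meet); congr clique_complex.
by apply/funext => x; apply/funext => y; apply/asboolP/idP => /eball_meet; apply.
Qed.

Lemma betti_rips_cluster Q r k : 0 < r -> (0 < k)%N -> betti (rips Q r) k <> 0%N ->
  exists X : 'M[R]_((2 * k + 1).+1, d), [/\ injective (fun i => row i X),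
    (forall i, row i X \in Q) &
    forall i, enorm (row i X - row ord0 X) <= (2 * k + 1)%:R * r].
Proof.
move=> r0 k0; rewrite rips_clique ?ltW// => b0.
have [x xC] := betti_clique_component (close_refl (ltW r0)) (@close_sym Q r) k0 b0.
have Cx : (2 * k + 1 < #|component (close (Q := Q) r) x|)%N by lia.
have [||s [us ss sD]] := component_walk (D := fun y : Q => enorm (val y - val x)) (ltW r0) _ _ Cx.
- by rewrite subrr enorm0.
- move=> y u yu; rewrite (le_trans (enorm_triangle (val y) _ _))// addrC lerD2l.
  by rewrite enormB.
have ssz : size (x :: s) = (2 * k + 1).+1 by rewrite /= ss.
exists (\matrix_i val (nth x (x :: s) i)); split.
- move=> i i'; rewrite !rowK => /val_inj/eqP.
  by rewrite nth_uniq ?ssz// => /eqP/val_inj.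
- by move=> i; rewrite rowK; exact: valP.
- move=> i; rewrite !rowK/=.
  case: i => -[|i] /= ilt; first by rewrite subrr enorm0 mulr_ge0// ltW.
  by apply: sD; rewrite mem_nth// ss; lia.
Qed.

Lemma betti_rips_octahedron Q r k (X : 'M[R]_((2 * k + 1).+1, d))
    (s : 'I_(2 * k + 1).+1 -> 'I_k.+1 * bool) : 0 <= r -> (0 < k)%N -> bijective s ->
  (forall i, row i X \in Q) ->
  (forall i j, i != j -> (enorm (row i X - row j X) <= r) = ((s i).1 != (s j).1)) ->
  (forall i j, i != j -> row i X != row j X) ->
  (forall x, x \in Q -> (forall i, x != row i X) -> forall i, r < enorm (x - row i X)) ->
  betti (rips Q r) k <> 0%N.
Proof.
move=> r0 k0 [s' sK s'K] XQ adj inj iso; rewrite rips_clique//.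
pose h p : Q := FSetSub (XQ (s' p)).
have hE p : val (h p) = row (s' p) X by [].
refine (@betti_octahedron _ _ k h _ _ _ k0).
- move=> p q /(congr1 val); rewrite !hE => /eqP pq.
  apply: (can_inj s'K); apply/eqP; apply: contraTT pq; exact: inj.
- move=> p q; rewrite /close !hE; have [->|pq] := eqVneq p q.
    by rewrite subrr enorm0 r0.
  by rewrite adj ?(can_eq s'K)// !s'K.
- move=> v vh p; rewrite /close -ltNge hE; apply: iso; first exact: valP.
  move=> i; apply: contra vh => /eqP vE; apply/codomP; exists (s i).
  by apply: val_inj; rewrite hE sK.
Qed.

Lemma betti_rips_iso Q Q' r r' k (f : 'rV[R]_d -> 'rV[R]_d) :
  0 <= r -> 0 <= r' -> (0 < k)%N ->
  {in Q &, injective f} -> Q' = [fset f x | x in Q]%fset ->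
  {in Q &, forall x y, (enorm (f x - f y) <= r') = (enorm (x - y) <= r)} ->
  (betti (rips Q r) k == 0%N) = (betti (rips Q' r') k == 0%N).
Proof.
move=> r0 r'0 k0 finj -> fE; rewrite !rips_clique//.
have fQ (x : Q) : f (val x) \in [fset f x | x in Q]%fset.
  by rewrite in_imfset//; exact: valP.
pose h (x : Q) := FSetSub (fQ x).
have hinj : injective h.
  by move=> x y /(congr1 val)/= /finj => /(_ (valP x) (valP y))/val_inj.
have hs (y : [fset f x | x in Q]%fset) : exists x : Q, h x = y.
  have := valP y => /imfsetP[x /= xQ yE]; exists (FSetSub xQ).
  by apply: val_inj.
have [g gE] := choice hs.
have hE : bijective h by exists g => // x; apply: hinj; rewrite gE.
have hc (x y : Q) : close r' (h x) (h y) = close r x y.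
  by rewrite /close; apply: fE; exact: valP.
have gB : bijective g by exists h => // x; apply: hinj; rewrite gE.
have gc (y z : [fset f x | x in Q]%fset) : close r (g y) (g z) = close r' y z by rewrite -hc !gE.
apply/idP/idP; apply: contraTT => /eqP b0; apply/eqP.
  exact: (betti_clique_iso gB gc k0 b0).
exact: (betti_clique_iso hE hc k0 b0).
Qed.

End RipsPoints.

(** * Integrals, regions and counts *)

Section Integrals.
Local Open Scope ereal_scope.
Context (dT : measure_display) (T : measurableType dT) (R : realType).
Variable mu : {measure set T -> \bar R}.

(** The integral of a nonnegative function is the supremum of the integrals of the
    simple functions below it, hence monotone.  This applies to numbers of tuples
    and to Palm integrands, whose measurability would take some work. *)
Lemma ge0_le_integral_nonmeasurable (D : set T) (f g : T -> \bar R) :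
  (forall x, D x -> 0 <= f x) -> (forall x, D x -> f x <= g x) ->
  \int[mu]_(x in D) f x <= \int[mu]_(x in D) g x.
Proof.
move=> f0 fg; have g0 x : D x -> 0 <= g x.
  by move=> Dx; rewrite (le_trans (f0 _ Dx))// fg.
rewrite !ge0_integralE//; apply: le_ereal_sup => _ [h hf <-]; exists h => // x.
by rewrite (le_trans (hf x))//; apply: lee_restrict.
Qed.

Lemma measure_le_integral (A : set T) (g : T -> \bar R) : measurable A ->
  (forall x, 0 <= g x) -> (forall x, A x -> 1 <= g x) ->
  mu A <= \int[mu]_x g x.
Proof.
move=> mA g0 Ag; rewrite -[A in mu A]setIT -integral_indic//.
apply: ge0_le_integral_nonmeasurable => x _; rewrite ?lee_fin// indicE.
by have [/set_mem/Ag|] := boolP (x \in A).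
Qed.

End Integrals.

(** Otherwise h would vanish outside a null set. *)
Lemma integral_gt0_exists (dT : measure_display) (T : measurableType dT) (R : realType)
    (mu : {measure set T -> \bar R}) (h : T -> \bar R) (Q : T -> Prop) :
  {ae mu, forall x, Q x} -> (forall x, 0 <= h x)%E -> (0 < \int[mu]_x h x)%E ->
  exists2 x, Q x & (0 < h x)%E.
Proof.
move=> [N [mN N0 QN]] h0 hgt0; apply: contrapT => none.
have : (\int[mu]_x h x <= \int[mu]_x (cst +oo%E \_ N) x)%E.
  apply: ge0_le_integral_nonmeasurable => // x _; rewrite /patch.
  case: (boolP (x \in N)) => [_|xN]; first by rewrite leey.
  rewrite leNgt; apply/negP => hx; apply: none; exists x => //.
  by apply: contrapT => /QN/mem_set; rewrite (negPf xN).
by rewrite -integral_mkcond integral_cst// N0 mule0 leNgt hgt0.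
Qed.

Lemma counting_le (R : realType) (U : choiceType) (A B : set U) : A `<=` B ->
  (counting A <= counting B :> \bar R)%E.
Proof.
move=> AB; rewrite /counting; case: (asboolP (finite_set B)) => [fB|_]; last by rewrite leey.
have fA := sub_finite_set AB fB; rewrite asboolT//.
rewrite lee_fin ler_nat; apply: fsubset_leq_card; apply/fsubsetP => x.
by rewrite !in_fset_set// => /set_mem /AB; exact: mem_set.
Qed.

Section MatrixMeasurability.
Variables (R : realType) (m n : nat).

Lemma measurable_fun_mx dT (T : measurableType dT) (F : T -> 'M[R]_(m, n)) :
  (forall i j, measurable_fun setT (fun x => F x i j)) -> measurable_fun setT F.
Proof.
move=> mF; rewrite (_ : F = tuple_mx (n := n) \o (fun x => mx_tuple (F x))).
  apply: measurableT_comp; first exact: measurable_tuple_mx.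
  apply/measurable_fun_tnthP => l; case/mxvec_indexP: l => i j.
  rewrite (_ : _ \o _ = fun x => F x i j); first exact: mF.
  apply/funext => x /=.
  by rewrite tnth_mktuple mxvecE.
by apply/funext => x; apply/matrixP => i j /=; rewrite mxE tnth_mktuple mxvecE.
Qed.

Lemma open_mx_measurable (U : set 'M[R]_(m, n)) : open U -> measurable U.
Proof. by move=> oU; exact: sub_sigma_algebra. Qed.

Lemma mx_norm_le (X : 'M[R]_(m, n)) (M : R) :
  0 <= M -> (forall i j, `|X i j| <= M) -> `|X| <= M.
Proof.
move=> M0 XM; have [X0|/mx_norm_neq0[[i j] XE]] := eqVneq (mx_norm X) 0.
  by rewrite /Num.norm/= X0.
by rewrite /Num.norm/= XE.
Qed.

Lemma mx_entry_le_norm (X : 'M[R]_(m, n)) i j : `|X i j| <= `|X|.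
Proof.
rewrite [leRHS]/Num.norm/= mx_normrE; apply/bigmax_geP; right => /=.
by exists (i, j).
Qed.

Lemma bounded_mx_set (A : set 'M[R]_(m, n)) M :
  (forall X, A X -> forall i j, `|X i j| <= M) -> bounded_set A.
Proof.
move=> AM; exists (Num.max 0 M); split; first exact: num_real.
move=> r Mr X /AM XM /=; apply: mx_norm_le => [|i j].
  by rewrite (le_trans _ (ltW Mr))// le_max lexx.
by rewrite (le_trans (XM i j))// (le_trans _ (ltW Mr))// le_max lexx orbT.
Qed.

Lemma ball_mxP (X Y : 'M[R]_(m, n)) e : 0 < e ->
  ball X e Y <-> forall i j, `|X i j - Y i j| < e.
Proof. by move=> e0; split => [[_ XY] i j|XY]; [exact: XY|split]. Qed.

Lemma bounded_ball (X : 'M[R]_(m, n)) e : bounded_set (ball X e).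
Proof.
apply: (@bounded_mx_set _ (`|X| + e)) => Y [e0 XY] i j.
rewrite (_ : Y i j = X i j - (X i j - Y i j)); last by rewrite opprB addrC subrK.
rewrite (le_trans (ler_normB _ _))// lerD ?mx_entry_le_norm//.
by have := XY i j => /ltW.
Qed.

Lemma measurable_mx_ball (X : 'M[R]_(m, n)) e : measurable (ball X e).
Proof.
have [e0|e0] := ltP 0 e.
  by apply: open_mx_measurable; exact: ball_open.
rewrite (_ : ball X e = set0)//; apply/seteqP; split => // Y [/= e0'].
by rewrite ltNge e0 in e0'.
Qed.

End MatrixMeasurability.

Lemma compact_mx_box (R : realType) (m n : nat) (M : R) :
  compact [set X : 'M[R]_(m, n) | forall i j, - M <= X i j <= M].
Proof.
pose h (v : 'rV[R]_(m * n)) : 'M[R]_(m, n) := \matrix_(i, j) v ord0 (mxvec_index i j).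
have hc : continuous h.
  move=> v A /nbhs_ballP[e e0 hA]; apply/nbhs_ballP; exists e => // u vu; apply: hA.
  by split => // i j; rewrite !mxE; exact: vu.2.
have -> : [set X : 'M[R]_(m, n) | forall i j, - M <= X i j <= M] =
    h @` [set v : 'rV[R]_(m * n) | forall l, (`[- M, M]%classic : set R) (v ord0 l)].
  apply/seteqP; split => [X XM|_ [v vM <-] i j].
    exists (mxvec X); last by apply/matrixP => i j; rewrite mxE mxvecE.
    by case/mxvec_indexP => i j; rewrite mxvecE /= in_itv/=.
  by rewrite mxE; have := vM (mxvec_index i j); rewrite /= in_itv.
apply: continuous_compact; first exact: continuous_subspaceT.
apply: (@rV_compact R (m * n) (fun=> `[- M, M]%classic)) => l.
exact: segment_compact.
Qed.

Section Regions.
Variables (R : realType) (d : nat).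
Implicit Types (x y : 'rV[R]_d).

Lemma measurable_fun_enorm dT (T : measurableType dT) (F : T -> 'rV[R]_d) :
  (forall i, measurable_fun setT (fun w => F w ord0 i)) ->
  measurable_fun setT (fun w => enorm (F w)).
Proof.
move=> mF; have ms : measurable_fun setT (Num.sqrt : R -> R).
  by apply: continuous_measurable_fun; exact: sqrt_continuous.
apply: (measurableT_comp ms).
by apply: measurable_sum => i; exact: measurable_funX.
Qed.

Lemma measurable_eball x r : measurable (eball x r).
Proof.
rewrite /eball -[X in measurable X]setTI.
apply: (measurable_fun_ler (f := fun y => enorm (y - x)) (g := cst r)) => //.
apply: measurable_fun_enorm => i.
rewrite (_ : (fun w => _) = (fun y : 'rV[R]_d => y ord0 i - x ord0 i)).
  apply: measurable_funB => //; exact: measurable_mx_entry.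
by apply/funext => y; rewrite !mxE.
Qed.

Lemma measurable_eballs k (X : 'M[R]_(k, d)) r : measurable (eballs X r).
Proof. by apply: fin_bigcup_measurable => // i _; exact: measurable_eball. Qed.

Lemma bounded_eballs k (X : 'M[R]_(k, d)) r : bounded_set (eballs X r).
Proof.
apply: (@bounded_mx_set _ _ _ _ (`|X| + r)) => y [i _ /= yX] j l.
rewrite (_ : y j l = X i l + (y - row i X) ord0 l); last first.
  by rewrite !mxE ord1; ring.
rewrite (le_trans (ler_normD _ _))// lerD ?mx_entry_le_norm//.
exact: le_trans (coord_le_enorm _ _) yX.
Qed.

Lemma measurable_coord_le (i : 'I_d) (a b : R) :
  measurable [set x : 'rV[R]_d | a <= x ord0 i <= b].
Proof.
rewrite (_ : mkset _ = setT `&` (fun x : 'rV[R]_d => x ord0 i) @^-1` `[a, b]%classic).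
  by apply: measurable_mx_entry => //; exact: measurable_itv.
by rewrite setTI; apply/seteqP; split => x /=; rewrite in_itv.
Qed.

Lemma measurable_window n : measurable (@window R d n).
Proof.
rewrite (_ : window _ = \bigcap_(i in [set: 'I_d]) [set x : 'rV[R]_d |
    - (n%:R `^ d%:R^-1) / 2 <= x ord0 i <= n%:R `^ d%:R^-1 / 2]).
  by apply: fin_bigcap_measurable => // i _; exact: measurable_coord_le.
by apply/seteqP; split => [x xW i _|x xW i]; [exact: xW|exact: xW].
Qed.

Lemma bounded_window n : bounded_set (@window R d n).
Proof.
apply: (@bounded_mx_set _ _ _ _ (n%:R `^ d%:R^-1 / 2)) => x xW i j.
by rewrite ord1 ler_norml -mulNr; exact: xW.
Qed.

End Regions.

Lemma subset_bounded (R : realType) m n (A B : set 'M[R]_(m, n)) :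
  A `<=` B -> bounded_set B -> bounded_set A.
Proof.
move=> AB [M [Mr BM]]; exists M; split => // r Mr' x /AB; exact: BM.
Qed.

Section Counts.
Variables (R : realType) (d : nat).
Implicit Types (phi : config R d) (B C : set 'rV[R]_d).

Lemma mem_npoints phi B x : bounded_set B ->
  (x \in fset_set (phi `&` B)) = ((x \in points phi) && (x \in B)).
Proof.
move=> bB; rewrite in_fset_set ?in_setI//; exact: config_locally_finite.
Qed.

Lemma npoints_gt0P phi B : bounded_set B ->
  reflect (exists2 x, points phi x & B x) (0 < npoints phi B)%N.
Proof.
move=> bB; rewrite /npoints cardfs_gt0; apply: (iffP (fset0Pn _)) => -[x].
  by rewrite mem_npoints// => /andP[/set_mem ? /set_mem ?]; exists x.
by move=> px Bx; exists x; rewrite mem_npoints// !mem_set.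
Qed.

Lemma measurable_npoints_eq B n : measurable B -> bounded_set B ->
  measurable [set phi : config R d | npoints phi B = n].
Proof. by move=> mB bB; apply: sub_sigma_algebra; exists B, n. Qed.

Lemma measurable_npoints B : measurable B -> bounded_set B ->
  measurable_fun setT (fun phi : config R d => npoints phi B).
Proof.
move=> mB bB _ Y _; rewrite setTI.
rewrite (_ : _ @^-1` Y = \bigcup_(n in Y) [set phi : config R d | npoints phi B = n]).
  by apply: bigcup_measurable => n _; exact: measurable_npoints_eq.
by apply/seteqP; split => [phi Yphi|phi [n Yn /= pn]]; [exists (npoints phi B)|rewrite /= pn].
Qed.

(** The tuples in question are the injections of k indices into the finite set of
    points of phi in C. *)
Lemma counting_factorial_power phi C k : bounded_set C ->
  counting (factorial_power k phi `&` [set X | forall i, C (row i X)]) =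
  ((npoints phi C) ^_ k)%:R%:E :> \bar R.
Proof.
move=> bC; set A := _ `&` _; pose Q := fset_set (phi `&` C).
pose h (f : {ffun 'I_k -> Q}) : 'M[R]_(k, d) := \matrix_i val (f i).
have h_inj : injective h.
  move=> f f' /matrixP ff'; apply/ffunP => i; apply: val_inj; apply/rowP => j.
  by have := ff' i j; rewrite !mxE.
pose F := [fset h f | f in [pred f : {ffun 'I_k -> Q} | injectiveb f]]%fset.
have AE : A = [set` F].
  apply/seteqP; split => [X [[Xinj Xphi] XC]|X /= /imfsetP[f /= /injectiveP finj ->]].
    have XQ i : row i X \in Q by rewrite mem_npoints// !mem_set.
    have XE : X = h [ffun i => FSetSub (XQ i)].
      by apply/row_matrixP => i; rewrite rowK ffunE.
    apply/imfsetP; exists [ffun i => FSetSub (XQ i)] => //=.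
    apply/injectiveP => i i'; rewrite !ffunE => /(congr1 val)/=; exact: Xinj.
  have fQ i : points phi (val (f i)) /\ C (val (f i)).
    by have := valP (f i); rewrite mem_npoints// => /andP[/set_mem ? /set_mem].
  split; first split.
  - by move=> i i'; rewrite !rowK => /val_inj/finj.
  - by move=> i; rewrite rowK; exact: (fQ i).1.
  - by move=> i; rewrite rowK; exact: (fQ i).2.
rewrite AE /counting asboolT// set_fsetK card_imfset//= -cardE.
have := card_inj_ffuns 'I_k Q; rewrite card_ord -cardfE => <-.
by congr (_%:R%:E); rewrite cardsE.
Qed.

End Counts.

(** * Measurability of Betti numbers *)

Section Discretization.
Variables (R : realType) (d : nat).
Implicit Types (x y : 'rV[R]_d) (phi : config R d) (W : set 'rV[R]_d).

Definition grid_cell (m : nat) x : 'rV[int]_d :=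
  map_mx (fun t => Num.floor (m.+1%:R * t)) x.

Definition grid_point (m : nat) (a : 'rV[int]_d) : 'rV[R]_d :=
  map_mx (fun z : int => z%:~R / m.+1%:R) a.

Definition discretize m x := grid_point m (grid_cell m x).

Lemma enorm_discretize m x : enorm (x - discretize m x) <= d%:R / m.+1%:R.
Proof.
apply: enorm_le_coord => [|i]; first by rewrite invr_ge0.
rewrite !mxE -[X in X - _](mulKf (_ : m.+1%:R != 0)) ?pnatr_eq0//.
rewrite mulrC -mulrBl normrM [X in _ * X]gtr0_norm ?invr_gt0//.
rewrite ler_piMl ?invr_ge0//.
set t := m.+1%:R * x ord0 i.
have h1 : (Num.floor t)%:~R <= t by exact: floor_le.
have h2 : t < (Num.floor t + 1)%:~R by exact: floorD1_gt.
by rewrite ger0_norm ?subr_ge0// lerBlDl ltW// (lt_le_trans h2)// intrD.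
Qed.

Lemma enorm_discretize_diff m x y :
  `|enorm (discretize m x - discretize m y) - enorm (x - y)| <= 2 * (d%:R / m.+1%:R).
Proof.
have xm := enorm_discretize m x; have ym := enorm_discretize m y.
set x' := discretize m x in xm *; set y' := discretize m y in ym *.
have h1 := enorm_triangle x' x y; have h2 := enorm_triangle y' x' y.
have h3 := enorm_triangle x x' y'; have h4 := enorm_triangle y x y'.
have h5 := enormB x' x; have h6 := enormB y' y.
rewrite ler_distl; move: xm ym; set c := d%:R / _ => xm ym.
by apply/andP; split; lra.
Qed.

(** Rounding moves points by at most d/(m+1).  Enlarging the radius by twice this
    keeps all edges, and as Q is finite, distinct points stay distinct and no new
    edge appears once the mesh is small compared with the distances and with the
    differences between r and the larger distances. *)
Lemma near_betti_discretize (Q : {fset 'rV[R]_d}) r k : 0 <= r -> (0 < k)%N ->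
  \forall m \near \oo,
    (betti (rips [fset discretize m x | x in Q]%fset (r + 2 * (d%:R / m.+1%:R))) k == 0%N) =
    (betti (rips Q r) k == 0%N).
Proof.
move=> r0 k0.
have small (e : R) : 0 < e -> \forall m \near \oo, 4 * (d%:R / m.+1%:R) < e.
  move=> e0; have c0 : 0 < 4 * d%:R + 1 :> R by rewrite ltr_wpDl ?mulr_ge0.
  have e'0 : 0 < e / (4 * d%:R + 1) by rewrite divr_gt0.
  have := near_infty_natSinv_lt (PosNum e'0); apply: filterS => m /=.
  rewrite ltr_pdivlMr// => me; apply: le_lt_trans me.
  by rewrite mulrA mulrC ler_wpM2l ?invr_ge0// lerDl ler01.
have near_pair (x y : 'rV[R]_d) : \forall m \near \oo,
    (discretize m x = discretize m y -> x = y) /\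
    (enorm (discretize m x - discretize m y) <= r + 2 * (d%:R / m.+1%:R))
     = (enorm (x - y) <= r).
  have near1 : \forall m \near \oo, discretize m x = discretize m y -> x = y.
    have [->|xy] := eqVneq x y; first by near=> m.
    have xy0 : 0 < enorm (x - y).
      rewrite lt_def enorm_ge0 andbT; apply: contraNneq xy => /enorm_eq0/eqP.
      by rewrite subr_eq0.
    apply: filterS (small _ xy0) => m mxy dxy; exfalso.
    have := enorm_discretize_diff m x y; rewrite dxy subrr enorm0 sub0r normrN.
    rewrite ger0_norm ?enorm_ge0// => xyd.
    have c0 : 0 <= d%:R / m.+1%:R :> R by rewrite divr_ge0.
    suff : enorm (x - y) < enorm (x - y) by rewrite ltxx.
    set c := _ / _ in mxy xyd c0; set e := enorm _ in mxy xyd *; lra.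
  have near2 : \forall m \near \oo,
     (enorm (discretize m x - discretize m y) <= r + 2 * (d%:R / m.+1%:R)) = (enorm (x - y) <= r).
    have [xyr|xyr] := leP (enorm (x - y)) r.
      near=> m; have := enorm_discretize_diff m x y.
      rewrite ler_norml => /andP[_ h]; apply/idP; rewrite lerBlDr in h.
      by rewrite (le_trans h)// addrC lerD2r.
    have xyr0 : 0 < enorm (x - y) - r by rewrite subr_gt0.
    apply: filterS (small _ xyr0) => m mxy.
    have := enorm_discretize_diff m x y.
    rewrite ler_norml => /andP[h _]; apply/negbTE; rewrite -ltNge.
    by set c := _ / _ in mxy h *; set a := enorm _ in mxy h *; set b := enorm _ in h *; lra.
  by near=> m; split; near: m.
have near_all : \forall m \near \oo, forall p : Q * Q,
    (discretize m (val p.1) = discretize m (val p.2) -> val p.1 = val p.2) /\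
    (enorm (discretize m (val p.1) - discretize m (val p.2)) <=
      r + 2 * (d%:R / m.+1%:R)) = (enorm (val p.1 - val p.2) <= r).
  by apply: filter_forall => p; exact: near_pair.
apply: filterS near_all => m mQ.
have fst_of x y : x \in Q -> y \in Q -> exists p : Q * Q, val p.1 = x /\ val p.2 = y.
  by move=> xQ yQ; exists (FSetSub xQ, FSetSub yQ).
apply/esym/betti_rips_iso => //.
- by rewrite addr_ge0// mulr_ge0// divr_ge0.
- by move=> x y /fst_of h /h[p [<- <-]]; exact: (mQ p).1.
- by move=> x y /fst_of h /h[p [<- <-]]; exact: (mQ p).2.
Unshelve. all: by end_near. Qed.

(** The complex of the rounded points depends only on which cells of a countable
    grid are occupied, so its Betti number vanishes on a countable union of
    events defined by counts.  Refining the grid recovers the original complex. *)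
Lemma measurable_betti_eq0 W r k : 0 <= r -> (0 < k)%N ->
  measurable W -> bounded_set W ->
  measurable [set phi : config R d | betti (rips (fset_set (phi `&` W)) r) k = 0%N].
Proof.
move=> r0 k0 mW bW.
pose q m phi := [fset grid_cell m x | x in fset_set (points phi `&` W)]%fset.
pose cell m a := W `&` [set x | grid_cell m x = a].
have mcell m a : measurable (cell m a).
  apply: measurableI => //.
  rewrite (_ : mkset _ = \bigcap_(i in [set: 'I_d]) ((fun x : 'rV[R]_d => x ord0 i) @^-1`
      [set t | Num.floor (m.+1%:R * t) = a ord0 i])).
    apply: fin_bigcap_measurable => // i _; rewrite -[X in measurable X]setTI.
    apply: measurable_mx_entry => //.
    rewrite (_ : mkset _ = `[(a ord0 i)%:~R / m.+1%:R, (a ord0 i + 1)%:~R / m.+1%:R[%classic) //.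
    apply/seteqP; split => t /=; rewrite in_itv/= ler_pdivrMr// ltr_pdivlMr// mulrC.
      by move=> <-; exact: floor_itv.
    by move=> ta; apply: floor_def.
  apply/seteqP; split => [x <- i _|x xa]/=; first by rewrite mxE.
  by apply/rowP => i; rewrite mxE; exact: xa.
have bcell m a : bounded_set (cell m a) by apply: subset_bounded bW => x [].
have qE m phi a : (a \in q m phi) = (0 < npoints phi (cell m a))%N.
  apply/imfsetP/npoints_gt0P => // [[x /=]|[x px [Wx xa]]].
    by rewrite mem_npoints// => /andP[/set_mem px /set_mem Wx] ->; exists x.
  by exists x => //=; rewrite mem_npoints// !mem_set.
have mq m (s : {fset 'rV[int]_d}) : measurable [set phi | q m phi = s].
  have -> : [set phi | q m phi = s] = ~` \bigcup_(a in [set: 'rV[int]_d])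
      [set phi | (0 < npoints phi (cell m a))%N <> (a \in s)].
    apply/seteqP; split => [phi /= <- [a _ /=]|phi h]; first by rewrite qE.
    apply/fsetP => a; rewrite qE; apply: contrapT => na; apply: h.
    by exists a.
  apply: measurableC; apply: countable_bigcupT_measurable => [|a].
    exact: countableP.
  rewrite -[X in measurable X]setTI.
  apply: (measurable_npoints (mcell m a) (bcell m a) measurableT
    (Y := [set c | (0 < c)%N <> (a \in s)])).
  by [].
pose E m := [set phi : config R d |
  betti (rips [fset discretize m x | x in fset_set (points phi `&` W)]%fset
    (r + 2 * (d%:R / m.+1%:R))) k == 0%N].
have mE m : measurable (E m).
  have -> : E m = \bigcup_(s in [set s : {fset 'rV[int]_d} |
      betti (rips [fset grid_point m a | a in s]%fset (r + 2 * (d%:R / m.+1%:R))) k == 0%N])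
      [set phi | q m phi = s].
    have EE phi : [fset discretize m x | x in fset_set (points phi `&` W)]%fset =
        [fset grid_point m a | a in q m phi]%fset.
      apply/fsetP => y; apply/imfsetP/imfsetP => -[x /= xQ ->].
        exists (grid_cell m x) => //; apply/imfsetP; by exists x.
      by move/imfsetP: xQ => [z /= zQ ->]; exists z.
    apply/seteqP; split => [phi|phi [s /= bs sE]]; rewrite /E/= EE; last by rewrite sE.
    by move=> h; exists (q m phi).
  rewrite bigcup_mkcond; apply: countable_bigcupT_measurable => [|s].
    exact: countableP.
  by case: ifPn.
rewrite (_ : mkset _ = \bigcup_N \bigcap_(m in [set m | (N <= m)%N]) E m).
  by apply: bigcup_measurable => N _; apply: bigcap_measurableType => m _.
apply/seteqP; split => [phi b0|phi [N _ NE]].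
  have [N _ NE] := near_betti_discretize (fset_set (points phi `&` W)) r0 k0.
  by exists N => // m /NE /=; rewrite /E/= b0 eqxx.
have [N' _ NE'] := near_betti_discretize (fset_set (points phi `&` W)) r0 k0.
have := NE (maxn N N') (leq_maxl _ _); rewrite /E/= NE' => [/eqP//|].
exact: leq_maxr.
Qed.

Lemma measurable_config_event dT (T : measurableType dT)
    (Phi : {mfun T >-> config R d}) (E : set (config R d)) :
  measurable E -> measurable [set w | E (Phi w)].
Proof.
move=> mE; rewrite -[X in measurable X]setTI.
exact: (@measurable_funPT _ _ _ _ Phi measurableT E mE).
Qed.

Lemma measurable_rips_betti_eq0 dT (T : measurableType dT)
    (Phi : {mfun T >-> config R d}) r k n : 0 <= r -> (0 < k)%N ->
  measurable [set w | rips_betti Phi k n r w = 0%N].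
Proof.
move=> r0 k0; exact: (measurable_config_event Phi
  (measurable_betti_eq0 r0 k0 (@measurable_window R d n) (@bounded_window R d n))).
Qed.

End Discretization.

(** * Lebesgue measure on tuples of points *)

Section LebesgueMatrix.
Variables (R : realType) (m n : nat).
Local Notation M := 'M[R]_(m, n).
Local Notation mu1 := (@lebesgue_measure R).

Definition mx_box (S : 'I_m -> 'I_n -> set R) : set M :=
  [set X | forall i j, S i j (X i j)].

Definition mx_boxes : set (set M) :=
  [set A | exists2 S, forall i j, measurable (S i j) & A = mx_box S].

Lemma measurable_mx_box S : (forall i j, measurable (S i j)) ->
  measurable (mx_box S).
Proof.
move=> mS; rewrite (_ : mx_box S = \bigcap_(i in [set: 'I_m])
    \bigcap_(j in [set: 'I_n]) ((fun X : M => X i j) @^-1` S i j)).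
  apply: fin_bigcap_measurable => // i _; apply: fin_bigcap_measurable => // j _.
  by rewrite -[X in measurable X]setTI; apply: measurable_mx_entry.
by apply/seteqP; split => [X XS i _ j _|X XS i j]; [exact: XS|exact: (XS i I j I)].
Qed.

(** A Borel set of matrices is the preimage of a measurable set of tuples under
    [mx_tuple], whose coordinates are measurable for the boxes. *)
Lemma measurable_mx_boxes : @measurable _ M = <<s mx_boxes >>.
Proof.
apply/seteqP; split => [A mA|A]; last first.
  apply: smallest_sub; first exact: sigma_algebra_measurable.
  by move=> _ [S mS ->]; exact: measurable_mx_box.
have mt : measurable (@tuple_mx R m n @^-1` A).
  by rewrite -[X in measurable X]setTI; exact: measurable_tuple_mx.
have mf : measurable_fun setT (@mx_tuple R m n : g_sigma_algebraType mx_boxes -> _).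
  apply/measurable_fun_tnthP => l; case/mxvec_indexP: l => i0 j0 _ Y mY.
  rewrite setTI; apply: sub_sigma_algebra.
  exists (fun i j => if (i == i0) && (j == j0) then Y else setT).
    by move=> i j; case: ifP.
  apply/seteqP; split => [X /= XY i j|X XY /=].
    by case: ifPn => // /andP[/eqP -> /eqP ->]; move: XY; rewrite tnth_mktuple mxvecE.
  by have := XY i0 j0; rewrite !eqxx/= tnth_mktuple mxvecE.
have := mf measurableT _ mt; rewrite setTI.
congr (<<s _ >> _); apply/seteqP; rewrite /preimage; split => X /=.
  by rewrite (_ : tuple_mx (mx_tuple X) = X)//; apply/matrixP => i j;
    rewrite mxE tnth_mktuple mxvecE.
by rewrite (_ : tuple_mx (mx_tuple X) = X)//; apply/matrixP => i j;
  rewrite mxE tnth_mktuple mxvecE.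
Qed.

Lemma lebesgue_mx_unique (mu : {measure set M -> \bar R}) :
  (forall S, (forall i j, measurable (S i j)) ->
    mu (mx_box S) = (\prod_(i < m) \prod_(j < n) mu1 (S i j))%E) ->
  forall A, measurable A -> lebesgue_mx R m n A = mu A.
Proof.
move=> muE; pose g k := mx_box (fun _ _ => `]- k%:R, k%:R[%classic : set R).
apply: (measure_unique mx_boxes g).
- exact: measurable_mx_boxes.
- move=> _ _ [S mS ->] [S' mS' ->]; exists (fun i j => S i j `&` S' i j).
    by move=> i j; exact: measurableI.
  apply/seteqP; split => [X [XS XS'] i j|X XS]; first by split.
  by split => i j; have [] := XS i j.
- by move=> k; exists (fun _ _ => `]- k%:R, k%:R[%classic : set R).
- apply/seteqP; split => // X _; exists (Num.truncn `|X|).+1 => // i j /=.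
  rewrite in_itv/= -ltr_norml (le_lt_trans (mx_entry_le_norm X i j))//.
  exact: truncnS_gt.
- by move=> _ [S mS ->]; rewrite muE//; exact: lebesgue_mx_box.
- move=> k; have gE := @lebesgue_mx_box R m n (fun _ _ => `]- k%:R, k%:R[%classic)
    (fun _ _ => measurable_itv _).
  rewrite [X in (X < _)%E]gE.
  have fin : mu1 `]- k%:R, k%:R[%classic \is a fin_num.
    by rewrite lebesgue_measure_itv/=; case: ifP.
  rewrite -(fineK fin) (eq_bigr (fun=> (\prod_(j < n)
    (fine (mu1 `]- k%:R, k%:R[%classic)))%:E)) ?prodEFin ?ltry//.
Qed.

End LebesgueMatrix.

Lemma lebesgue_measure_affine (R : realType) (b v : R) (S : set R) : 0 < b ->
  measurable S -> (@lebesgue_measure R S =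
    b%:E * @lebesgue_measure R ((fun x => b * x + v)%R @^-1` S))%E.
Proof.
move=> b0 mS; pose f (x : R) : measurableTypeR R := b * x + v.
have mf : measurable_fun setT f.
  by apply: measurable_funD => //; exact: mulrl_measurable.
pose bn : {nonneg R} := NngNum (ltW b0).
apply: (lebesgue_measure_unique (mu := mscale bn (pushforward (@lebesgue_measure R) f))) => //.
move=> _ [[x y] _ <-].
rewrite -[RHS]/(b%:E * lebesgue_measure (f @^-1` `]x, y]%classic))%E.
rewrite (_ : f @^-1` _ = `](x - v) / b, (y - v) / b]%classic).
  rewrite !lebesgue_measure_itv/= !lte_fin ltr_pM2r ?invr_gt0// ltrD2r.
  case: ifP => // _; last by rewrite mule0.
  rewrite -!EFinD -EFinM; congr EFin.
  by field; rewrite gt_eqF.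
apply/seteqP; split => z; rewrite /f /= !in_itv/= ltr_pdivrMr// ler_pdivlMr//.
  by rewrite ltrBlDr lerBrDr mulrC.
by rewrite ltrBlDr lerBrDr mulrC.
Qed.

Section AffineChange.
Variables (R : realType) (m n : nat).
Local Notation M := 'M[R]_(m, n).
Local Notation lam := (lebesgue_mx R m n).

Lemma measurable_affine (b : R) (V : M) :
  measurable_fun setT (fun X : M => b *: X + V).
Proof.
apply: measurable_fun_mx => i j.
rewrite (_ : (fun x => _) = (fun X : M => b * X i j + V i j)); last first.
  by apply/funext => X; rewrite !mxE.
apply: measurable_funD => //; apply: measurable_funM => //.
exact: measurable_mx_entry.
Qed.

Lemma measurable_affine_preimage (b : R) (V : M) (A : set M) :
  measurable A -> measurable ((fun X => b *: X + V) @^-1` A).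
Proof.
by move=> mA; rewrite -[X in measurable X]setTI; exact: measurable_affine.
Qed.

Lemma lebesgue_mx_affine (b : R) (V : M) (A : set M) : 0 < b -> measurable A ->
  lam A = ((b ^+ (m * n))%:E * lam ((fun X => b *: X + V)%R @^-1` A))%E.
Proof.
move=> b0 mA; have bn0 : 0 <= b ^+ (m * n) by rewrite exprn_ge0// ltW.
have mf := measurable_affine b V.
apply: (lebesgue_mx_unique (mu := mscale (NngNum bn0)
  (pushforward lam (fun X : M => b *: X + V)))) => // S mS.
pose S' i j := (fun x => b * x + V i j) @^-1` S i j.
have mS' i j : measurable (S' i j).
  rewrite -[X in measurable X]setTI.
  have : measurable_fun setT (fun x : R => b * x + V i j).
    by apply: measurable_funD => //; exact: mulrl_measurable.
  by apply.
rewrite -[LHS]/((b ^+ (m * n))%:E * lam ((fun X : M => b *: X + V)%R @^-1` mx_box S))%E.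
have -> : (fun X : M => b *: X + V) @^-1` mx_box S =
    [set X | forall i j, S' i j (X i j)].
  by apply/seteqP; split => X XS i j; have := XS i j; rewrite /S' /= !mxE.
rewrite (lebesgue_mx_box mS').
rewrite [RHS](eq_bigr (fun i => (b ^+ n)%:E * \prod_(j < n) lebesgue_measure (S' i j))%E).
  by rewrite big_split/= prodEFin prodr_const card_ord -exprM mulnC.
move=> i _; rewrite (eq_bigr (fun j => b%:E * lebesgue_measure (S' i j))%E).
  by rewrite big_split/= prodEFin prodr_const card_ord.
by move=> j _; exact: lebesgue_measure_affine.
Qed.

Lemma integral_mx_affine (b : R) (V : M) (A : set M) (h : M -> \bar R) : 0 < b ->
  measurable A -> measurable_fun setT h -> (forall X, 0 <= h X)%E ->
  (\int[lam]_(X in A) h X = (b ^+ (m * n))%:E *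
    \int[lam]_(X in (fun X => b *: X + V)%R @^-1` A) h (b *: X + V)%R)%E.
Proof.
move=> b0 mA mh h0; have bn0 : 0 <= b ^+ (m * n) by rewrite exprn_ge0// ltW.
have mf := measurable_affine b V.
rewrite (eq_measure_integral (mscale (NngNum bn0)
  (pushforward lam (fun X : M => b *: X + V)))) => [|B mB _]; last first.
  exact: lebesgue_mx_affine.
rewrite ge0_integral_mscale//; last exact: measurable_funTS.
rewrite (ge0_integral_pushforward mf)//; first exact: measurable_funTS.
Qed.

Lemma lebesgue_mx_affine_null (b : R) (V : M) (A : set M) : 0 < b -> measurable A ->
  lam ((fun X => b *: X + V) @^-1` A) = 0%E <-> lam A = 0%E.
Proof.
move=> b0 mA; rewrite (lebesgue_mx_affine V b0 mA).
split => [->|/eqP]; first by rewrite mule0.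
by rewrite mule_eq0 eqe expf_eq0 (gt_eqF b0) andbF => /eqP.
Qed.

(** The dilates of a bounded part of A by the factors 1 + 1/i are disjoint, have
    at least its volume, and lie in a bounded box.  This applies to level sets of
    homogeneous functions, such as the tuples with two points at distance 1. *)
Lemma lebesgue_mx_scale_transversal (A : set M) : measurable A ->
  (forall X s, 1 < s -> A X -> A (s *: X) -> False) -> lam A = 0%E.
Proof.
move=> mA trans.
suff null K : lam (A `&` mx_box (fun _ _ => `]- K%:R, K%:R[%classic)) = 0%E.
  have -> : A = \bigcup_K (A `&` mx_box (fun _ _ => `]- K%:R, K%:R[%classic)).
    apply/seteqP; split => [X AX|X [K _ []//]].
    exists (Num.truncn `|X|).+1 => //; split => // i j /=.
    rewrite in_itv/= -ltr_norml (le_lt_trans (mx_entry_le_norm X i j))//.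
    exact: truncnS_gt.
  have mB K : measurable (A `&` mx_box (fun _ _ => `]- K%:R, K%:R[%classic)).
    by apply: measurableI => //; exact: measurable_mx_box.
  apply/negligibleP; first exact: bigcupT_measurable.
  apply: negligible_bigcup => K.
  by apply/negligibleP; [exact: mB|exact: null].
set B := A `&` _.
have mB : measurable B.
  by apply: measurableI => //; exact: measurable_mx_box.
pose s i : R := 1 + i.+1%:R^-1.
have s1 i : 1 < s i by rewrite ltrDl.
have s0 i : 0 < s i by rewrite (lt_trans ltr01).
pose C i := (fun X : M => (s i)^-1 *: X + 0) @^-1` B.
have mC i : measurable (C i) by exact: measurable_affine_preimage.
have lamC i : (lam B <= lam (C i))%E.
  rewrite [leRHS](lebesgue_mx_affine 0 (s0 i) (mC i)).
  have -> : (fun X : M => s i *: X + 0) @^-1` C i = B.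
    apply/seteqP; rewrite /C; split => X /=;
      by rewrite addr0 addr0 scalerA mulVf ?gt_eqF// scale1r.
  by rewrite lee_pemull// lee_fin exprn_ege1// ltW.
have sub i : C i `<=` mx_box (fun _ _ => `]- (2 * K%:R), 2 * K%:R[%classic).
  move=> X [_ XK] a c /=; have := XK a c; rewrite /= !in_itv/= !mxE addr0.
  rewrite -!ltr_norml normrM gtr0_norm ?invr_gt0// mulrC ltr_pdivrMr//.
  move=> /lt_le_trans; apply; rewrite mulrC ler_wpM2r// /s.
  by rewrite -[2]/(1 + 1) lerD2l invf_le1// ler1n.
have tC : trivIset setT C.
  apply/trivIsetP => i j _ _ ij; apply/seteqP; split => // X [].
  wlog ltij : i j ij / (i < j)%N.
    move=> W; case: (ltngtP i j) => [/(W _ _ ij)//|ji Ci Cj|ij']; last first.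
      by rewrite ij' eqxx in ij.
    by apply: (W _ _ _ ji) => //; rewrite eq_sym.
  rewrite /C/= !addr0 => -[AX _] [AX' _].
  apply: (trans _ (s i / s j) _ AX).
    rewrite ltr_pdivlMr// mul1r /s ltrD2l ltf_pV2 ?posrE//.
    by rewrite ltr_nat.
  by rewrite scalerA mulrAC divff ?mul1r// gt_eqF.
pose D : set M := @mx_box R m n (fun _ _ => `]- (2 * K%:R), 2 * K%:R[%classic).
have Dfin : lam D \is a fin_num.
  have -> : lam D = _ := @lebesgue_mx_box R m n (fun _ _ => `]- (2 * K%:R), 2 * K%:R[%classic)
    (fun _ _ => measurable_itv _).
  rewrite prode_fin_num// => i _; rewrite prode_fin_num// => j _.
  by rewrite lebesgue_measure_itv/=; case: ifP.
have mD : measurable D by exact: measurable_mx_box.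
have bound N : (N%:R%:E * lam B <= lam D)%E.
  apply: (@le_trans _ _ (lam (\big[setU/set0]_(i < N) C i))).
    rewrite (measure_bigsetU lam mC tC).
    rewrite (_ : _ * _ = \sum_(i < N) lam B)%E; last first.
      elim: N => [|N IH]; first by rewrite big_ord0 mul0e.
      by rewrite big_ord_recr/= -IH -natr1 EFinD ge0_muleDl ?lee_fin// mul1e.
    by apply: lee_sum => i _; exact: lamC.
  apply: le_measure; rewrite ?inE//; first exact: bigsetU_measurable.
  by rewrite -bigcup_mkord => X [i _ /sub].
have Bfin : lam B \is a fin_num.
  rewrite ge0_fin_numE//; apply: (@le_lt_trans _ _ (lam D)).
    by have := bound 1%N; rewrite mul1e.
  by rewrite ltey_eq Dfin.
rewrite -(fineK Bfin) -(fineK Dfin) in bound *.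
congr EFin; apply/eqP; rewrite eq_le fine_ge0 ?andbT//.
rewrite leNgt; apply/negP => b0.
have := bound (Num.truncn (fine (lam D) / fine (lam B))).+1.
rewrite -EFinM lee_fin leNgt => /negP; apply.
by rewrite -ltr_pdivrMr// truncnS_gt.
Qed.

End AffineChange.

Section FirstRow.
Variables (R : realType) (m n : nat).

Definition cons_row (p : 'rV[R]_n * 'M[R]_(m, n)) : 'M[R]_(m.+1, n) :=
  col_mx p.1 p.2.

Lemma cons_row_head p (i : 'I_1) j : cons_row p (lshift m i) j = p.1 i j.
Proof. exact: col_mxEu. Qed.

Lemma cons_row_tail p (i : 'I_m) j : cons_row p (rshift 1 i) j = p.2 i j.
Proof. exact: col_mxEd. Qed.

Lemma measurable_cons_row : measurable_fun setT cons_row.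
Proof.
apply: (@measurable_fun_mx R m.+1 n) => i j.
case: (splitP (i : 'I_(1 + m))) => i' iE.
  rewrite (_ : (fun x => _) = (fun p : 'rV[R]_n * 'M[R]_(m, n) => p.1 i' j)).
    exact: (measurableT_comp (@measurable_mx_entry R 1 n i' j) measurable_fst).
  apply/funext => p; have -> : i = lshift m i' by exact: val_inj.
  exact: cons_row_head.
rewrite (_ : (fun x => _) = (fun p : 'rV[R]_n * 'M[R]_(m, n) => p.2 i' j)).
  exact: (measurableT_comp (@measurable_mx_entry R m n i' j) measurable_snd).
apply/funext => p; have -> : i = rshift 1 i' by exact: val_inj.
exact: cons_row_tail.
Qed.

Lemma lebesgue_mx_cons_row (A : set 'M[R]_(m.+1, n)) : measurable A ->
  lebesgue_mx R m.+1 n A = (lebesgue_mx R 1 n \x lebesgue_mx R m n)%E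
    (cons_row @^-1` A).
Proof.
have mc := measurable_cons_row.
apply: (lebesgue_mx_unique (mu := pushforward (lebesgue_mx R 1 n \x lebesgue_mx R m n)%E
  cons_row)) => // S mS.
rewrite -[LHS]/((lebesgue_mx R 1 n \x lebesgue_mx R m n)%E _).
have -> : cons_row @^-1` mx_box S =
  mx_box (fun (i : 'I_1) j => S (lshift m i) j) `*` mx_box (fun (i : 'I_m) j => S (rshift 1 i) j).
  apply/seteqP; split => [p pS|p [pS1 pS2] i j].
    split=> i j; first by rewrite -cons_row_head; exact: pS.
    by rewrite -cons_row_tail; exact: pS.
  case: (splitP (i : 'I_(1 + m))) => i' iE.
    have -> : i = lshift m i' by exact: val_inj.
    by rewrite cons_row_head; exact: pS1.
  have -> : i = rshift 1 i' by exact: val_inj.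
  by rewrite cons_row_tail; exact: pS2.
rewrite product_measure1E; [|exact: measurable_mx_box..].
rewrite [X in (X * _)%E]lebesgue_mx_box// [X in (_ * X)%E]lebesgue_mx_box//.
by rewrite [RHS](@big_split_ord _ _ _ 1 m).
Qed.

(** Passes from a null set of tuples to tuples with a prescribed first point, which
    themselves form a null set and so are invisible to almost everywhere
    statements about all tuples. *)
Lemma lebesgue_mx_null_section (A : set 'M[R]_(m.+1, n)) : measurable A ->
  lebesgue_mx R m.+1 n A = 0%E ->
  exists x : 'rV[R]_n, lebesgue_mx R m n [set Z | A (col_mx x Z)] = 0%E.
Proof.
move=> mA; rewrite lebesgue_mx_cons_row//; set B := _ @^-1` A => B0.
have mB : measurable B.
  by rewrite -[X in measurable X]setTI; exact: measurable_cons_row.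
have mx := measurable_fun_xsection (lebesgue_mx R m n) mB.
have xE x : xsection B x = [set Z | A (col_mx x Z)].
  by apply/seteqP; split => Z; rewrite /xsection /= ?in_setE.
apply: contrapT => none.
have pos x : (0 < lebesgue_mx R m n (xsection B x))%E.
  rewrite lt_neqAle measure_ge0 andbT; apply/eqP => x0; apply: none.
  by exists x; rewrite -xE -x0.
have /ae_eq_integral_abs : measurable_fun setT
    (lebesgue_mx R m n \o xsection B) by [].
move=> /(_ (lebesgue_mx R 1 n) measurableT) [+ _].
have -> : (\int[lebesgue_mx R 1 n]_x `|(lebesgue_mx R m n \o xsection B) x| =
   (lebesgue_mx R 1 n \x lebesgue_mx R m n) B)%E.
  by apply: eq_integral => x _; rewrite gee0_abs.
rewrite B0 => /(_ erefl)[N [mN N0 sN]].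
have NT : N = setT.
  apply/seteqP; split => // x _; apply: sN => /= /(_ Logic.I) h.
  by have := pos x; rewrite h ltxx.
pose I (_ : 'I_1) (_ : 'I_n) : set R := `]0, 1[%classic.
have mI i j : measurable (I i j) by exact: measurable_itv.
have : (lebesgue_mx R 1 n (mx_box I) <= lebesgue_mx R 1 n N)%E.
  by rewrite NT; apply: le_measure; rewrite ?inE//; exact: measurable_mx_box.
have -> : lebesgue_mx R 1 n (mx_box I) = _ := lebesgue_mx_box mI.
rewrite N0 big1 ?lee_fin ?ler10// => i _; rewrite big1// => j _.
by rewrite lebesgue_measure_itv/= lte_fin ltr01 oppr0 adde0.
Qed.

End FirstRow.

(** * Volumes of clusters *)

Section Probability.
Context (dT : measure_display) (T : measurableType dT) (R : realType).
Variable P : probability T R.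

Lemma cvg_probability1 (E : nat -> set T) : (forall n, measurable (E n)) ->
  (forall e : R, 0 < e -> \forall n \near \oo, (P (~` E n) <= e%:E)%E) ->
  P (E n) @[n --> \oo] --> 1%E.
Proof.
move=> mE small; have fin n : P (E n) \is a fin_num by exact: fin_num_measure.
apply: cvg_EFin; first by near=> n.
apply/cvgrPdist_le => e e0; apply: filterS (small e e0) => n.
rewrite probability_setC// -(fineK (fin n)) -EFinB lee_fin => Pe.
by rewrite /= ger0_norm// subr_ge0 -lee_fin fineK// probability_le1.
Unshelve. all: by end_near. Qed.

End Probability.

Lemma row_cons_row0 (R : realType) m n (p : 'rV[R]_n * 'M[R]_(m, n)) :
  row ord0 (cons_row p) = p.1.
Proof.
apply/rowP => j; rewrite mxE -(cons_row_head p ord0 j); congr (cons_row p _ j).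
exact: val_inj.
Qed.

Lemma row_cons_rowS (R : realType) m n (p : 'rV[R]_n * 'M[R]_(m, n)) (i : 'I_m) :
  row (lift ord0 i) (cons_row p) = row i p.2.
Proof.
apply/rowP => j; rewrite [LHS]mxE [RHS]mxE -(cons_row_tail p i j); congr (cons_row p _ j).
exact: val_inj.
Qed.

Section Volumes.
Variables (R : realType) (d : nat).

Lemma lebesgue_mx_ball m n (X : 'M[R]_(m, n)) (e : R) : 0 < e ->
  lebesgue_mx R m n (ball X e) = ((2 * e) ^+ (m * n))%:E.
Proof.
move=> e0; pose S i j : set R := `]X i j - e, X i j + e[%classic.
have mS i j : measurable (S i j) by exact: measurable_itv.
have -> : ball X e = mx_box S.
  apply/seteqP; split => [Y [_ XY] i j|Y YS]; rewrite /S/=.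
    have := XY i j; rewrite /ball/= ltr_distlC => /andP[h1 h2].
    by rewrite in_itv/= h1 h2.
  split => // i j; have := YS i j; rewrite /S/= in_itv/= => /andP[h1 h2].
  by rewrite /ball/= ltr_distlC h1 h2.
have -> : lebesgue_mx R m n (mx_box S) = _ := lebesgue_mx_box mS.
rewrite (eq_bigr (fun=> ((2 * e) ^+ n)%:E)) => [|i _].
  by rewrite prodEFin prodr_const card_ord -exprM mulnC.
rewrite (eq_bigr (fun=> (2 * e)%:E)) => [|j _].
  by rewrite prodEFin prodr_const card_ord.
rewrite lebesgue_measure_itv/= lte_fin ifT; last by rewrite ltrD2l gtrN.
by rewrite -EFinB; congr EFin; ring.
Qed.

Lemma lebesgue_mx_window n : (0 < d)%N ->
  lebesgue_mx R 1 d (@window R d n) = n%:R%:E.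
Proof.
move=> d0; set h := n%:R `^ d%:R^-1 : R.
have h0 : 0 <= h by exact: powR_ge0.
pose S (_ : 'I_1) (_ : 'I_d) : set R := `[- h / 2, h / 2]%classic.
have mS i j : measurable (S i j) by exact: measurable_itv.
have -> : @window R d n = mx_box S.
  apply/seteqP; split => [x xW i j|x xS i]; rewrite /S/=.
    by rewrite in_itv/= ord1; exact: xW.
  by have := xS ord0 i; rewrite /S/= in_itv.
have -> : lebesgue_mx R 1 d (mx_box S) = _ := lebesgue_mx_box mS.
rewrite big_ord1 (eq_bigr (fun=> h%:E)) => [|j _].
  rewrite prodEFin prodr_const card_ord -powR_mulrn// -powRrM mulVf ?pnatr_eq0 -?lt0n//.
  by rewrite powRr1.
rewrite lebesgue_measure_itv/= lte_fin; case: ifPn => [_|].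
  by rewrite -EFinB; congr EFin; field.
rewrite -leNgt => hh; congr EFin; apply/eqP; rewrite eq_le h0/=.
by move: hh; lra.
Qed.

Definition spread k (X : 'M[R]_(k.+1, d)) r : Prop :=
  forall i, enorm (row i X - row ord0 X) <= r.

Lemma measurable_spread k r : measurable [set X : 'M[R]_(k.+1, d) | spread X r].
Proof.
rewrite (_ : mkset _ = \bigcap_(i in [set: 'I_k.+1])
    [set X : 'M[R]_(k.+1, d) | enorm (row i X - row ord0 X) <= r]).
  apply: fin_bigcap_measurable => // i _.
  rewrite -[X in measurable X]setTI.
  apply: (measurable_fun_ler
    (f := fun X : 'M[R]_(k.+1, d) => enorm (row i X - row ord0 X)) (g := cst r)) => //.
  apply: measurable_fun_enorm => l.
  rewrite (_ : (fun w => _) = (fun X : 'M[R]_(k.+1, d) => X i l - X ord0 l)).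
    by apply: measurable_funB; exact: measurable_mx_entry.
  by apply/funext => X; rewrite !mxE.
by apply/seteqP; split => [X XS i _|X XS i]; [exact: XS|exact: (XS i I)].
Qed.

Lemma measurable_spread_window k n r :
  measurable [set X : 'M[R]_(k.+1, d) | @window R d n (row ord0 X) /\ spread X r].
Proof.
apply: measurableI; last exact: measurable_spread.
rewrite -[X in measurable X]setTI.
have : measurable_fun setT (fun X : 'M[R]_(k.+1, d) => row ord0 X).
  apply: measurable_fun_mx => i j.
  rewrite (_ : (fun X => _) = (fun X : 'M[R]_(k.+1, d) => X ord0 j)).
    exact: measurable_mx_entry.
  by apply/funext => X; rewrite mxE.
by apply => //; exact: measurable_window.
Qed.

(** The first point ranges over the window, of volume n, and each of the k others
    over a cube of side 4r around it. *)
Lemma lebesgue_mx_spread_window k n r : (0 < d)%N -> 0 < r ->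
  (lebesgue_mx R k.+1 d [set X | @window R d n (row ord0 X) /\ spread X r] <=
   (n%:R * (4 * r) ^+ (k * d))%:E)%E.
Proof.
move=> d0 r0; set A := mkset _.
have mA : measurable A by exact: measurable_spread_window.
rewrite lebesgue_mx_cons_row// /product_measure1.
rewrite EFinM -lebesgue_mx_window// muleC.
rewrite -[X in (_ * lebesgue_mx _ _ _ X)%E]setIT -integral_indic//; last exact: measurable_window.
rewrite -ge0_integralZl//; last 2 first.
- apply/measurable_EFinP; exact: measurable_indic (@measurable_window R d n).
- by rewrite lee_fin exprn_ge0// mulr_ge0// ltW.
apply: ge0_le_integral_nonmeasurable => // x _ /=.
rewrite indicE; have [/set_mem xW|xW] := boolP (x \in @window R d n); last first.
  rewrite mule0 (_ : xsection _ _ = set0) ?measure0//.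
  apply/seteqP; split => // Z; rewrite /xsection/= in_setE => -[+ _].
  by rewrite row_cons_row0; move/mem_set; rewrite (negPf xW).
rewrite mule1; apply: (@le_trans _ _
  (lebesgue_mx R k d (ball (\matrix_(i, j) x ord0 j) (2 * r)))); last first.
  by rewrite lebesgue_mx_ball ?mulr_gt0// lee_fin mulrA -natrM.
apply: le_measure; rewrite ?inE.
- apply: measurable_xsection; rewrite -[X in measurable X]setTI.
  exact: measurable_cons_row.
- exact: measurable_mx_ball.
move=> Z; rewrite /xsection/= in_setE => -[_ ZS].
apply/ball_mxP; first by rewrite mulr_gt0.
move=> i j; rewrite mxE distrC.
have := ZS (lift ord0 i); rewrite row_cons_row0 row_cons_rowS.
move=> /(le_trans (coord_le_enorm _ j)); rewrite !mxE => /le_lt_trans; apply.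
by rewrite ltr_pMl// ltr1n.
Qed.

End Volumes.

Section IntensityBound.
Variables (R : realType) (d j : nat).

(** Transfers the bounds in terms of scaling functions, which concern tuples
    anchored at the origin, to all tuples of small diameter. *)
Lemma translation_invariant_anchor (rho : 'M[R]_(j.+1, d) -> R) (r : R) X :
  translation_invariant rho -> 0 < r -> spread X (j.+1%:R * r) ->
  exists2 Y, anchored_ball Y & rho X = rho (r *: Y).
Proof.
move=> rhoT r0 Xr; exists (r^-1 *: translate_mx (- row ord0 X) X).
  have rowE i : row i (r^-1 *: translate_mx (- row ord0 X) X) =
      r^-1 *: (row i X - row ord0 X).
    by apply/rowP => l; rewrite !mxE.
  split => [|i]; rewrite rowE; first by rewrite subrr scaler0.
  by rewrite enormZ gtr0_norm ?invr_gt0// mulrC ler_pdivrMr.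
by rewrite scalerA divff ?gt_eqF// scale1r rhoT.
Qed.

Lemma intensity_le (rho : 'M[R]_(j.+1, d) -> R) (r c : R) (A : set 'M[R]_(j.+1, d)) :
  translation_invariant rho -> 0 < r -> measurable A ->
  (forall X, 0 <= rho X) ->
  (forall Y, anchored_ball Y -> rho (r *: Y) <= c) ->
  (forall X, A X -> spread X (j.+1%:R * r)) ->
  (\int[lebesgue_mx R j.+1 d]_(X in A) (rho X)%:E <=
   c%:E * lebesgue_mx R j.+1 d A)%E.
Proof.
move=> rhoT r0 mA rho0 rhoc Ar; rewrite -integral_cst//.
apply: ge0_le_integral_nonmeasurable => X AX; rewrite lee_fin//.
by have [Y YB ->] := translation_invariant_anchor rhoT r0 (Ar X AX); exact: rhoc.
Qed.

End IntensityBound.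

(** * Vanishing of the Betti numbers *)

Section SubcriticalRegime.
Context (R : realType) (d : nat) (dT : measure_display) (T : measurableType dT).
Variables (P : probability T R) (Phi : {mfun T >-> config R d}).

(** Markov's inequality for the number of clusters of 2k+2 points with their first
    point in the window. *)
Lemma probability_betti_neq0_le k (rho : 'M[R]_((2 * k + 1).+1, d) -> R) n r c :
  (0 < d)%N -> (0 < k)%N -> 0 < r -> 0 <= c ->
  joint_intensity P Phi rho -> translation_invariant rho ->
  (forall Y, anchored_ball Y -> rho (r *: Y) <= c) ->
  (P [set w | rips_betti Phi k n r w <> 0%N] <=
   (c * (n%:R * (4 * ((2 * k + 1).+1%:R * r)) ^+ ((2 * k + 1) * d)))%:E)%E.
Proof.
move=> d0 k0 r0 c0 [mrho rho0 rhoE] rhoT rhoc; set j := (2 * k + 1)%N in rho mrho rho0 rhoE rhoT rhoc *.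
have jr0 : 0 < j.+1%:R * r by rewrite mulr_gt0.
pose A := [set X : 'M[R]_(j.+1, d) | @window R d n (row ord0 X) /\ spread X (j.+1%:R * r)].
have mA : measurable A by exact: measurable_spread_window.
apply: (@le_trans _ _ (\int[P]_w counting (factorial_power j.+1 (Phi w) `&` A))%E).
  apply: measure_le_integral => [|w|w /= b0].
  - rewrite (_ : mkset _ = ~` [set w | rips_betti Phi k n r w = 0%N])//.
    by apply: measurableC; apply: measurable_rips_betti_eq0 => //; exact: ltW.
  - by rewrite /counting; case: ifP; rewrite ?lee_fin// leey.
  have [X [Xinj XQ Xs]] := betti_rips_cluster r0 k0 b0.
  have XPhi i : points (Phi w) (row i X) /\ @window R d n (row i X).
    have := XQ i; rewrite mem_npoints; last exact: bounded_window.
    by move=> /andP[/set_mem ? /set_mem].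
  have XA : (factorial_power j.+1 (Phi w) `&` A) X.
    split; first by split => // i; exact: (XPhi i).1.
    split; first exact: (XPhi _).2.
    move=> i; rewrite (le_trans (Xs i))//.
    by apply: ler_wpM2r; rewrite ?(ltW r0)// ler_nat.
  rewrite /counting; case: asboolP => [fA|]; last by rewrite leey.
  rewrite lee_fin ler1n cardfs_gt0; apply/fset0Pn; exists X.
  by rewrite in_fset_set// mem_set.
rewrite rhoE//; apply: (le_trans (intensity_le rhoT r0 mA rho0 rhoc _)).
  by move=> X [].
rewrite [leRHS]EFinM lee_wpmul2l ?lee_fin//.
exact: lebesgue_mx_spread_window.
Qed.

Lemma betti_eq0_whp k (rho : 'M[R]_((2 * k + 1).+1, d) -> R) f g (r : nat -> R) :
  (0 < d)%N -> (0 < k)%N ->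
  joint_intensity P Phi rho -> translation_invariant rho ->
  scaling_functions rho f g ->
  (forall n, 0 < r n) -> r n @[n --> \oo] --> 0 ->
  (fun n => r n ^+ (d * (2 * k + 1)) * f (r n)) =o_\oo (fun n => n%:R^-1 : R) ->
  P [set w | rips_betti Phi k n (r n) w = 0%N] @[n --> \oo] --> 1%E.
Proof.
move=> d0 k0 rhoI rhoT [f0 _ [[C C0 /near_right0P[e e0 rhoC]] _] _ _] r0 rcvg ro.
apply: cvg_probability1 => [n|eps eps0].
  by apply: measurable_rips_betti_eq0 => //; exact: ltW.
set j := (2 * k + 1)%N in rho rhoI rhoT rhoC ro *.
pose K : R := C * (4 * j.+1%:R) ^+ (j * d).
have K0 : 0 < K by rewrite mulr_gt0// exprn_gt0// mulr_gt0.
have re : \forall n \near \oo, r n < e.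
  move/cvgrPdist_lt : rcvg => /(_ _ e0); apply: filterS => n.
  by rewrite sub0r normrN gtr0_norm.
have epsK : 0 < eps / K by rewrite divr_gt0.
have rK : \forall n \near \oo,
    `|r n ^+ (d * j) * f (r n)| <= eps / K * `|n%:R^-1 : R|.
  by move/eqoP : ro => /(_ _ epsK).
near=> n.
have n0 : (0 < n)%N by near: n; exists 1%N.
have fn0 : 0 <= f (r n) by rewrite f0// ltW.
have -> : ~` [set w | rips_betti Phi k n (r n) w = 0%N] =
  [set w | rips_betti Phi k n (r n) w <> 0%N] by [].
apply: (le_trans (probability_betti_neq0_le n d0 k0 (r0 n)
  (mulr_ge0 (ltW C0) fn0) rhoI rhoT _)).
  by apply: rhoC; rewrite r0/=; near: n.
rewrite lee_fin -/j.
have -> : C * f (r n) * (n%:R * (4 * (j.+1%:R * r n)) ^+ (j * d)) =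
    n%:R * (K * (r n ^+ (d * j) * f (r n))).
  by rewrite /K mulrA exprMn (mulnC d); ring.
have : `|r n ^+ (d * j) * f (r n)| <= eps / K * `|n%:R^-1 : R| by near: n.
rewrite ger0_norm ?mulr_ge0 ?exprn_ge0 ?(ltW (r0 n))// ger0_norm ?invr_ge0// => h.
rewrite mulrC -ler_pdivlMr ?ltr0n// mulrC -ler_pdivlMr//.
by rewrite mulrAC.
Unshelve. all: by end_near. Qed.

End SubcriticalRegime.

(** * A second moment bound *)

Section Expectation.
Context (dT : measure_display) (T : measurableType dT) (R : realType).
Variable P : probability T R.
Implicit Types (X Y : T -> R).

Definition bounded_rv X := measurable_fun setT X /\ exists C, forall w, `|X w| <= C.

Lemma bounded_rvD X Y : bounded_rv X -> bounded_rv Y ->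
  bounded_rv (fun w => X w + Y w).
Proof.
move=> [mX [C XC]] [mY [D YD]]; split; first exact: measurable_funD.
by exists (C + D) => w; rewrite (le_trans (ler_normD _ _))// lerD.
Qed.

Lemma bounded_rvM X Y : bounded_rv X -> bounded_rv Y ->
  bounded_rv (fun w => X w * Y w).
Proof.
move=> [mX [C XC]] [mY [D YD]]; split; first exact: measurable_funM.
by exists (C * D) => w; rewrite normrM ler_pM.
Qed.

Lemma bounded_rv_cst c : bounded_rv (fun=> c).
Proof. by split; [exact: measurable_cst|exists `|c|]. Qed.

Lemma bounded_rvZ c X : bounded_rv X -> bounded_rv (fun w => c * X w).
Proof. by move=> bX; exact: bounded_rvM (bounded_rv_cst c) bX. Qed.

Lemma bounded_rvB X Y : bounded_rv X -> bounded_rv Y ->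
  bounded_rv (fun w => X w - Y w).
Proof.
move=> bX /(bounded_rvZ (-1)) bY.
rewrite (_ : (fun w => _) = (fun w => X w + -1 * Y w)); first exact: bounded_rvD.
by apply/funext => w; rewrite mulN1r.
Qed.

Lemma bounded_rv_sum (I : Type) (s : seq I) (F : I -> T -> R) :
  (forall i, bounded_rv (F i)) -> bounded_rv (fun w => \sum_(i <- s) F i w).
Proof.
move=> bF; elim: s => [|i s IH].
  by under eq_fun do rewrite big_nil; exact: bounded_rv_cst.
by under eq_fun do rewrite big_cons; exact: bounded_rvD.
Qed.

Lemma bounded_rv_indic (A : set T) : measurable A -> bounded_rv \1_A.
Proof.
move=> mA; split; first exact: measurable_indic.
by exists 1 => w; rewrite indicE; case: (w \in A); rewrite ?normr1 ?normr0.
Qed.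

Lemma bounded_rv_integrable X : bounded_rv X -> P.-integrable setT (EFin \o X).
Proof.
move=> [mX [C XC]]; apply: measurable_bounded_integrable => //.
  by rewrite ltey_eq fin_num_measure.
exists C; split; first exact: num_real.
by move=> c Cc w _ /=; rewrite (le_trans (XC w))// ltW.
Qed.

Definition mean X : R := \int[P]_w X w.

Lemma meanD X Y : bounded_rv X -> bounded_rv Y ->
  mean (fun w => X w + Y w) = mean X + mean Y.
Proof. by move=> bX bY; apply: RintegralD => //; exact: bounded_rv_integrable. Qed.

Lemma meanZ c X : bounded_rv X -> mean (fun w => c * X w) = c * mean X.
Proof. by move=> bX; apply: RintegralZl => //; exact: bounded_rv_integrable. Qed.

Lemma meanB X Y : bounded_rv X -> bounded_rv Y ->
  mean (fun w => X w - Y w) = mean X - mean Y.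
Proof. by move=> bX bY; apply: RintegralB => //; exact: bounded_rv_integrable. Qed.

Lemma mean_cst c : mean (fun=> c) = c.
Proof.
rewrite /mean Rintegral_cst//.
have -> : fine (P setT) = 1 by rewrite probability_setT.
by rewrite mulr1.
Qed.

Lemma mean_le X Y : bounded_rv X -> bounded_rv Y -> (forall w, X w <= Y w) ->
  mean X <= mean Y.
Proof.
by move=> bX bY XY; apply: le_Rintegral => //; exact: bounded_rv_integrable.
Qed.

Lemma mean_indic (A : set T) : measurable A -> mean \1_A = fine (P A).
Proof. by move=> mA; rewrite /mean /Rintegral integral_indic// setIT. Qed.

Lemma mean_sum (I : Type) (s : seq I) (F : I -> T -> R) :
  (forall i, bounded_rv (F i)) ->
  mean (fun w => \sum_(i <- s) F i w) = \sum_(i <- s) mean (F i).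
Proof.
move=> bF; elim: s => [|i s IH].
  by under [X in mean X]eq_fun do rewrite big_nil; rewrite big_nil mean_cst.
under [X in mean X]eq_fun do rewrite big_cons.
by rewrite big_cons meanD ?IH//; exact: bounded_rv_sum.
Qed.

Lemma covariance_mean X Y : bounded_rv X -> bounded_rv Y ->
  covariance P X Y = (mean (fun w => X w * Y w) - mean X * mean Y)%:E.
Proof.
move=> bX bY; have Lf Z : bounded_rv Z -> Z \in Lfun P 1.
  by move=> bZ; apply/Lfun1_integrable; exact: bounded_rv_integrable.
have EE Z : bounded_rv Z -> 'E_P[Z]%E = (mean Z)%:E.
  move=> bZ; rewrite unlock /mean /Rintegral fineK//.
  by apply: integrable_fin_num => //; exact: bounded_rv_integrable.
rewrite covarianceE ?EE -?EFinM ?Lf//.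
- exact: bounded_rvM.
- exact: bounded_rvM.
Qed.

Definition real_variance X := mean (fun w => (X w - mean X) ^+ 2).

Lemma real_varianceE X : bounded_rv X ->
  real_variance X = mean (fun w => X w * X w) - mean X * mean X.
Proof.
move=> bX; set m := mean X.
rewrite /real_variance (_ : (fun w => _) =
  (fun w => X w * X w - ((2 * m) * X w - m * m))); last first.
  by apply/funext => w; rewrite -/m; ring.
have bXX := bounded_rvM bX bX; have bmX := bounded_rvZ (2 * m) bX.
have bmm := bounded_rv_cst (m * m).
rewrite (meanB bXX (bounded_rvB bmX bmm)) (meanB bmX bmm) meanZ// mean_cst.
by rewrite -/m; ring.
Qed.

(** The off-diagonal covariances are nonpositive, and on the diagonal F^2 <= F. *)
Lemma real_variance_sum_le (I : finType) (F : I -> T -> R) q :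
  (forall i, bounded_rv (F i)) -> (forall i w, 0 <= F i w <= 1) ->
  (forall i j, i != j ->
    mean (fun w => F i w * F j w) <= mean (F i) * mean (F j)) ->
  (forall i, mean (F i) <= q) ->
  real_variance (fun w => \sum_i F i w) <= #|I|%:R * q.
Proof.
move=> bF F01 neg Fq; have bS := bounded_rv_sum (index_enum I) bF.
have bFF i j := bounded_rvM (bF i) (bF j).
rewrite real_varianceE// mean_sum//.
rewrite (_ : (fun w => _) = (fun w => \sum_i \sum_j F i w * F j w)); last first.
  apply/funext => w; rewrite mulr_suml; apply: eq_bigr => i _.
  by rewrite mulr_sumr.
rewrite mean_sum; last by move=> i; exact: bounded_rv_sum.
rewrite mulr_suml -sumrB -[#|I|]sum1_card natr_sum mulr_suml ler_sum// => i _.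
rewrite mul1r mean_sum// mulr_sumr -sumrB (bigD1 i)//= -[leRHS]addr0 lerD//; last first.
  by apply: sumr_le0 => j ji; rewrite subr_le0; apply: neg; rewrite eq_sym.
rewrite (le_trans _ (Fq i))// lerBlDr (@le_trans _ _ (mean (F i)))//.
  apply: mean_le => // w; have /andP[F0 F1] := F01 i w.
  by rewrite ler_piMl.
by rewrite lerDl -expr2 sqr_ge0.
Qed.

(** The sums of A and of V agree on Z although their means differ by #|I| p, so
    one of them deviates from its mean by at least half of this.  The differences
    A - V may themselves be positively correlated, which is why the two families
    are kept apart. *)
Lemma second_moment_bound (I : finType) (A V : I -> T -> R) p q (Z : set T) :
  (forall i, bounded_rv (A i)) -> (forall i w, 0 <= A i w <= 1) ->
  (forall i, bounded_rv (V i)) -> (forall i w, 0 <= V i w <= 1) ->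
  (forall i j, i != j ->
    mean (fun w => A i w * A j w) <= mean (A i) * mean (A j)) ->
  (forall i j, i != j ->
    mean (fun w => V i w * V j w) <= mean (V i) * mean (V j)) ->
  (forall i, mean (A i) <= q) -> (forall i, mean (V i) <= q) ->
  (forall i, mean (A i) - mean (V i) = p) ->
  (0 < #|I|)%N -> measurable Z -> (forall w, Z w -> forall i, A i w = V i w) ->
  #|I|%:R * p ^+ 2 * fine (P Z) <= 4 * q.
Proof.
move=> bA A01 bV V01 negA negV Aq Vq Ap I0 mZ ZAV.
have bSA := bounded_rv_sum (index_enum I) bA.
have bSV := bounded_rv_sum (index_enum I) bV.
have varA := real_variance_sum_le bA A01 negA Aq.
have varV := real_variance_sum_le bV V01 negV Vq.
set SA := (fun w => \sum_i A i w) in varA bSA; set SV := (fun w => \sum_i V i w) in varV bSV.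
have mp : mean SA - mean SV = #|I|%:R * p.
  rewrite !mean_sum// -sumrB (eq_bigr (fun=> p)) => [|i _]; last exact: Ap.
  by rewrite sumr_const mulr_natl.
have bsq X c : bounded_rv X -> bounded_rv (fun w => (X w - c) ^+ 2).
  move=> bX; have bXc := bounded_rvB bX (bounded_rv_cst c).
  exact: (bounded_rvM bXc bXc).
have : (#|I|%:R * p) ^+ 2 * fine (P Z) <= 2 * real_variance SA + 2 * real_variance SV.
  rewrite -mean_indic// -meanZ; last exact: bounded_rv_indic.
  rewrite /real_variance -!meanZ -?meanD; try by do ?apply: bounded_rvZ; exact: bsq.
  apply: mean_le => [||w].
  - by apply: bounded_rvZ; exact: bounded_rv_indic.
  - by apply: bounded_rvD; apply: bounded_rvZ; exact: bsq.
  rewrite indicE; have [/set_mem wZ|_] := boolP (w \in Z); last first.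
    by rewrite mulr0 addr_ge0// mulr_ge0// sqr_ge0.
  have SAV : SA w = SV w by apply: eq_bigr => i _; exact: ZAV.
  rewrite mulr1 -mp SAV; set a := mean SA; set b := mean SV; set c := SV w.
  (* (a - b)^2 <= 2 (c - a)^2 + 2 (c - b)^2 where c is the common value of the sums. *)
  by have := sqr_ge0 ((c - a) + (c - b)); nra.
rewrite exprMn => h; have I0' : 0 < #|I|%:R :> R by rewrite ltr0n.
rewrite -(ler_pM2l I0').
have -> : #|I|%:R * (#|I|%:R * p ^+ 2 * fine (P Z)) =
  #|I|%:R ^+ 2 * p ^+ 2 * fine (P Z) by ring.
rewrite (le_trans h)// (_ : _ * (4 * q) = 2 * (#|I|%:R * q) + 2 * (#|I|%:R * q)).
  by rewrite lerD// ler_wpM2l.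
by ring.
Qed.

End Expectation.

(** * Octahedral templates *)

Section OctahedralTemplates.
Variables (R : realType) (d k : nat).
Local Notation J := (2 * k + 1).+1.
Implicit Types (Y : 'M[R]_(J, d)) (e t r : R) (phi : config R d).

(** A ball is taken in the sup norm, so points of [ball (row m Y) e] move by at
    most d e in the Euclidean norm, and distances between two of them change by
    at most 2 d e.  The first two distance conditions thus make every choice of
    points, one per ball, a copy of O_k at scale r, labelled by s; the third
    keeps the points distinct; the last makes the region [eballs Y t] contain
    every point that is adjacent to one of them. *)
Definition octahedral_template (s : 'I_J -> 'I_k.+1 * bool) Y e t r : Prop :=
  [/\ 0 < e,
      forall m l, (s m).1 != (s l).1 ->
        enorm (row m Y - row l Y) + 2 * (d%:R * e) <= r,
      forall m l, m != l -> (s m).1 = (s l).1 ->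
        r + 2 * (d%:R * e) < enorm (row m Y - row l Y),
      forall m l, m != l -> 2 * (d%:R * e) < enorm (row m Y - row l Y) &
      r + 2 * (d%:R * e) <= t].

(** Once each ball is occupied the region contains at least J points
    ([template_npoints_ge]), so the upper bound excludes any further one. *)
Definition hit Y e t : set (config R d) := [set phi |
  (forall m, (0 < npoints phi (ball (row m Y) e))%N) /\
  (npoints phi (eballs Y t) <= J)%N].

Lemma ball_enorm (x y : 'rV[R]_d) e : ball x e y -> enorm (y - x) <= d%:R * e.
Proof.
move=> [e0 xy]; apply: enorm_le_coord => [|i]; first exact: ltW.
by rewrite !mxE distrC ltW//; exact: xy.
Qed.

Lemma card_rows m (X : 'M[R]_(m, d)) : injective (fun i => row i X) ->
  #|` [fset x in [seq row i X | i <- enum 'I_m]]%fset| = m.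
Proof.
move=> Xinj; rewrite card_fseq undup_id; first by rewrite size_map size_enum_ord.
by rewrite (map_inj_uniq Xinj) enum_uniq.
Qed.

Section Template.
Variables (s : 'I_J -> 'I_k.+1 * bool) (Y : 'M[R]_(J, d)) (e t r : R).
Hypotheses (s_bij : bijective s) (r0 : 0 <= r) (temp : octahedral_template s Y e t r).

Let e0 : 0 < e. Proof. by case: temp. Qed.
Let de0 : 0 <= d%:R * e. Proof. by rewrite mulr_ge0// ltW. Qed.

Lemma ball_template m : ball (row m Y) e `<=` eballs Y t.
Proof.
have [_ _ _ _ rt] := temp => x /ball_enorm xY; exists m => //=.
rewrite /eball/= (le_trans xY)//; by move: rt r0 de0; set c := d%:R * e; lra.
Qed.

Lemma enorm_template_diff (x y : 'rV[R]_d) m l :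
  ball (row m Y) e x -> ball (row l Y) e y ->
  `|enorm (x - y) - enorm (row m Y - row l Y)| <= 2 * (d%:R * e).
Proof.
move=> /ball_enorm xm /ball_enorm yl; set c := d%:R * e in xm yl *.
have h1 := enorm_triangle (row m Y) x y; have h2 := enorm_triangle (row l Y) (row m Y) y.
have h3 := enorm_triangle x (row m Y) (row l Y); have h4 := enorm_triangle y x (row l Y).
have h5 := enormB x (row m Y); have h6 := enormB y (row l Y).
by rewrite ler_distl; apply/andP; split; lra.
Qed.

Lemma template_points phi : (forall m, (0 < npoints phi (ball (row m Y) e))%N) ->
  exists X : 'M[R]_(J, d), [/\ forall m, points phi (row m X),
    forall m, ball (row m Y) e (row m X), injective (fun m => row m X) &
    forall m l, m != l -> (enorm (row m X - row l X) <= r) = ((s m).1 != (s l).1)].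
Proof.
move=> hitY; have [_ near far sep _] := temp.
have /choice[x xP] m : exists x, points phi x /\ ball (row m Y) e x.
  have /(npoints_gt0P phi (bounded_ball _ _))[x px Bx] := hitY m.
  by exists x.
have diff m l := enorm_template_diff (xP m).2 (xP l).2.
exists (\matrix_m x m); split=> [m|m|m l|m l ml]; rewrite ?rowK.
- exact: (xP m).1.
- exact: (xP m).2.
- move=> xml; apply/eqP; apply: contrapT => /negP ml.
  have := diff m l; rewrite xml subrr enorm0 sub0r normrN ger0_norm ?enorm_ge0//.
  by rewrite leNgt sep.
- have := diff m l; rewrite ler_norml => /andP[h1 h2].
  have [sml|/negbTE sml] := boolP ((s m).1 != (s l).1).
    have := near m l sml; move: h2; set c := d%:R * e; set a := enorm _; set b := enorm _.
    by move=> h2 h; apply/idP; lra.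
  have := far m l ml (eqP (negbFE sml)); move: h1.
  set c := d%:R * e; set a := enorm _; set b := enorm _ => h1 h.
  by apply/negbTE; rewrite -ltNge; lra.
Qed.

Lemma template_npoints_ge phi :
  (forall m, (0 < npoints phi (ball (row m Y) e))%N) ->
  (J <= npoints phi (eballs Y t))%N.
Proof.
move=> /template_points[X [Xphi XY Xinj _]].
rewrite -[leqLHS](card_rows Xinj).
apply: fsubset_leq_card; apply/fsubsetP => x; rewrite inE /= => /mapP[m _ ->].
rewrite mem_npoints; last exact: bounded_eballs.
by rewrite !mem_set//; exact: ball_template (XY m).
Qed.

(** The points in the balls span an octahedron, and the points outside the region
    are too far away to be adjacent to it. *)
Lemma hit_betti phi (W : set 'rV[R]_d) : (0 < k)%N ->
  bounded_set W -> eballs Y t `<=` W -> hit Y e t phi ->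
  betti (rips (fset_set (phi `&` W)) r) k <> 0%N.
Proof.
move=> k0 bW YW [hitY NJ]; have [_ near far sep rt] := temp.
have [X [Xphi XY Xinj Xadj]] := template_points hitY.
have Xball m : eballs Y t (row m X) by exact: ball_template (XY m).
have all_rows x : points phi x -> eballs Y t x -> exists m, x = row m X.
  move=> px Bx; pose S := [fset x in [seq row m X | m <- enum 'I_J]]%fset.
  have SE : S = fset_set (phi `&` eballs Y t).
    apply/eqP; rewrite eqEfcard; apply/andP; split.
      apply/fsubsetP => y; rewrite inE /= => /mapP[m _ ->].
      by rewrite mem_npoints ?mem_set//; exact: bounded_eballs.
    by rewrite card_rows.
  have : x \in S by rewrite SE mem_npoints ?mem_set//; exact: bounded_eballs.
  by rewrite inE /= => /mapP[m _ ->]; exists m.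
apply: (@betti_rips_octahedron _ _ _ _ _ X s) => //.
- by move=> m; rewrite mem_npoints// !mem_set//; exact: YW.
- by move=> m l ml; apply: contra ml => /eqP/Xinj ->.
- move=> x; rewrite mem_npoints// => /andP[/set_mem px _] xX m.
  rewrite ltNge; apply/negP => xr.
  have [l xE] : exists l, x = row l X.
    apply: all_rows => //; exists m => //; rewrite /eball/=.
    rewrite (le_trans (enorm_triangle (row m X) _ _))//.
    have := ball_enorm (XY m); move: rt xr de0; set c := d%:R * e.
    by move=> ? ? ? ?; lra.
  by have := xX l; rewrite xE eqxx.
Qed.

End Template.
End OctahedralTemplates.

(** * Translations, and increasing functions of counts *)

Section Translation.
Variables (R : realType) (d : nat).
Implicit Types (phi : config R d) (B : set 'rV[R]_d) (x y v : 'rV[R]_d).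

Lemma npoints_translate phi B v : bounded_set B ->
  npoints (translate v phi) B = npoints phi [set y | B (y + v)].
Proof.
move=> bB; have bBv : bounded_set [set y | B (y + v)].
  have [M [Mr BM]] := bB; exists (M + `|v|); split; first exact: num_real.
  move=> r Mvr y /= Byv; have := BM (r - `|v|); rewrite ltrBrDr => /(_ Mvr _ Byv)/=.
  by rewrite lerBrDr; apply: le_trans; rewrite -{1}(addrK v y) ler_normB.
rewrite /npoints; set B' := [set y | B (y + v)] in bBv *; pose shift (y : 'rV[R]_d) := y + v.
have -> : fset_set (points (translate v phi) `&` B) =
    [fset shift y | y in fset_set (points phi `&` B')]%fset.
  apply/fsetP => x; apply/idP/imfsetP => [|[y /=]].
    rewrite mem_npoints// => /andP[/set_mem[y /= py <-] /set_mem Byv].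
    by exists y => //=; rewrite mem_npoints// !mem_set.
  rewrite mem_npoints// => /andP[/set_mem py /set_mem Byv] ->.
  have -> := mem_npoints (translate v phi) (shift y) bB.
  by rewrite !mem_set//; exists y.
by rewrite card_imfset//=; exact: addIr.
Qed.

Lemma row_translate_mx j (Y : 'M[R]_(j, d)) v m :
  row m (translate_mx v Y) = row m Y + v.
Proof. by rewrite rowK. Qed.

Lemma ball_translate x v e : [set y | ball (x + v) e (y + v)] = ball x e.
Proof.
have add i j (y : 'rV[R]_d) : (x + v) i j - (y + v) i j = x i j - y i j.
  by rewrite !mxE; ring.
apply/seteqP; split => y [e0 xy]; split => // i j.
  by rewrite /ball/= -add; exact: xy.
by rewrite /ball/= add; exact: xy.
Qed.

Lemma eballs_translate j (Y : 'M[R]_(j, d)) v t :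
  [set y | eballs (translate_mx v Y) t (y + v)] = eballs Y t.
Proof.
have add m (y : 'rV[R]_d) : y + v - row m (translate_mx v Y) = y - row m Y.
  by rewrite row_translate_mx opprD addrACA subrr addr0.
apply/seteqP; split => y [m _ /= ym]; exists m => //; move: ym; rewrite /eball/=.
  by rewrite add.
by rewrite -add.
Qed.

Lemma npoints_ball_translate phi x v e :
  npoints (translate v phi) (ball (x + v) e) = npoints phi (ball x e).
Proof. by rewrite npoints_translate ?ball_translate//; exact: bounded_ball. Qed.

Lemma npoints_eballs_translate phi j (Y : 'M[R]_(j, d)) v t :
  npoints (translate v phi) (eballs (translate_mx v Y) t) = npoints phi (eballs Y t).
Proof. by rewrite npoints_translate ?eballs_translate//; exact: bounded_eballs. Qed.

End Translation.

Section Clamp.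
Variable R : realType.

(** Interpolates the indicator of [1, oo) on the integers: negative association
    concerns continuous functions of counts, and indicators of events defined by
    counts have to be written in this way. *)
Definition clamp (x : R) : R := Num.min 1 (Num.max 0 x).

Lemma clamp_ge0 x : 0 <= clamp x.
Proof. by rewrite /clamp le_min ler01 le_max lexx. Qed.

Lemma clamp_le1 x : clamp x <= 1.
Proof. by rewrite /clamp ge_min lexx. Qed.

Lemma clamp_incr x y : x <= y -> clamp x <= clamp y.
Proof. by move=> xy; apply: le_min2 => //; apply: le_max2. Qed.

Lemma clampN x : x <= 0 -> clamp x = 0.
Proof. by move=> x0; rewrite /clamp max_l// min_r. Qed.

Lemma clampP x : 1 <= x -> clamp x = 1.
Proof.
by move=> x1; rewrite /clamp max_r ?(le_trans ler01)// min_l.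
Qed.

Lemma clamp_nat n m : clamp (n%:R - m%:R) = (m < n)%N%:R.
Proof.
case: ltnP => mn; last by rewrite clampN// subr_le0 ler_nat.
by rewrite clampP// lerBrDr nat1r ler_nat.
Qed.

Lemma clamp_continuous : continuous clamp.
Proof.
move=> x; apply: (@continuous_min R R (fun=> 1) (fun y => Num.max 0 y)); first exact: cvg_cst.
by apply: (@continuous_max R R (fun=> 0) id); [exact: cvg_cst|exact: cvg_id].
Qed.

End Clamp.

Section IncreasingFunctionals.
Variables (R : realType) (J : nat).
Implicit Types x : 'rV[R]_J.+1.

(** The last coordinate is the count of the region, the others are the counts of
    the balls. *)
Definition crowded x : R := clamp (x ord0 ord_max - J%:R).

Definition occupied x : R := \prod_(m < J) clamp (x ord0 (lift ord_max m)).

Definition occupied_or_crowded x : R := Num.max (occupied x) (crowded x).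

Lemma crowded_01 x : 0 <= crowded x <= 1.
Proof. by rewrite clamp_ge0 clamp_le1. Qed.

Lemma occupied_01 x : 0 <= occupied x <= 1.
Proof.
rewrite prodr_ge0 => [|m _]; last exact: clamp_ge0.
by apply: prodr_ile1 => m _; rewrite clamp_ge0 clamp_le1.
Qed.

Lemma occupied_or_crowded_01 x : 0 <= occupied_or_crowded x <= 1.
Proof.
have /andP[x0 x1] := occupied_01 x; have /andP[c0 c1] := crowded_01 x.
by rewrite le_max x0 ge_max x1 c1.
Qed.

Lemma crowded_increasing : coordinate_increasing crowded.
Proof. by move=> x y xy; apply: clamp_incr; rewrite lerD2r. Qed.

Lemma occupied_or_crowded_increasing : coordinate_increasing occupied_or_crowded.
Proof.
move=> x y xy; apply: le_max2; last exact: crowded_increasing.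
by apply: ler_prod => m _; rewrite clamp_ge0 clamp_incr.
Qed.

Lemma crowded_continuous : continuous crowded.
Proof.
move=> x; apply: (@continuous_comp _ _ _ (fun x : 'rV[R]_J.+1 => x ord0 ord_max - J%:R)).
  exact: (cvgB (@coord_continuous R 1 J.+1 ord0 ord_max x) (cvg_cst _)).
exact: clamp_continuous.
Qed.

Lemma occupied_continuous : continuous occupied.
Proof.
rewrite /occupied => x; elim: (index_enum _) => [|m s IH].
  rewrite (_ : (fun y => _) = cst 1); first exact: cst_continuous.
  by apply/funext => y; rewrite big_nil.
rewrite (_ : (fun y => _) = (fun y : 'rV[R]_J.+1 => clamp (y ord0 (lift ord_max m)) *
    \prod_(l <- s) clamp (y ord0 (lift ord_max l)))); last first.
  by apply/funext => y; rewrite big_cons.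
have cm : {for x, continuous (fun y : 'rV[R]_J.+1 => clamp (y ord0 (lift ord_max m)))}.
  apply: (@continuous_comp _ _ _ (fun x : 'rV[R]_J.+1 => x ord0 (lift ord_max m))).
    exact: (@coord_continuous R 1 J.+1 ord0 (lift ord_max m) x).
  exact: clamp_continuous.
exact: (continuousM cm IH).
Qed.

Lemma occupied_or_crowded_continuous : continuous occupied_or_crowded.
Proof.
move=> x; apply: (@continuous_max R _ occupied crowded).
  exact: occupied_continuous.
exact: crowded_continuous.
Qed.

Lemma bounded_fun_01 (f : 'rV[R]_J.+1 -> R) :
  (forall x, 0 <= f x <= 1) -> bounded_fun f.
Proof.
move=> f01; exists 1; split; first exact: num_real.
move=> M M1 x _ /=; have /andP[f0 f1] := f01 x.
by rewrite ger0_norm// (le_trans f1)// ltW.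
Qed.

End IncreasingFunctionals.

(** * Packing templates into the window *)

Section CellCounts.
Context (R : realType) (d k : nat) (dT : measure_display) (T : measurableType dT).
Variables (P : probability T R) (Phi : {mfun T >-> config R d}).
Local Notation J := (2 * k + 1).+1.
Implicit Types (Y : 'M[R]_(J, d)) (e t : R).

Definition test_sets Y e t (i : 'I_J.+1) : set 'rV[R]_d :=
  if unlift ord_max i is Some m then ball (row m Y) e else eballs Y t.

(** Increasing in the configuration, unlike [hit]. *)
Definition hit_or_crowded Y e t : set (config R d) := [set phi |
  (forall m, (0 < npoints phi (ball (row m Y) e))%N) \/
  (J < npoints phi (eballs Y t))%N].

Definition over_crowded Y t : set (config R d) :=
  [set phi | (J < npoints phi (eballs Y t))%N].

Definition full Y t : set (config R d) :=
  [set phi | (J <= npoints phi (eballs Y t))%N].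

Lemma measurable_npoints_preimage (B : set 'rV[R]_d) (Q : set nat) :
  measurable B -> bounded_set B ->
  measurable [set phi : config R d | Q (npoints phi B)].
Proof.
move=> mB bB; rewrite -[X in measurable X]setTI.
exact: (measurable_npoints mB bB measurableT (Y := Q)).
Qed.

Lemma measurable_over_crowded Y t : measurable (over_crowded Y t).
Proof.
apply: (@measurable_npoints_preimage _ [set n | (J < n)%N]).
  exact: measurable_eballs.
exact: bounded_eballs.
Qed.

Lemma measurable_full Y t : measurable (full Y t).
Proof.
apply: (@measurable_npoints_preimage _ [set n | (J <= n)%N]).
  exact: measurable_eballs.
exact: bounded_eballs.
Qed.

Lemma measurable_all_hit Y e :
  measurable [set phi : config R d | forall m, (0 < npoints phi (ball (row m Y) e))%N].
Proof.
rewrite (_ : mkset _ = \bigcap_(m in [set: 'I_J])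
  [set phi : config R d | (0 < npoints phi (ball (row m Y) e))%N]).
  apply: fin_bigcap_measurable => // m _.
  apply: (@measurable_npoints_preimage _ [set n | (0 < n)%N]).
    exact: measurable_mx_ball.
  exact: bounded_ball.
by apply/seteqP; split => [phi h m _|phi h m]; [exact: h|exact: h].
Qed.

Lemma measurable_hit Y e t : measurable (hit Y e t).
Proof.
apply: measurableI; first exact: measurable_all_hit.
apply: (@measurable_npoints_preimage _ [set n | (n <= J)%N]).
  exact: measurable_eballs.
exact: bounded_eballs.
Qed.

Lemma measurable_hit_or_crowded Y e t : measurable (hit_or_crowded Y e t).
Proof.
apply: measurableU; first exact: measurable_all_hit.
exact: measurable_over_crowded.
Qed.

Lemma crowded_counts Y e t w :
  crowded (counts Phi (test_sets Y e t) w) = \1_(over_crowded Y t) (Phi w).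
Proof.
rewrite /crowded mxE /test_sets unlift_none clamp_nat indicE; congr (nat_of_bool _)%:R.
by apply/idP/idP => [|/set_mem//]; move/mem_set; exact.
Qed.

Lemma occupied_or_crowded_counts Y e t w :
  occupied_or_crowded (counts Phi (test_sets Y e t) w) =
  \1_(hit_or_crowded Y e t) (Phi w).
Proof.
have occ m : clamp (counts Phi (test_sets Y e t) w ord0 (lift ord_max m)) =
    (0 < npoints (Phi w) (ball (row m Y) e))%N%:R :> R.
  by rewrite mxE /test_sets liftK -[X in clamp X]subr0 -[0 in LHS]/(0%N%:R) clamp_nat.
rewrite /occupied_or_crowded crowded_counts !indicE.
have [all|] := pselect (forall m, (0 < npoints (Phi w) (ball (row m Y) e))%N).
  rewrite [in RHS]mem_set; last by left.
  rewrite /occupied big1 => [|m _]; last by rewrite occ all.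
  by case: (_ \in _); rewrite ?maxxx// max_l.
move=> /existsNP[m /negP nm].
rewrite /occupied (bigD1 m)//= occ (negbTE nm) mul0r max_r//.
congr (nat_of_bool _)%:R; apply/idP/idP => /set_mem h; apply/mem_set.
  by right.
by case: h => // /(_ m); rewrite (negbTE nm).
Qed.

Lemma indic_01 (E : set (config R d)) phi : 0 <= (\1_E phi : R) <= 1.
Proof. by rewrite indicE; case: (_ \in _); rewrite ?lexx ?ler01. Qed.

(** Negative association applies to each of the two terms, though not to their
    difference. *)
Lemma indic_hit Y e t phi :
  \1_(hit_or_crowded Y e t) phi - \1_(over_crowded Y t) phi = \1_(hit Y e t) phi :> R.
Proof.
rewrite !indicE; have [over|over] := pselect (over_crowded Y t phi).
  rewrite (mem_set over) mem_set; last by right.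
  by rewrite subrr memNset// => -[_]; rewrite leqNgt over.
rewrite (memNset over) subr0; congr (nat_of_bool _)%:R.
apply/idP/idP => /set_mem h; apply/mem_set.
  by split; [case: h|rewrite leqNgt; exact/negP].
by left; case: h.
Qed.

Lemma bounded_rv_config_indic (E : set (config R d)) : measurable E ->
  bounded_rv (fun w => \1_E (Phi w) : R).
Proof.
move=> mE; rewrite (_ : (fun w => _) = \1_[set w | E (Phi w)]).
  exact/bounded_rv_indic/(measurable_config_event Phi).
by apply/funext => w; rewrite !indicE.
Qed.

Lemma mean_config_indic (E : set (config R d)) : measurable E ->
  mean P (fun w => \1_E (Phi w) : R) = fine (P [set w | E (Phi w)]).
Proof.
move=> mE; rewrite -mean_indic; last exact: measurable_config_event.
by congr (mean P _); apply/funext => w; rewrite !indicE.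
Qed.

Lemma bounded_test_sets Y e t (i : 'I_J.+1) :
  measurable (test_sets Y e t i) /\ bounded_set (test_sets Y e t i).
Proof.
rewrite /test_sets; case: (unlift _ _) => [m|].
  by split; [exact: measurable_mx_ball|exact: bounded_ball].
by split; [exact: measurable_eballs|exact: bounded_eballs].
Qed.

(** Negative association for the counts in two disjoint regions, applied to
    continuous functions that agree with indicators on counts. *)
Lemma negative_correlation (E E' : set (config R d)) (f : 'rV[R]_J.+1 -> R) Y Y' e t :
  negatively_associated P Phi ->
  (forall m, ball (row m Y) e `<=` eballs Y t) ->
  (forall m, ball (row m Y') e `<=` eballs Y' t) ->
  eballs Y t `&` eballs Y' t = set0 ->
  (forall x, 0 <= f x <= 1) -> coordinate_increasing f -> continuous f ->
  measurable E -> measurable E' ->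
  (forall w, f (counts Phi (test_sets Y e t) w) = \1_E (Phi w)) ->
  (forall w, f (counts Phi (test_sets Y' e t) w) = \1_E' (Phi w)) ->
  mean P (fun w => \1_E (Phi w) * \1_E' (Phi w)) <=
  mean P (fun w => \1_E (Phi w)) * mean P (fun w => \1_E' (Phi w)).
Proof.
move=> NA BY BY' YY' f01 fi fc mE mE' fE fE'.
have := NA J.+1 J.+1 (test_sets Y e t) (test_sets Y' e t) f f
  (bounded_test_sets Y e t) (bounded_test_sets Y' e t) _ fi (bounded_fun_01 f01) fc
  fi (bounded_fun_01 f01) fc.
have -> : f \o counts Phi (test_sets Y e t) = (fun w => \1_E (Phi w)).
  by apply/funext => w; exact: fE.
have -> : f \o counts Phi (test_sets Y' e t) = (fun w => \1_E' (Phi w)).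
  by apply/funext => w; exact: fE'.
rewrite covariance_mean; [|exact: bounded_rv_config_indic..].
rewrite lee_fin subr_le0; apply.
have sub Z (i : 'I_J.+1) : (forall m, ball (row m Z) e `<=` eballs Z t) ->
    test_sets Z e t i `<=` eballs Z t.
  by move=> BZ; rewrite /test_sets; case: (unlift _ _).
apply/seteqP; split => // x [[i _ xi] [l _ xl]].
have : (eballs Y t `&` eballs Y' t) x by split; [exact: sub xi|exact: sub xl].
by rewrite YY'.
Qed.

End CellCounts.

Section LatticeOfCells.
Context (R : realType) (d k : nat) (dT : measure_display) (T : measurableType dT).
Variables (P : probability T R) (Phi : {mfun T >-> config R d}).
Local Notation J := (2 * k + 1).+1.

Lemma octahedral_template_translate (s : 'I_J -> 'I_k.+1 * bool) (Y : 'M[R]_(J, d)) v e t r :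
  octahedral_template s Y e t r -> octahedral_template s (translate_mx v Y) e t r.
Proof.
move=> [e0 near far sep rt].
have diff m l : row m (translate_mx v Y) - row l (translate_mx v Y) = row m Y - row l Y.
  by rewrite !row_translate_mx opprD addrACA subrr addr0.
by split => // m l; rewrite diff; [exact: near|exact: far|exact: sep].
Qed.

Lemma full_translate Y v t (phi : config R d) :
  full (k := k) (translate_mx v Y) t (translate v phi) = full Y t phi.
Proof. by rewrite /full/= npoints_eballs_translate. Qed.

Lemma hit_translate Y v e t (phi : config R d) :
  hit (k := k) (translate_mx v Y) e t (translate v phi) = hit Y e t phi.
Proof.
rewrite /hit [LHS]/mkset [RHS]/mkset.
rewrite npoints_eballs_translate.
have bE m : npoints (translate v phi) (ball (row m (translate_mx v Y)) e) =
    npoints phi (ball (row m Y) e).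
  by rewrite row_translate_mx npoints_ball_translate.
apply/propext; split => -[h1 h2].
  by apply: (conj _ h2) => m; rewrite -bE; exact: h1.
by apply: (conj _ h2) => m; rewrite bE; exact: h1.
Qed.

Lemma stationary_event (E E' : set (config R d)) v :
  stationary P Phi -> measurable E -> (forall phi, E (translate v phi) = E' phi) ->
  P [set w | E (Phi w)] = P [set w | E' (Phi w)].
Proof.
move=> st mE EE'; apply: etrans (esym (st v E mE)) _; congr (P _).
by apply/funext => w; exact: EE'.
Qed.

Lemma stationary_full Y v t : stationary P Phi ->
  P [set w | full (k := k) (translate_mx v Y) t (Phi w)] = P [set w | full Y t (Phi w)].
Proof.
move=> st; exact: (@stationary_event (full (translate_mx v Y) t) (full Y t) v st
  (measurable_full (translate_mx v Y) t) (full_translate Y v t)).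
Qed.

Lemma stationary_hit Y v e t : stationary P Phi ->
  P [set w | hit (k := k) (translate_mx v Y) e t (Phi w)] = P [set w | hit Y e t (Phi w)].
Proof.
move=> st; exact: (@stationary_event (hit (translate_mx v Y) e t) (hit Y e t) v st
  (measurable_hit (translate_mx v Y) e t) (hit_translate Y v e t)).
Qed.

(** The cells are cubes of side 2L, and the M^d translates of the region lie in
    different cells inside the window; stationarity makes their probabilities
    equal.  If beta_k = 0 then none of them is hit, that is, the two increasing
    events coincide in each cell. *)
Lemma betti_eq0_second_moment (s : 'I_J -> 'I_k.+1 * bool) (Y : 'M[R]_(J, d)) e t r L
    (M n : nat) : (0 < d)%N -> (0 < k)%N -> stationary P Phi -> negatively_associated P Phi ->
  bijective s -> 0 <= r -> octahedral_template s Y e t r ->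
  (forall x, eballs Y t x -> forall i, `|x ord0 i| < L) ->
  (0 < M)%N -> 2 * L * M%:R <= n%:R `^ d%:R^-1 / 2 ->
  M%:R ^+ d * fine (P [set w | hit Y e t (Phi w)]) ^+ 2 *
    fine (P [set w | rips_betti Phi k n r w = 0%N]) <=
  4 * fine (P [set w | full Y t (Phi w)]).
Proof.
move=> d0 k0 st NA sb r0 temp YL M0 MW.
have L0 : 0 < L.
  have m0 : 'I_J := ord0.
  have /YL /(_ (Ordinal d0)) : eballs Y t (row m0 Y).
    by apply: (ball_template r0 temp) (ballxx _ _); case: temp.
  exact: le_lt_trans.
(* The centres of M^d cubes of side 2L in the positive part of the window. *)
pose v (a : {ffun 'I_d -> 'I_M}) : 'rV[R]_d := \row_i (L * (2 * (a i)%:R + 1)).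
pose Ya a := translate_mx (v a) Y.
have tempa a : octahedral_template s (Ya a) e t r by exact: octahedral_template_translate.
have BYa a m : ball (row m (Ya a)) e `<=` eballs (Ya a) t by exact: ball_template (tempa a) m.
have cell a x : eballs (Ya a) t x -> forall i,
    2 * L * (a i)%:R < x ord0 i < 2 * L * (a i).+1%:R.
  move=> xa i; have /YL/(_ i) : eballs Y t (x - v a).
    by rewrite -(eballs_translate Y (v a) t)/= subrK.
  rewrite !mxE -natr1 ltr_norml => /andP[h1 h2].
  by apply/andP; split; [move: h1|move: h2]; set ai := (a i)%:R; nra.
have disj a b : a != b -> eballs (Ya a) t `&` eballs (Ya b) t = set0.
  move=> ab; apply/seteqP; split => // x [/cell xa /cell xb].
  have /ffunP : a = b; last by move=> ab'; move/eqP: ab; apply; exact/ffunP.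
  apply/ffunP => i; apply: val_inj; apply/eqP.
  have /andP[a1 a2] := xa i; have /andP[b1 b2] := xb i.
  have L2 : 0 < 2 * L by rewrite mulr_gt0.
  rewrite eqn_leq; apply/andP; split; rewrite -ltnS -(ltr_nat R) -(ltr_pM2l L2).
    exact: lt_trans a1 b2.
  exact: lt_trans b1 a2.
have inW a : eballs (Ya a) t `<=` @window R d n.
  move=> x /cell xa i; have /andP[a1 a2] := xa i; apply/andP; split.
    apply: (@le_trans _ _ 0); last by rewrite (le_trans _ (ltW a1))// !mulr_ge0// ltW.
    by rewrite mulNr oppr_le0 divr_ge0// powR_ge0.
  rewrite (le_trans (ltW a2))// (le_trans _ MW)// ler_wpM2l ?mulr_ge0 ?(ltW L0)//.
  by rewrite ler_nat.
pose p := fine (P [set w | hit Y e t (Phi w)]).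
pose q := fine (P [set w | full Y t (Phi w)]).
pose A a w : R := \1_(hit_or_crowded (Ya a) e t) (Phi w).
pose V a w : R := \1_(over_crowded (Ya a) t) (Phi w).
have mA a := measurable_hit_or_crowded (Ya a) e t.
have mV a := measurable_over_crowded (Ya a) t.
have mF a := measurable_full (Ya a) t.
have cardI : #|{ffun 'I_d -> 'I_M}|%:R = M%:R ^+ d :> R.
  by rewrite card_ffun !card_ord natrX.
have fullE a : P [set w | full (Ya a) t (Phi w)] = P [set w | full Y t (Phi w)].
  exact: stationary_full.
have hitE a : P [set w | hit (Ya a) e t (Phi w)] = P [set w | hit Y e t (Phi w)].
  exact: stationary_hit.
rewrite -/p -/q -cardI.
apply: (@second_moment_bound _ _ _ P _ A V) => //.
- by move=> a; exact: bounded_rv_config_indic.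
- by move=> a w; exact: indic_01.
- by move=> a; exact: bounded_rv_config_indic.
- by move=> a w; exact: indic_01.
- move=> a b ab; apply: (negative_correlation (f := @occupied_or_crowded R J)
    NA (BYa a) (BYa b) (disj _ _ ab)) => //.
  + exact: occupied_or_crowded_01.
  + exact: occupied_or_crowded_increasing.
  + exact: occupied_or_crowded_continuous.
  + by move=> w; exact: occupied_or_crowded_counts.
  + by move=> w; exact: occupied_or_crowded_counts.
- move=> a b ab; apply: (negative_correlation (f := @crowded R J)
    NA (BYa a) (BYa b) (disj _ _ ab)) => //.
  + exact: crowded_01.
  + exact: crowded_increasing.
  + exact: crowded_continuous.
  + by move=> w; exact: crowded_counts.
  + by move=> w; exact: crowded_counts.
- move=> a; rewrite /q -(fullE a) -(mean_config_indic P Phi (mF a)).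
  apply: mean_le => [||w]; try exact: bounded_rv_config_indic.
  rewrite !indicE ler_nat; case: (boolP (Phi w \in hit_or_crowded _ _ _)) => // /set_mem h.
  rewrite mem_set//; case: h => [h|/ltnW//].
  exact: template_npoints_ge (tempa a) _ h.
- move=> a; rewrite /q -(fullE a) -(mean_config_indic P Phi (mF a)).
  apply: mean_le => [||w]; try exact: bounded_rv_config_indic.
  rewrite !indicE ler_nat; case: (boolP (Phi w \in over_crowded _ _)) => // /set_mem h.
  by rewrite mem_set//; exact: ltnW.
- move=> a; rewrite /p -(hitE a) -(mean_config_indic P Phi (measurable_hit (Ya a) e t)).
  rewrite -meanB; [|exact: bounded_rv_config_indic..].
  by congr (mean P _); apply/funext => w; exact: indic_hit.
- by rewrite card_ffun !card_ord expn_gt0 M0.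
- by apply: measurable_rips_betti_eq0.
- move=> w /= b0 a; apply/eqP; rewrite -subr_eq0 /A /V indic_hit indicE memNset// => ha.
  have := hit_betti sb r0 (tempa a) k0 (@bounded_window R d n) (@inW a) ha.
  by apply; exact: b0.
Qed.
End LatticeOfCells.

Section CellBound.
Context (R : realType) (d k : nat) (dT : measure_display) (T : measurableType dT).
Variables (P : probability T R) (Phi : {mfun T >-> config R d}).
Local Notation J := (2 * k + 1).+1.

Lemma le_fine_probability (A B : set T) : measurable A -> measurable B -> A `<=` B ->
  fine (P A) <= fine (P B).
Proof.
move=> mA mB AB; rewrite fine_le ?fin_num_measure//.
by apply: le_measure => //; rewrite inE.
Qed.

Lemma fine_probability_01 (A : set T) : measurable A -> 0 <= fine (P A) <= 1.
Proof.
move=> mA; rewrite fine_ge0//= -lee_fin fineK ?probability_le1//.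
exact: fin_num_measure.
Qed.

(** Takes M of the order of n^(1/d) / L. *)
Lemma betti_eq0_cell_bound (s : 'I_J -> 'I_k.+1 * bool) (Y : 'M[R]_(J, d)) e t r L n :
  (0 < d)%N -> (0 < k)%N -> stationary P Phi -> negatively_associated P Phi ->
  bijective s -> 0 <= r -> octahedral_template s Y e t r ->
  (forall x, eballs Y t x -> forall i, `|x ord0 i| < L) -> 0 < L ->
  n%:R * fine (P [set w | hit Y e t (Phi w)]) ^+ 2 *
    fine (P [set w | rips_betti Phi k n r w = 0%N]) <=
  4 * (8 * L) ^+ d * fine (P [set w | full Y t (Phi w)]).
Proof.
move=> d0 k0 st NA sb r0 temp YL L0.
have mh := measurable_config_event Phi (@measurable_hit R d k Y e t).
have mf := measurable_config_event Phi (@measurable_full R d k Y t).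
have mb : measurable [set w | rips_betti Phi k n r w = 0%N].
  exact: measurable_rips_betti_eq0.
have pq : fine (P [set w | hit Y e t (Phi w)]) <= fine (P [set w | full Y t (Phi w)]).
  apply: le_fine_probability => // w [h _].
  exact: template_npoints_ge temp _ h.
have /andP[p0 p1] := fine_probability_01 mh.
have /andP[z0 z1] := fine_probability_01 mb.
have moment M := @betti_eq0_second_moment R d k _ _ P Phi s Y e t r L M n
  d0 k0 st NA sb r0 temp YL.
move: pq p0 p1 z0 z1 moment.
set p := fine _; set q := fine _; set z := fine _ => pq p0 p1 z0 z1 moment.
set h := n%:R `^ d%:R^-1 in moment.
have hd : n%:R = h ^+ d.
  by rewrite -powR_mulrn ?powR_ge0// -powRrM mulVf ?pnatr_eq0 -?lt0n// powRr1.
have h0 : 0 <= h by exact: powR_ge0.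
have pp : p ^+ 2 * z <= p.
  rewrite -[leRHS]mulr1 expr2 -mulrA ler_wpM2l// mulr_ile1//.
(* If the window does not contain a cell, then n <= (4L)^d and p <= q suffice. *)
have [hL|hL] := ltP h (4 * L).
  apply: (@le_trans _ _ ((8 * L) ^+ d * q)).
    rewrite -mulrA ler_pM ?exprn_ge0 ?mulr_ge0 ?exprn_ge0 ?ler0n//.
      by rewrite hd lerXn2r ?nnegrE ?mulr_ge0 ?(ltW L0)//; move: hL L0; lra.
    exact: le_trans pq.
  rewrite -[leRHS]mulrA ler_peMl ?mulr_ge0 ?exprn_ge0 ?mulr_ge0 ?(ltW L0) ?ler1n//.
  exact: le_trans pq.
have L4 : 0 < 4 * L by rewrite mulr_gt0.
pose M := Num.truncn (h / (4 * L)).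
have Mle : M%:R <= h / (4 * L) by rewrite truncn_le divr_ge0// ltW.
have Mgt : h / (4 * L) < M.+1%:R by exact: truncnS_gt.
have M0 : (0 < M)%N by rewrite truncn_gt0 ler_pdivlMr// mul1r.
have hM : h <= 8 * L * M%:R.
  have := ltW Mgt; rewrite ler_pdivrMr// => /le_trans; apply.
  have M1 : 1 <= M%:R :> R by rewrite ler1n.
  by rewrite -natr1; move: L0 M1; set m := M%:R => *; nra.
have := moment M M0.
have -> : 2 * L * M%:R <= h / 2.
  by move: Mle; rewrite ler_pdivlMr//; lra.
move=> /(_ isT) m2.
rewrite hd; apply: (@le_trans _ _ ((8 * L * M%:R) ^+ d * p ^+ 2 * z)).
  have hMd : h ^+ d <= (8 * L * M%:R) ^+ d.
    by rewrite lerXn2r ?nnegrE//; apply: le_trans hM.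
  by apply: ler_wpM2r => //; apply: ler_wpM2r => //; exact: exprn_ge0.
rewrite exprMn [4 * _]mulrC -!mulrA ler_wpM2l ?exprn_ge0 ?mulr_ge0 ?(ltW L0)//.
by move: m2; rewrite -!mulrA.
Qed.

End CellBound.

(** * Octahedral configurations *)

Section OctahedralConfigurations.
Variables (R : realType) (d k : nat).
Local Notation J := (2 * k + 1).+1.

(** The geometric graph at scale b on the rows, which are distinct, is a copy of
    O_k, with vertices labelled by s. *)
Definition octahedral (b : R) (s : 'I_J -> 'I_k.+1 * bool) (X : 'M[R]_(J, d)) : Prop :=
  forall m l, m != l ->
    row m X != row l X /\ (enorm (row m X - row l X) <= b) = ((s m).1 != (s l).1).

Lemma graph_iso_octahedral (X : 'M[R]_(J, d)) :
  graph_iso (@cross_polytope k) (@geometric_graph R d (row_fset X) 1) ->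
  exists2 s, bijective s & octahedral 1 s X.
Proof.
move=> [h [h' hK h'K] hE].
have XF m : row m X \in row_fset X by apply/imfsetP; exists m.
pose x m : row_fset X := FSetSub (XF m).
have cardF : #|{: row_fset X}| = J.
  by rewrite -(bij_eq_card (Bijective hK h'K)) card_prod card_ord card_bool; lia.
have xs y : exists m, x m = y.
  have /imfsetP[m /= _ yE] := valP y; exists m; exact: val_inj.
have [x' x'K] := choice xs.
have x'inj : injective x' by exact: can_inj x'K.
have x'bij : bijective x' by apply: inj_card_bij => //; rewrite card_ord cardF.
have xK : cancel x x'.
  have [x'' _ x''K] := x'bij; move=> m.
  by rewrite -[m in x m]x''K x'K x''K.
have xbij : bijective x by exists x'.
exists (h' \o x); first by apply: bij_comp => //; exists h.
move=> m l ml; have xml : x m != x l by rewrite (can_eq xK).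
split; first by apply: contra xml => /eqP e; apply/eqP/val_inj.
have := hE (h' (x m)) (h' (x l)); rewrite !h'K /geometric_graph/= xml/=.
by move=> ->.
Qed.

(** Two antipodal vertices have a common neighbour, as k > 0. *)
Lemma octahedral_diameter b s (X : 'M[R]_(J, d)) m l : 0 < b -> (0 < k)%N ->
  bijective s -> octahedral b s X -> enorm (row m X - row l X) <= 2 * b.
Proof.
move=> b0 k0 [s' sK s'K] oct.
have [->|ml] := eqVneq m l; first by rewrite subrr enorm0 mulr_ge0// ltW.
have [] := boolP ((s m).1 != (s l).1).
  by rewrite -(oct m l ml).2 => /le_trans; apply; rewrite ler_peMl ?ler1n// ltW.
move=> /negPn/eqP sml.
have [i iE] : exists i : 'I_k.+1, i != (s m).1.
  have [m0|m0] := eqVneq (s m).1 ord0; last by exists ord0; rewrite eq_sym.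
  by exists ord_max; rewrite m0 -val_eqE/= -lt0n.
pose p := s' (i, true).
have sp : (s p).1 = i by rewrite /p s'K.
have mp : m != p by apply: contraNneq iE => mE; rewrite -sp -mE.
have pl : p != l by apply: contraNneq iE => pE; rewrite sml -pE sp.
rewrite (le_trans (enorm_triangle (row p X) _ _))// mulr_natl mulr2n lerD//.
  by rewrite (oct m p mp).2 sp eq_sym.
by rewrite (oct p l pl).2 sp -sml.
Qed.

(** The conditions on a template are finitely many strict inequalities when no
    distance equals b; B e bounds the change of distances together with that of
    the scale. *)
Lemma near_octahedral_template b t s (X : 'M[R]_(J, d)) : 0 < b -> b < t ->
  octahedral b s X ->
  (forall m l, m != l -> enorm (row m X - row l X) != b) ->
  \forall e \near 0^'+, forall r Y, `|r - b| <= e -> ball X e Y ->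
    octahedral_template s Y e t r.
Proof.
move=> b0 bt oct nb.
have bnd (e : R) (Y : 'M[R]_(J, d)) m l : ball X e Y ->
    `|enorm (row m Y - row l Y) - enorm (row m X - row l X)| <= 2 * (d%:R * e).
  move=> [e0 XY].
  have c m' : enorm (row m' Y - row m' X) <= d%:R * e.
    by apply: ball_enorm; split => // i j; rewrite /ball/= !mxE; exact: XY.
  have c1 := c m; have c2 := c l.
  have h1 := enorm_triangle (row m X) (row m Y) (row l Y).
  have h2 := enorm_triangle (row l X) (row m X) (row l Y).
  have h3 := enorm_triangle (row m Y) (row m X) (row l X).
  have h4 := enorm_triangle (row l Y) (row m Y) (row l X).
  have h5 := enormB (row m Y) (row m X); have h6 := enormB (row l Y) (row l X).
  by move: c1 c2; set c0 := d%:R * e => c1 c2; rewrite ler_distl; apply/andP; split; lra.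
pose B := 4 * d%:R + 1 : R.
have near_pair m l : \forall e \near 0^'+,
    ((s m).1 != (s l).1 -> enorm (row m X - row l X) + B * e < b) /\
    (m != l -> (s m).1 = (s l).1 -> b + B * e < enorm (row m X - row l X)) /\
    (m != l -> 0 + B * e < enorm (row m X - row l X)).
  have [<-|ml] := eqVneq m l.
    near=> e; split => [|]; last by [].
    rewrite eqxx => _; rewrite subrr enorm0.
    by near: e; exact: near_right0_lt.
  have [Xml adj] := oct m l ml.
  have Xml0 : 0 < enorm (row m X - row l X).
    rewrite lt_def enorm_ge0 andbT; apply: contraNneq Xml => /enorm_eq0/eqP.
    by rewrite subr_eq0.
  have n3 := @near_right0_lt R 0 B _ Xml0.
  have [sml|sml] := eqVneq (s m).1 (s l).1.
    have bX : b < enorm (row m X - row l X).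
      by rewrite ltNge adj sml eqxx.
    have n2 := @near_right0_lt R b B _ bX.
    by near=> e; split => //; split => _; [move=> _|]; near: e.
  have Xb : enorm (row m X - row l X) < b.
    by rewrite lt_neqAle nb//= adj sml.
  have n1 := @near_right0_lt R _ B _ Xb.
  near=> e; split => [_|]; first by near: e.
  by split => [_ sE|_]; [rewrite sE eqxx in sml|near: e].
have near_all : \forall e \near 0^'+, forall p : 'I_J * 'I_J,
    ((s p.1).1 != (s p.2).1 -> enorm (row p.1 X - row p.2 X) + B * e < b) /\
    (p.1 != p.2 -> (s p.1).1 = (s p.2).1 -> b + B * e < enorm (row p.1 X - row p.2 X)) /\
    (p.1 != p.2 -> 0 + B * e < enorm (row p.1 X - row p.2 X)).
  by apply: filter_forall => p; exact: near_pair.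
have near_t := @near_right0_lt R b B t bt.
near=> e.
have e0 : 0 < e by near: e; exact: nbhs_right_gt.
have all : forall p : 'I_J * 'I_J,
    ((s p.1).1 != (s p.2).1 -> enorm (row p.1 X - row p.2 X) + B * e < b) /\
    (p.1 != p.2 -> (s p.1).1 = (s p.2).1 -> b + B * e < enorm (row p.1 X - row p.2 X)) /\
    (p.1 != p.2 -> 0 + B * e < enorm (row p.1 X - row p.2 X)) by near: e.
have te : b + B * e < t by near: e.
have de0 : 0 <= d%:R * e by rewrite mulr_ge0// ltW.
have BE : B * e = 4 * (d%:R * e) + e by rewrite /B; ring.
move=> r Y; rewrite ler_distl => /andP[rb1 rb2] XY; split => //.
- move=> m l sml; have [/(_ sml) + _] := all (m, l); rewrite BE/=.
  have := bnd e Y m l XY; rewrite ler_norml => /andP[_].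
  by set c := d%:R * e; set a := enorm _; set a' := enorm _; lra.
- move=> m l ml sml; have [_ [/(_ ml sml) + _]] := all (m, l); rewrite BE/=.
  have := bnd e Y m l XY; rewrite ler_norml => /andP[+ _].
  by set c := d%:R * e; set a := enorm _; set a' := enorm _; lra.
- move=> m l ml; have [_ [_ /(_ ml)]] := all (m, l); rewrite BE/=.
  have := bnd e Y m l XY; rewrite ler_norml => /andP[+ _].
  by set c := d%:R * e; set a := enorm _; set a' := enorm _; lra.
- by move: te rb2 de0; rewrite BE; set c := d%:R * e; lra.
Unshelve. all: by end_near. Qed.

End OctahedralConfigurations.

(** * A template for small scales *)

Section AnchoredRows.
Variables (R : realType) (d j : nat).

Lemma row_anchor0 (Z : 'M[R]_(j, d)) : row ord0 (anchor Z) = 0.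
Proof. exact: (row_cons_row0 (0, Z)). Qed.

Lemma row_anchorS (Z : 'M[R]_(j, d)) (i : 'I_j) : row (lift ord0 i) (anchor Z) = row i Z.
Proof. exact: (row_cons_rowS (0, Z) i). Qed.

Lemma row_scale m c (X : 'M[R]_(j, d)) : row m (c *: X) = c *: row m X.
Proof. by apply/rowP => i; rewrite !mxE. Qed.

End AnchoredRows.

Section SparseTemplate.
Variables (R : realType) (d k : nat).
Local Notation j := (2 * k + 1)%N.
Local Notation J := (2 * k + 1).+1.

Definition normalize (Y : 'M[R]_(J, d)) : 'M[R]_(J, d) := translate_mx (- row ord0 Y) Y.

Lemma row_normalize Y m : row m (normalize Y) = row m Y - row ord0 Y.
Proof. exact: row_translate_mx. Qed.

Lemma normalizeE Y :
  normalize Y = anchor (\matrix_(i < j) (row (lift ord0 i) Y - row ord0 Y)).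
Proof.
apply/row_matrixP => m; rewrite row_normalize; case: (unliftP ord0 m) => [i ->|->].
  by rewrite row_anchorS rowK.
by rewrite row_anchor0 subrr.
Qed.

Lemma spread_normalize (Y : 'M[R]_(J, d)) :
  (forall m, enorm (row m Y - row ord0 Y) <= J%:R) -> anchored_ball (normalize Y).
Proof.
move=> YJ; split; first by rewrite row_normalize subrr.
by move=> i; rewrite row_normalize.
Qed.

Lemma row_ball (X Y : 'M[R]_(J, d)) e m : ball X e Y -> ball (row m X) e (row m Y).
Proof. by move=> [e0 XY]; split => // i l; rewrite !mxE; exact: XY. Qed.

(** As mu_0 > 0, there is an octahedral tuple Z at which g is positive and
    continuous.  Adjacent points of Z may be at distance exactly 1, which a
    perturbation could increase; shrinking Z by a factor 1 - eta makes these
    distances smaller than 1 and keeps antipodal points at distance more than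
    1. *)
Lemma sparse_template (g : 'M[R]_(J, d) -> R) : (0 < k)%N ->
  (forall Y, anchored_ball Y -> 0 <= g Y) -> scaling_ae_continuous g ->
  (0 < mu0 (@cross_polytope k) g)%E ->
  exists s Y e c, [/\ bijective s, 0 < c, octahedral_template s Y e 2 1,
    octahedral 1 s Y &
    row ord0 Y = 0 /\ forall Y', ball Y e Y' -> anchored_ball (normalize Y') /\ c <= g (normalize Y')].
Proof.
move=> k0 g0 gc; rewrite /mu0 => mu0gt.
have J4 : 4 <= J%:R :> R by rewrite (ler_nat R 4 J); lia.
have ind (Z : 'M[R]_(j, d)) : graph_indicator (@cross_polytope k) Z != 0 ->
    exists2 s, bijective s & octahedral 1 s (anchor Z).
  rewrite /graph_indicator; case: asboolP; last by rewrite eqxx.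
  by move=> /graph_iso_octahedral h _; exact: h.
have ball2 s (Y : 'M[R]_(J, d)) : row ord0 Y = 0 -> bijective s -> octahedral 1 s Y ->
    anchored_ball Y.
  move=> Y0 sb oct; split => // m; rewrite -[row m Y]subr0 -{1}Y0.
  rewrite (le_trans (octahedral_diameter _ _ ltr01 k0 sb oct))//.
  by move: J4; lra.
have [Z Zc] : exists2 Z : 'M[R]_(j, d), anchored_ball (anchor Z) ->
     g (anchor Z') @[Z' --> within (@anchor R d j @^-1` @anchored_ball R d j) (nbhs Z)] --> g (anchor Z)
     & (0 < (graph_indicator (@cross_polytope k) Z * g (anchor Z))%:E)%E.
  apply: (integral_gt0_exists gc).
    move=> Z; rewrite lee_fin.
    have [->|/ind[s sb oct]] := eqVneq (graph_indicator (@cross_polytope k) Z) 0.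
      by rewrite mul0r.
    rewrite mulr_ge0 ?ler0n// g0//.
    by apply: ball2 sb oct; exact: row_anchor0.
  rewrite ltNge; apply/negP => le0; move: mu0gt; apply/negP; rewrite -leNgt.
  by rewrite mule_ge0_le0// lee_fin invr_ge0.
rewrite lte_fin => indg.
have ind0 : graph_indicator (@cross_polytope k) Z != 0.
  by apply: contraTneq indg => ->; rewrite mul0r ltxx.
have [s sb oct] := ind Z ind0.
have aZ : anchored_ball (anchor Z).
  by apply: ball2 sb oct; exact: row_anchor0.
have gZ : 0 < g (anchor Z).
  by rewrite lt_def g0// andbT; apply: contraTneq indg => ->; rewrite mulr0 ltxx.
have [delta delta0 Hdelta] : exists2 delta, 0 < delta & forall Z', ball Z delta Z' ->
    anchored_ball (anchor Z') -> g (anchor Z) / 2 <= g (anchor Z').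
  have g2 : 0 < g (anchor Z) / 2 by rewrite divr_gt0.
  have /cvgrPdist_lt/(_ _ g2) := Zc aZ.
  move=> /nbhs_ballP[delta /= delta0 H]; exists delta => // Z' ZZ' aZ'.
  have := H Z' ZZ' aZ'; rewrite ltr_distlC => /andP[+ _].
  by set a := g (anchor Z); set b := g (anchor Z'); lra.
set X := anchor Z in oct aZ gZ Hdelta.
have [eta /andP[eta0 eta1] [etaZ etaX]] : exists2 eta, 0 < eta < 1 &
    `|Z| * eta < delta /\ forall m l, m != l -> (s m).1 = (s l).1 ->
      1 < (1 - eta) * enorm (row m X - row l X).
  have near_pair (p : 'I_J * 'I_J) : \forall eta \near 0^'+,
      p.1 != p.2 -> (s p.1).1 = (s p.2).1 ->
      - enorm (row p.1 X - row p.2 X) + enorm (row p.1 X - row p.2 X) * eta < - 1.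
    have [pp|pp] := eqVneq p.1 p.2; first by near=> eta => /negP.
    have [ss|ss] := eqVneq (s p.1).1 (s p.2).1; last by near=> eta => _ E; rewrite E eqxx in ss.
    have lt1 : - enorm (row p.1 X - row p.2 X) < - 1.
      by rewrite ltrN2 ltNge (oct _ _ pp).2 ss eqxx.
    have := @near_right0_lt _ _ (enorm (row p.1 X - row p.2 X)) _ lt1.
    by apply: filterS => eta h _ _.
  have near_all : \forall eta \near 0^'+, forall p : 'I_J * 'I_J,
      p.1 != p.2 -> (s p.1).1 = (s p.2).1 ->
      - enorm (row p.1 X - row p.2 X) + enorm (row p.1 X - row p.2 X) * eta < - 1.
    by apply: filter_forall => p; exact: near_pair.
  have nZ := @near_right0_lt _ 0 `|Z| _ delta0.
  have [e1 e10 He1] := near_right0P (filterI near_all nZ).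
  exists (Num.min e1 1 / 2).
    by rewrite divr_gt0 ?lt_min ?e10 ?ltr01//= ltr_pdivrMr// mul1r gt_min ltr1n orbT.
  have [|all] := He1 (Num.min e1 1 / 2).
    rewrite divr_gt0 ?lt_min ?e10 ?ltr01//= ltr_pdivrMr// gt_min ltr_pMr//.
    by rewrite ltr1n.
  rewrite add0r => Zd; split => // m l ml sml.
  have := all (m, l) ml sml; rewrite /=.
  by set x := enorm _; set y := _ / _; nra.
pose X1 := (1 - eta) *: X.
have eta1' : 0 < 1 - eta by rewrite subr_gt0.
have rowX1 m l : enorm (row m X1 - row l X1) = (1 - eta) * enorm (row m X - row l X).
  by rewrite !row_scale -scalerBr enormZ gtr0_norm.
have X10 : row ord0 X1 = 0 by rewrite row_scale row_anchor0 scaler0.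
have adj1 m l : m != l -> (s m).1 != (s l).1 -> (1 - eta) * enorm (row m X - row l X) < 1.
  move=> ml; rewrite -(oct m l ml).2 => h; apply: (@le_lt_trans _ _ (1 - eta)).
    by rewrite ler_piMr// ltW.
  by rewrite ltrBlDl ltrDr.
have oct1 : octahedral 1 s X1.
  move=> m l ml; split.
    have := (oct m l ml).1; apply: contra => /eqP e; apply/eqP.
    have /eqP : enorm (row m X1 - row l X1) = 0 by rewrite e subrr enorm0.
    by rewrite rowX1 mulf_eq0 (gt_eqF eta1')/= => /eqP/enorm_eq0/eqP; rewrite subr_eq0 => /eqP.
  rewrite rowX1; have [sml|sml] := eqVneq (s m).1 (s l).1.
    by apply/negbTE; rewrite -ltNge etaX.
  by rewrite ltW// adj1.
have nb1 m l : m != l -> enorm (row m X1 - row l X1) != 1.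
  move=> ml; rewrite rowX1; have [sml|sml] := eqVneq (s m).1 (s l).1.
    by rewrite gt_eqF// etaX.
  by rewrite lt_eqF// adj1.
have n1 := near_octahedral_template ltr01 (ltr1n R 2) oct1 nb1.
have e2 := @near_right0_lt R (`|Z| * eta) 2 _ etaZ.
have e3 := @near_right0_lt R 0 d%:R 1 ltr01.
have [e [e0 tempe [eZ ed]]] : exists e, [/\ 0 < e,
    forall Y, ball X1 e Y -> octahedral_template s Y e 2 1 &
    `|Z| * eta + 2 * e < delta /\ 0 + d%:R * e < 1].
  have [e1 e10 He1] := near_right0P (filterI n1 (filterI e2 e3)).
  exists (e1 / 2); have [|H [? ?]] := He1 (e1 / 2).
    by rewrite divr_gt0//= ltr_pdivrMr// ltr_pMr// ltr1n.
  split => //; first by rewrite divr_gt0.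
  by move=> Y; apply: H; rewrite subrr normr0 divr_ge0// ltW.
exists s, X1, e, (g X / 2); split => //; first by rewrite divr_gt0.
  by apply: tempe; exact: ballxx.
split=> // Y' X1Y'.
have aY' : anchored_ball (normalize Y').
  apply: spread_normalize => m.
  have b0 := ball_enorm (row_ball ord0 X1Y').
  have bm := ball_enorm (row_ball m X1Y').
  have t1 := enorm_triangle (row m X1) (row m Y') (row ord0 Y').
  have t2 := enorm_triangle (row ord0 X1) (row m X1) (row ord0 Y').
  have t3 := octahedral_diameter m ord0 ltr01 k0 sb oct1.
  have t4 := enormB (row ord0 X1) (row ord0 Y').
  move: b0 bm ed J4; set c := d%:R * e => *; lra.
split => //; rewrite normalizeE; apply: Hdelta; last by rewrite -normalizeE.
have delta0' := delta0; apply/ball_mxP => // i l; rewrite !mxE.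
move: X1Y' => /(ball_mxP _ _ e0) X1Y'.
have := X1Y' (lift ord0 i) l; have := X1Y' ord0 l.
have -> : X1 ord0 l = 0 by move/rowP: X10 => /(_ l); rewrite !mxE.
have -> : X1 (lift ord0 i) l = (1 - eta) * Z i l.
  by have /rowP/(_ l) := row_anchorS Z i; rewrite !mxE => <-.
rewrite sub0r normrN; set a := Y' _ _; set b := Y' _ _; set z := Z i l.
have zZ : `|z| <= `|Z| by exact: mx_entry_le_norm.
move=> ha hb; apply: (@le_lt_trans _ _ (`|(1 - eta) * z - b| + `|a| + `|eta * z|)).
  have -> : z - (b - a) = ((1 - eta) * z - b) + a + eta * z by ring.
  by rewrite (le_trans (ler_normD _ _))// lerD2r ler_normD.
rewrite (@normrM _ eta) gtr0_norm//; move: ha hb zZ eZ; set A := `|a|; set B := `|_ - b|.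
by move: eta0; clear; nra.
Unshelve. all: by end_near. Qed.
End SparseTemplate.

(** * Factorial moments *)

Section FactorialMoments.
Context (R : realType) (d : nat) (dT : measure_display) (T : measurableType dT).
Variables (P : probability T R) (Phi : {mfun T >-> config R d}).
Implicit Types (B : set 'rV[R]_d) (phi : config R d).

Lemma measurable_row m (i : 'I_m) (B : set 'rV[R]_d) : measurable B ->
  measurable [set X : 'M[R]_(m, d) | B (row i X)].
Proof.
move=> mB; rewrite -[X in measurable X]setTI.
suff : measurable_fun setT (fun X : 'M[R]_(m, d) => row i X) by exact.
apply: measurable_fun_mx => i' l.
rewrite (_ : (fun _ => _) = (fun X : 'M[R]_(m, d) => X i l)).
  exact: measurable_mx_entry.
by apply/funext => X; rewrite mxE.
Qed.

Lemma measurable_rows m (B : set 'rV[R]_d) : measurable B ->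
  measurable [set X : 'M[R]_(m, d) | forall i, B (row i X)].
Proof.
move=> mB; rewrite (_ : mkset _ = \bigcap_(i in [set: 'I_m]) [set X | B (row i X)]).
  by apply: fin_bigcap_measurable => // i _; exact: measurable_row.
by apply/seteqP; split => [X h i _|X h i]; [exact: h|exact: h].
Qed.

(** The factorial moment counts tuples of distinct points in B, so it is the
    integral of the joint intensity over tuples of points of B. *)
Lemma factorial_moment_le m (rho : 'M[R]_(m.+1, d) -> R) r c l B :
  joint_intensity P Phi rho -> translation_invariant rho -> 0 < r -> 0 < l -> 0 <= c ->
  measurable B -> (forall x, B x -> forall i, `|x ord0 i| < l) ->
  (forall x y, B x -> B y -> enorm (x - y) <= m.+1%:R * r) ->
  (forall Y, anchored_ball Y -> rho (r *: Y) <= c) ->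
  (\int[P]_w ((npoints (Phi w) B) ^_ m.+1)%:R%:E <= (c * (2 * l) ^+ (m.+1 * d))%:E)%E.
Proof.
move=> [mrho rho0 rhoE] rhoT r0 l0 c0 mB Bl Br rhoc.
have bB : bounded_set B.
  apply: (@bounded_mx_set _ _ _ _ l) => X BX i i'.
  by rewrite (ord1 i) ltW// Bl.
pose A := [set X : 'M[R]_(m.+1, d) | forall i, B (row i X)].
have mA : measurable A by exact: measurable_rows.
have -> : (\int[P]_w ((npoints (Phi w) B) ^_ m.+1)%:R%:E =
    \int[P]_w counting (factorial_power m.+1 (Phi w) `&` A))%E.
  by apply: eq_integral => w _; rewrite counting_factorial_power.
rewrite rhoE//; apply: (le_trans (intensity_le rhoT r0 mA rho0 rhoc _)).
  by move=> X AX i; apply: Br; exact: AX.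
rewrite EFinM lee_wpmul2l ?lee_fin// -(lebesgue_mx_ball (0 : 'M[R]_(m.+1, d)) l0).
apply: le_measure; rewrite ?inE//; first exact: measurable_mx_ball.
move=> X AX; apply/ball_mxP => // i j.
by rewrite mxE sub0r normrN; have := Bl _ (AX i) j; rewrite mxE.
Qed.

End FactorialMoments.

Section HitLowerBound.
Context (R : realType) (d k : nat) (dT : measure_display) (T : measurableType dT).
Variables (P : probability T R) (Phi : {mfun T >-> config R d}).
Local Notation J := (2 * k + 1).+1.

(** If the region has at most J points and some tuple is counted, then the template
    is hit and at most J! tuples are counted; if it has N > J points, then at
    most N^_J <= N^_(J+1) tuples are counted. *)
Lemma counting_ball_le_hit (s : 'I_J -> 'I_k.+1 * bool) (Y : 'M[R]_(J, d)) e t r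
    (phi : config R d) : 0 <= r -> octahedral_template s Y e t r ->
  (counting (factorial_power J phi `&` ball Y e) <=
   (J`!%:R * (\1_(hit Y e t) phi : R) + ((npoints phi (eballs Y t)) ^_ J.+1)%:R)%:E)%E.
Proof.
move=> r0 temp; have e0 : 0 < e by case: temp.
set N := npoints phi _.
have sub : factorial_power J phi `&` ball Y e `<=`
    factorial_power J phi `&` [set X | forall i, eballs Y t (row i X)].
  move=> X [fX YX]; split => // i; apply: (ball_template r0 temp (m := i)).
  exact: row_ball.
have le1 := counting_le R sub.
rewrite counting_factorial_power in le1; last exact: bounded_eballs.
have [->|/set0P[X [[_ Xphi] YX]]] := eqVneq (factorial_power J phi `&` ball Y e) set0.
  rewrite /counting asboolT// fset_set0 cardfs0 lee_fin.
  by rewrite addr_ge0 ?mulr_ge0 ?ler0n.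
apply: (le_trans le1); rewrite lee_fin -/N indicE.
have hitX m : (0 < npoints phi (ball (row m Y) e))%N.
  apply/npoints_gt0P; first exact: bounded_ball.
  by exists (row m X) => //; exact: row_ball.
have [NJ|JN] := leqP N J.
  rewrite mem_set; last by split.
  rewrite mulr1 ler_wpDr ?ler0n// ler_nat.
  by move: NJ; rewrite leq_eqVlt => /orP[/eqP ->|/ffact_small ->]; rewrite ?ffactnn.
rewrite ler_wpDl ?mulr_ge0 ?ler0n// ler_nat [X in (_ <= X)%N]ffactnSr leq_pmulr//.
by rewrite subn_gt0.
Qed.


Lemma hit_lower_bound (rho : 'M[R]_(J, d) -> R) (s : 'I_J -> 'I_k.+1 * bool)
    (Y : 'M[R]_(J, d)) e t r a b :
  joint_intensity P Phi rho -> 0 <= r -> octahedral_template s Y e t r ->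
  (a%:E <= \int[lebesgue_mx R J d]_(X in ball Y e) (rho X)%:E)%E ->
  (\int[P]_w ((npoints (Phi w) (eballs Y t)) ^_ J.+1)%:R%:E <= b%:E)%E ->
  a <= J`!%:R * fine (P [set w | hit Y e t (Phi w)]) + b.
Proof.
move=> [mrho rho0 rhoE] r0 temp a_le b_ge.
have mh := measurable_config_event Phi (@measurable_hit R d k Y e t).
rewrite -lee_fin (le_trans a_le)//.
rewrite -rhoE; last exact: measurable_mx_ball.
have mN : measurable_fun [set: T] (fun w => (((npoints (Phi w) (eballs Y t)) ^_ J.+1)%:R : R)%:E).
  apply/measurable_EFinP; apply: (@measurableT_comp _ _ _ _ _ _ (fun n : nat => (n ^_ J.+1)%:R : R)) => //.
  apply: (measurableT_comp (measurable_npoints _ _)) => //; last exact: bounded_eballs.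
  exact: measurable_eballs.
have mI : measurable_fun [set: T] (fun w => ((\1_[set w | hit Y e t (Phi w)] w : R)%:E)).
  apply/measurable_EFinP; exact: measurable_indic.
apply: (@le_trans _ _ (\int[P]_w (J`!%:R%:E * (\1_[set w | hit Y e t (Phi w)] w : R)%:E +
    ((npoints (Phi w) (eballs Y t)) ^_ J.+1)%:R%:E))%E).
  apply: ge0_le_integral_nonmeasurable => [w _|w _].
    by rewrite /counting; case: ifP => _; rewrite ?lee_fin ?leey.
  apply: (le_trans (counting_ball_le_hit (Phi w) r0 temp)).
  by rewrite EFinD EFinM !indicE.
rewrite ge0_integralD//=; last exact: measurable_funeM.
rewrite ge0_integralZl//.
rewrite integral_indic// setIT EFinD EFinM fineK ?fin_num_measure//.
by rewrite leeD2l.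
Qed.

End HitLowerBound.

(** * Intensities at small scales *)

Section SparseIntensity.
Variables (R : realType) (d k : nat).
Local Notation J := (2 * k + 1).+1.
Local Notation lam := (lebesgue_mx R J d).
Variables (rho : 'M[R]_(J, d) -> R) (f : R -> R) (g : 'M[R]_(J, d) -> R).

Lemma octahedral_template_scale (s : 'I_J -> 'I_k.+1 * bool) (Y : 'M[R]_(J, d)) e t r b :
  0 < b -> octahedral_template s Y e t r ->
  octahedral_template s (b *: Y) (b * e) (b * t) (b * r).
Proof.
move=> b0 [e0 near far sep rt].
have diff m l : enorm (row m (b *: Y) - row l (b *: Y)) = b * enorm (row m Y - row l Y).
  by rewrite !row_scale -scalerBr enormZ gtr0_norm.
have c2 : 2 * (d%:R * (b * e)) = b * (2 * (d%:R * e)) by ring.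
split; first by rewrite mulr_gt0.
- by move=> m l ml; rewrite diff c2 -mulrDr ler_pM2l// near.
- by move=> m l ml sml; rewrite diff c2 -mulrDr ltr_pM2l// far.
- by move=> m l ml; rewrite diff c2 ltr_pM2l// sep.
- by rewrite c2 -mulrDr ler_pM2l.
Qed.

(** Both sides are compared with the intensity at 2rY, which is at most C f(r)
    because 2Y is still in the domain of g, and of the order of f(2r) because
    g(Y) > 0. *)
Lemma scaling_doubling (Y : 'M[R]_(J, d)) : scaling_functions rho f g ->
  anchored_ball Y -> anchored_ball (2 *: Y) -> 0 < g Y ->
  exists2 D, 0 < D & \forall r \near 0^'+, f (2 * r) <= D * f r.
Proof.
move=> [f0 _ [[C C0 rhoC] _] rhog _] aY a2Y gY.
have g2 : 0 < g Y / 2 by rewrite divr_gt0.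
have near_g : \forall r \near 0^'+, g Y / 2 * f r <= rho (r *: Y).
  have /cvgrPdist_lt/(_ _ g2) := rhog Y aY.
  apply: filterS2 (nbhs_right_gt 0) => r r0.
  rewrite ltr_distlC => /andP[+ _].
  have : 0 <= f r by rewrite f0// ltW.
  rewrite le_eqVlt => /orP[/eqP <-|fr0].
    by rewrite invr0 mulr0 => h; exfalso; move: h gY; set a := g Y; lra.
  move=> h; rewrite -ler_pdivlMr//; apply: ltW; move: h.
  by set a := g Y; set b := _ / f r; lra.
exists (C * (g Y / 2)^-1); first by rewrite mulr_gt0// invr_gt0.
have near_2g := near_right0_scale (ltr0Sn R 1) near_g.
apply: filterS2 rhoC near_2g => r rC r2g.
rewrite mulrAC ler_pdivlMr// mulrC (le_trans r2g)//.
by rewrite mulrC -scalerA; exact: rC.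
Qed.

Lemma intensity_normalize X r : translation_invariant rho ->
  rho (r *: X) = rho (r *: normalize X).
Proof.
move=> rhoT; rewrite -(rhoT (- (r *: row ord0 X)) (r *: X)); congr rho.
apply/row_matrixP => m; rewrite row_translate_mx !row_scale row_normalize.
by rewrite scalerBr.
Qed.

(** Fatou's lemma along a sequence of scales that violates the bound.  The ratio
    rho(rX)/f(r) tends to g at the translate of X whose first point is 0. *)
Lemma ball_intensity_lower (Y : 'M[R]_(J, d)) e c : scaling_functions rho f g ->
  translation_invariant rho -> measurable_fun setT rho -> (forall X, 0 <= rho X) ->
  0 < e -> 0 < c ->
  (forall X, ball Y e X -> anchored_ball (normalize X) /\ c <= g (normalize X)) ->
  \forall r \near 0^'+, ((c / 2 * (2 * e) ^+ (J * d) * f r)%:E <=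
     \int[lam]_(X in ball Y e) (rho (r *: X))%:E)%E.
Proof.
move=> [f0 _ _ rhog _] rhoT mrho rho0 e0 c0 Yc; apply: contrapT => nlow.
set v := (2 * e) ^+ (J * d) in nlow.
have v0 : 0 < v by rewrite exprn_gt0// mulr_gt0.
have bad m : exists r, 0 < r < m.+1%:R^-1 /\
    (\int[lam]_(X in ball Y e) (rho (r *: X))%:E < (c / 2 * v * f r)%:E)%E.
  apply: contrapT => none; apply: nlow; near=> r.
  rewrite leNgt; apply/negP => lt; apply: none; exists r; split => //.
  by apply/andP; split; near: r; [exact: nbhs_right_gt|apply: nbhs_right_lt; rewrite invr_gt0].
have {bad}[r rP] := choice bad.
have r_gt0 m : 0 < r m by have [/andP[]] := rP m.
have r_cvg : r m @[m --> \oo] --> 0.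
  apply: (squeeze_cvgr (f := fun=> 0) (h := fun m => m.+1%:R^-1)) => //.
  - by apply: nearW => m; have [/andP[/ltW -> /ltW ->]] := rP m.
  - exact: cvg_cst.
  - exact: cvg_harmonic.
have int0 m : (0 <= \int[lam]_(X in ball Y e) (rho (r m *: X))%:E)%E.
  by apply: integral_ge0 => X _; rewrite lee_fin.
have fr m : 0 < f (r m).
  rewrite lt_def f0 ?(ltW (r_gt0 m))// andbT; apply/eqP => fr0.
  by have [_] := rP m; rewrite fr0 mulr0 ltNge int0.
pose F m (X : 'M[R]_(J, d)) : \bar R := (rho (r m *: X) / f (r m))%:E.
have mscale m : measurable_fun (ball Y e) (fun X => rho (r m *: X)).
  apply: measurable_funTS; apply: (measurableT_comp mrho).
  have := measurable_affine (r m) (0 : 'M[R]_(J, d)).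
  by congr measurable_fun; apply/funext => X; rewrite addr0.
have mF m : measurable_fun (ball Y e) (F m) by exact/measurable_EFinP/measurable_funM.
have mB : measurable (ball Y e) by exact: measurable_mx_ball.
have F0 m X : ball Y e X -> (0 <= F m X)%E.
  by move=> _; rewrite lee_fin divr_ge0// ltW.
have lower : ((c * v)%:E <= \int[lam]_(X in ball Y e) limn_einf (F^~ X))%E.
  rewrite EFinM -(lebesgue_mx_ball Y e0) -integral_cst//.
  apply: ge0_le_integral_nonmeasurable => X YX; first by rewrite lee_fin ltW.
  have [aX cX] := Yc X YX.
  have cvgF : (F^~ X) m @[m --> \oo] --> (g (normalize X))%:E.
    apply/cvg_EFin; first exact: nearW.
    have -> : fine \o F^~ X = (fun m => rho (r m *: normalize X) / f (r m)).
      by apply/funext => m /=; rewrite intensity_normalize.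
    by have /cvg_at_rightP/(_ r) := rhog _ aX; apply.
  by rewrite (cvg_limn_einf_sup cvgF).1 lee_fin.
have upper : (limn_einf (fun m => \int[lam]_(X in ball Y e) F m X) <= (c / 2 * v)%:E)%E.
  rewrite limn_einf_lim; apply: lime_le; first exact: is_cvg_einfs.
  apply: nearW => m; apply: (@le_trans _ _ (\int[lam]_(X in ball Y e) F m X)%E).
    by apply: ereal_inf_lbound; exists m => /=.
  have -> : (\int[lam]_(X in ball Y e) F m X =
      (f (r m))^-1%:E * \int[lam]_(X in ball Y e) (rho (r m *: X))%:E)%E.
    rewrite -ge0_integralZl_EFin//.
    - by apply: eq_integral => X _; rewrite -EFinM mulrC.
    - by move=> X _; rewrite lee_fin.
    - exact/measurable_EFinP.
    - by rewrite invr_ge0 ltW.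
  rewrite lee_pdivrMl// -EFinM mulrC; exact: ltW (rP m).2.
have := le_trans lower (le_trans (fatou lam mB mF F0) upper).
by rewrite lee_fin ler_pM2r// leNgt => /negP; apply; rewrite ltr_pdivrMr// ltr_pMr// ltr1n.
Unshelve. all: by end_near. Qed.

End SparseIntensity.

(** * The sparse regime *)

Section SparseRegime.
Context (R : realType) (d k : nat) (dT : measure_display) (T : measurableType dT).
Variables (P : probability T R) (Phi : {mfun T >-> config R d}).
Local Notation J := (2 * k + 1).+1.

Lemma ball_mx_scale m (X Y : 'M[R]_(m, d)) b e : 0 < b -> 0 < e ->
  ball (b *: Y) (b * e) (b *: X) = ball Y e X.
Proof.
move=> b0 e0; have be0 : 0 < b * e by rewrite mulr_gt0.
apply/propext; split => /ball_mxP h; apply/ball_mxP => // i j.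
  by have := h be0 i j; rewrite !mxE -mulrBr normrM gtr0_norm// ltr_pM2l.
by rewrite !mxE -mulrBr normrM gtr0_norm// ltr_pM2l// h.
Qed.

Lemma eballs_scaled (s : 'I_J -> 'I_k.+1 * bool) (Y : 'M[R]_(J, d)) r x :
  (0 < k)%N -> bijective s -> octahedral 1 s Y -> row ord0 Y = 0 -> 0 < r ->
  eballs (r *: Y) (r * 2) x -> enorm x <= 4 * r.
Proof.
move=> k0 sb oct Y0 r0 [m _]; rewrite /eball/= row_scale => xm.
have tri := enorm_triangle (r *: row m Y) x 0.
have dia := octahedral_diameter m ord0 ltr01 k0 sb oct.
rewrite subr0 in tri; rewrite Y0 subr0 mulr1 in dia.
have : enorm (r *: row m Y - 0) <= r * 2.
  by rewrite subr0 enormZ gtr0_norm// ler_pM2l.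
by move: xm tri; lra.
Qed.

(** The probabilities of a hit and of a full region are both of the order of
    r^(d(2k+2)) f(r), and the width of the region is of order r.  The factorial moments are bounded at scale 2r,
    where the region is small enough for the scaling bounds, and doubling brings
    f(2r) back to f(r). *)
Lemma sparse_regime_bound (rho : 'M[R]_(J, d) -> R) (rho' : 'M[R]_(J.+1, d) -> R)
    f f' g g' :
  (0 < d)%N -> (0 < k)%N -> stationary P Phi -> negatively_associated P Phi ->
  joint_intensity P Phi rho -> translation_invariant rho ->
  joint_intensity P Phi rho' -> translation_invariant rho' ->
  scaling_functions rho f g -> scaling_ae_continuous g ->
  scaling_functions rho' f' g' -> f' =O_ (0^'+) f ->
  (0 < mu0 (@cross_polytope k) g)%E ->
  exists2 K, 0 < K & \forall r \near 0^'+, forall n,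
    n%:R * (r ^+ (d * (2 * k + 1)) * f r) *
      fine (P [set w | rips_betti Phi k n r w = 0%N]) <= K.
Proof.
move=> d0 k0 st NA rhoI rhoT rhoI' rhoT' scal gcont scal' fO mu0gt.
have [f0 g0 [[C C0 rhoC] _] _ _] := scal.
have [_ _ [[C' C'0 rhoC'] _] _ _] := scal'.
have J4n : (4 <= J)%N by lia.
have J4 : 4 <= J%:R :> R by rewrite (ler_nat R 4 J).
have [s [Y [e [c [sb c0 temp oct [Y0 Yc]]]]]] := sparse_template k0 g0 gcont mu0gt.
have e0 : 0 < e by case: temp.
have Yrow m : enorm (row m Y) <= 2.
  have := octahedral_diameter m ord0 ltr01 k0 sb oct.
  by rewrite Y0 subr0 mulr1.
have aY : anchored_ball Y.
  by split => // m; rewrite (le_trans (Yrow m))//; move: J4; lra.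
have a2Y : anchored_ball (2 *: Y).
  split => [|m]; first by rewrite row_scale Y0 scaler0.
  by rewrite row_scale enormZ gtr0_norm//; have := Yrow m; move: J4; lra.
have gY : 0 < g Y.
  have nY : normalize Y = Y.
    by apply/row_matrixP => m; rewrite row_normalize Y0 subr0.
  by have [_] := Yc Y (ballxx _ e0); rewrite nY; exact: lt_le_trans.
have [D D0 dbl] := scaling_doubling scal aY a2Y gY.
have [B B0 f'B] : exists2 B, 0 < B & \forall r \near 0^'+, `|f' r| <= B * `|f r|.
  by have /eqO_exP[B B0 h] := fO; exists B.
have [mrho rho0 _] := rhoI.
have low := ball_intensity_lower scal rhoT mrho rho0 e0 c0 Yc.
pose c1 : R := c / 2 * (2 * e) ^+ (J * d).
have c10 : 0 < c1 by rewrite mulr_gt0 ?divr_gt0// exprn_gt0// mulr_gt0.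
pose lam : R := C * D * 10 ^+ (J * d).
have lam0 : 0 < lam by rewrite !mulr_gt0// exprn_gt0.
pose b1 : R := C' * (B * D) * 10 ^+ (J.+1 * d).
have b10 : 0 < b1 by rewrite !mulr_gt0// exprn_gt0.
pose kap : R := c1 / 2 / J`!%:R.
have kap0 : 0 < kap by rewrite !divr_gt0// ltr0n fact_gt0.
have K0 : 0 < 4 * 40 ^+ d * lam / kap ^+ 2.
  by rewrite divr_gt0// ?exprn_gt0// !mulr_gt0// exprn_gt0.
exists (4 * 40 ^+ d * lam / kap ^+ 2) => //.
have rhoC2 := near_right0_scale (ltr0Sn R 1) rhoC.
have rhoC2' := near_right0_scale (ltr0Sn R 1) rhoC'.
have f'B2 := near_right0_scale (ltr0Sn R 1) f'B.
have small := @near_right0_lt R 0 b1 (c1 / 2) (divr_gt0 c10 (ltr0Sn R 1)).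
near=> r => n.
have r0 : 0 < r by near: r; exact: nbhs_right_gt.
have r1 : r <= 1 by near: r; apply: nbhs_right_le.
have F0 : 0 <= f r by rewrite f0// ltW.
have F20 : 0 <= f (2 * r) by rewrite f0// mulr_ge0// ltW.
have dblr : f (2 * r) <= D * f r by near: r.
have lowr : ((c1 * f r)%:E <= \int[lebesgue_mx R J d]_(X in ball Y e) (rho (r *: X))%:E)%E.
  by near: r.
(* Makes the moment of order J+1 at most half of the lower bound of the integral. *)
have smallr : 0 + b1 * r < c1 / 2 by near: r.
have rhor Y' : anchored_ball Y' -> rho ((2 * r) *: Y') <= C * f (2 * r).
  by move: Y'; near: r.
have rhor' Y' : anchored_ball Y' -> rho' ((2 * r) *: Y') <= C' * f' (2 * r).
  by move: Y'; near: r.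
have f'r : `|f' (2 * r)| <= B * `|f (2 * r)| by near: r.
have [f'0 _ _ _ _] := scal'.
rewrite !ger0_norm ?f'0 ?mulr_ge0 ?(ltW r0)// in f'r.
have temr := octahedral_template_scale r0 temp.
rewrite mulr1 in temr.
have small_ball x : eballs (r *: Y) (r * 2) x -> enorm x <= 4 * r.
  exact: eballs_scaled oct Y0 r0.
have coord x : eballs (r *: Y) (r * 2) x -> forall i, `|x ord0 i| < 5 * r.
  move=> /small_ball xr i; rewrite (le_lt_trans (coord_le_enorm x i))//.
  by rewrite (le_lt_trans xr)// ltr_pM2r// ltr_nat.
have diam m x y : (4 <= m)%N -> eballs (r *: Y) (r * 2) x -> eballs (r *: Y) (r * 2) y ->
    enorm (x - y) <= m%:R * (2 * r).
  move=> m4 /small_ball xr /small_ball yr.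
  have := enormD x (- y); rewrite enormN => h.
  have m4' : 4 <= m%:R :> R by rewrite (ler_nat R 4 m).
  by move: h xr yr m4' r0; clear; set M := m%:R => *; nra.
have r20 : 0 < 2 * r by rewrite mulr_gt0.
have r50 : 0 < 5 * r by rewrite mulr_gt0.
have mE := measurable_eballs (r *: Y) (r * 2).
have momJ := factorial_moment_le rhoI rhoT r20 r50 (mulr_ge0 (ltW C0) F20) mE coord _ rhor.
have momJ1 := factorial_moment_le rhoI' rhoT' r20 r50
   (mulr_ge0 (ltW C'0) (f'0 _ (ltW r20))) mE coord _ rhor'.
have {}momJ := momJ (fun x y => @diam _ x y J4n).
have {}momJ1 := momJ1 (fun x y => @diam _ x y (leqW J4n)).
pose u := r ^+ d; pose v := r ^+ (d * (2 * k + 1)).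
have u0 : 0 < u by rewrite exprn_gt0.
have v0 : 0 < v by rewrite exprn_gt0.
have ur : u <= r by rewrite /u -(prednK d0) exprS ler_piMr ?(ltW r0)// exprn_ile1// ltW.
have uvE : r ^+ (J * d) = u * v by rewrite mulnC mulnS exprD.
have uuvE : r ^+ (J.+1 * d) = u * (u * v) by rewrite mulSn exprD uvE.
have ten : 2 * (5 * r) = 10 * r by rewrite mulrA -natrM.
rewrite ten exprMn uvE in momJ; rewrite ten exprMn uuvE in momJ1.
pose q := fine (P [set w | full (r *: Y) (r * 2) (Phi w)]).
pose p := fine (P [set w | hit (r *: Y) (r * e) (r * 2) (Phi w)]).
have mf := measurable_config_event Phi (@measurable_full R d k (r *: Y) (r * 2)).
have q_le : q <= lam * (u * v * f r).
  rewrite -lee_fin fineK ?fin_num_measure//.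
  apply: (le_trans (@measure_le_integral _ _ R P _
    (fun w => ((npoints (Phi w) (eballs (r *: Y) (r * 2))) ^_ J)%:R%:E) mf _ _)).
  - by move=> w; rewrite lee_fin ler0n.
  - by move=> w h; rewrite lee_fin ler1n ffact_gt0.
  apply: (le_trans momJ); rewrite lee_fin.
  have -> : lam * (u * v * f r) = C * (D * f r) * (10 ^+ (J * d) * (u * v)).
    by rewrite /lam; ring.
  by rewrite ler_wpM2r ?mulr_ge0 ?exprn_ge0 ?(ltW u0) ?(ltW v0)// ler_wpM2l// ltW.
have p_ge : kap * (u * v * f r) <= p.
  have lower : ((u * v * (c1 * f r))%:E <=
      \int[lebesgue_mx R J d]_(X in ball (r *: Y) (r * e)) (rho X)%:E)%E.
    rewrite (@integral_mx_affine R J d r 0) //; last exact/measurable_EFinP.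
      rewrite uvE EFinM lee_wpmul2l// ?lee_fin ?mulr_ge0 ?(ltW u0) ?(ltW v0)//.
      rewrite (_ : _ @^-1` _ = ball Y e).
        by under eq_integral do rewrite addr0.
      by apply/seteqP; split => X; rewrite /= addr0 ball_mx_scale.
    exact: measurable_mx_ball.
  have := hit_lower_bound rhoI (ltW r0) temr lower momJ1.
  rewrite -/p.
  set a := (X in X <= _); set b := (X in _ + X) => ab.
  have W0 : 0 <= u * v * f r by rewrite !mulr_ge0// ltW.
  have b_le : b <= c1 / 2 * (u * v * f r).
    have f'D : f' (2 * r) <= B * (D * f r).
      by rewrite (le_trans f'r)// ler_wpM2l// ltW.
    apply: (@le_trans _ _ (C' * (B * (D * f r)) * (10 ^+ (J.+1 * d) * (u * (u * v))))).
      by rewrite ler_wpM2r ?mulr_ge0 ?exprn_ge0 ?(ltW u0) ?(ltW v0)// ler_wpM2l// ltW.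
    have -> : C' * (B * (D * f r)) * (10 ^+ (J.+1 * d) * (u * (u * v))) =
        b1 * u * (u * v * f r) by rewrite /b1; ring.
    apply: ler_wpM2r => //; apply: (@le_trans _ _ (b1 * r)).
      by rewrite ler_wpM2l// ltW.
    by move: smallr; rewrite add0r => /ltW.
  have Jf : 0 < J`!%:R :> R by rewrite ltr0n fact_gt0.
  have -> : kap * (u * v * f r) = c1 / 2 * (u * v * f r) / J`!%:R by rewrite /kap; ring.
  rewrite ler_pdivrMr// [p * _]mulrC -(lerD2r b) (le_trans _ ab)//.
  apply: (le_trans (lerD (lexx _) b_le)).
  by rewrite /a -mulrDl -splitr mulrCA.
have bound := @betti_eq0_cell_bound R d k _ _ P Phi s (r *: Y) (r * e) (r * 2) r (5 * r) n
  d0 k0 st NA sb (ltW r0) temr coord r50.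
have mz := measurable_rips_betti_eq0 Phi n (ltW r0) k0.
have /andP[z0 _] := fine_probability_01 P mz.
move: bound z0; rewrite -/p -/q; set z := fine _ => bound z0.
have [F00|Fn0] := eqVneq (f r) 0.
  by rewrite F00 !(mulr0, mul0r) ltW.
have {}F0 : 0 < f r by rewrite lt_def Fn0.
rewrite -/v ler_pdivlMr ?exprn_gt0//.
have W0 : 0 < u * v * f r by rewrite !mulr_gt0.
have uW0 : 0 < u * (u * v * f r) by rewrite mulr_gt0.
rewrite -(ler_pM2r uW0).
have -> : n%:R * (v * f r) * z * kap ^+ 2 * (u * (u * v * f r)) =
    n%:R * (kap * (u * v * f r)) ^+ 2 * z by ring.
have p2 : (kap * (u * v * f r)) ^+ 2 <= p ^+ 2.
  by rewrite lerXn2r ?nnegrE ?(le_trans _ p_ge)// mulr_ge0// ltW.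
apply: (@le_trans _ _ (n%:R * p ^+ 2 * z)).
  by rewrite ler_wpM2r// ler_wpM2l// ler0n.
apply: (le_trans bound).
have -> : (8 * (5 * r)) ^+ d = 40 ^+ d * u by rewrite mulrA -natrM exprMn.
have -> : 4 * 40 ^+ d * lam * (u * (u * v * f r)) =
    4 * (40 ^+ d * u) * (lam * (u * v * f r)) by ring.
by rewrite ler_wpM2l// mulr_ge0// mulr_ge0 ?exprn_ge0// ltW.
Unshelve. all: by end_near. Qed.

End SparseRegime.

(** * The thermodynamic regime *)

Section SilentTemplates.
Context (R : realType) (d k : nat) (dT : measure_display) (T : measurableType dT).
Variables (P : probability T R) (Phi : {mfun T >-> config R d}).
Local Notation J := (2 * k + 1).+1.
Local Notation lam := (lebesgue_mx R J d).
Variables (rho : 'M[R]_(J, d) -> R) (palm : R.-pker 'M[R]_(J, d) ~> config R d).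
Hypotheses (rhoI : joint_intensity P Phi rho) (Palm : reduced_palm P Phi rho palm).

(** An empty region receives exactly the J points that the reduced Palm distribution
    leaves out. *)
Lemma npoints_add_rows (s : 'I_J -> 'I_k.+1 * bool) (Y X : 'M[R]_(J, d)) e t r
    (phi : config R d) : 0 <= r -> octahedral_template s Y e t r -> ball Y e X ->
  npoints phi (eballs Y t) = 0%N -> npoints (add_rows X phi) (eballs Y t) = J.
Proof.
move=> r0 temp YX phi0; have bY : bounded_set (eballs Y t) by exact: bounded_eballs.
have Yrow m : eballs Y t (row m X) by exact: (ball_template r0 temp) (row_ball m YX).
have Xinj : injective (fun m => row m X).
  move=> m l /= ml; apply/eqP; apply: contrapT => /negP nml; have [_ _ _ sep _] := temp.
  have := enorm_template_diff (row_ball m YX) (row_ball l YX).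
  rewrite ml subrr enorm0 sub0r normrN ger0_norm ?enorm_ge0//.
  by rewrite leNgt sep.
apply: etrans (card_rows Xinj); congr #|` _|%fset; apply/fsetP => x.
rewrite mem_npoints// inE /=; apply/idP/idP => [/andP[/set_mem + /set_mem Yx]|/mapP[m _ ->]].
  move=> [phix|[m _ <-]]; last by apply/mapP; exists m; rewrite ?mem_enum.
  suff : (0 < npoints phi (eballs Y t))%N by rewrite phi0.
  by apply/npoints_gt0P => //; exists x.
by apply/andP; split; apply/mem_set => //; right; exists m.
Qed.

(** The defining formula of Palm distributions is applied to the function that
    tests whether X lies in the balls and the region has J points.  Its sum over
    tuples vanishes unless the template is hit, while its Palm integral is at
    least the Palm void probability of the region. *)
Lemma silent_template (s : 'I_J -> 'I_k.+1 * bool) (Y : 'M[R]_(J, d)) e t r :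
  0 <= r -> octahedral_template s Y e t r -> P [set w | hit Y e t (Phi w)] = 0%E ->
  lam.-negligible [set X | [/\ ball Y e X, 0 < rho X &
    (0 < palm X [set phi | npoints phi (eballs Y t) = 0%N])%E]].
Proof.
move=> r0 temp hit0; have [mrho rho0 _] := rhoI; have [palmE _ _] := Palm.
have e0 : 0 < e by case: temp.
have mY : measurable (eballs Y t) by exact: measurable_eballs.
have bY : bounded_set (eballs Y t) by exact: bounded_eballs.
pose E := [set phi : config R d | npoints phi (eballs Y t) = J].
pose E0 := [set phi : config R d | npoints phi (eballs Y t) = 0%N].
have mE : measurable E by exact: measurable_npoints_eq.
have mE0 : measurable E0 by exact: measurable_npoints_eq.
have mB : measurable (ball Y e) by exact: measurable_mx_ball.
pose u (p : config R d * 'M[R]_(J, d)) : R := \1_(E `*` ball Y e) p.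
have u01 p : 0 <= u p <= 1 by rewrite /u indicE; case: (_ \in _); rewrite ?lexx ?ler01.
have mu : measurable_fun setT u by apply: measurable_indic; exact: measurableX.
have := palmE u mu (fun p => proj1 (andP (u01 p))).
have u1 : exists C, forall p, u p <= C by exists 1 => p; case/andP: (u01 p).
move=> /(_ u1).
have cK : exists2 K, compact K & forall phi X, ~ K X -> u (phi, X) = 0.
  exists [set X : 'M[R]_(J, d) | forall i j, - (`|Y| + e) <= X i j <= `|Y| + e].
    exact: compact_mx_box.
  move=> phi X KX; rewrite /u indicE memNset// => -[_ YX]; apply: KX => i j.
  rewrite -ler_norml -(subrK (Y i j) (X i j)) addrC (le_trans (ler_normD _ _))//.
  rewrite lerD ?mx_entry_le_norm// distrC ltW//; exact: YX.2.
move=> /(_ cK).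
have -> : (\int[P]_w (\esum_(X in factorial_power J (Phi w)) (u (Phi w, X))%:E) = 0)%E.
  apply/eqP; rewrite eq_le; apply/andP; split; last first.
    by apply: integral_ge0 => w _; apply: esum_ge0 => X _; rewrite lee_fin; case/andP: (u01 (Phi w, X)).
  have mh := measurable_config_event Phi (measurable_hit Y e t).
  apply: (@le_trans _ _ (\int[P]_w (cst +oo%E \_ [set w | hit Y e t (Phi w)]) w)%E).
    apply: ge0_le_integral_nonmeasurable => w _.
      by apply: esum_ge0 => X _; rewrite lee_fin; case/andP: (u01 (Phi w, X)).
    rewrite /patch; case: ifPn => [_|nhit]; first by rewrite leey.
    rewrite esum1// => X [_ XPhi]; rewrite /u indicE memNset// => -[/= Ephi YX].
    move/negP: nhit; apply; apply/mem_set; split => [m|]; last by rewrite Ephi.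
    apply/npoints_gt0P; first exact: bounded_ball.
    by exists (row m X); [exact: XPhi|exact: row_ball].
  rewrite -integral_mkcond integral_cst// [X in (_ * X)%E](hit0 : _ = 0%E) mule0//.
move=> /esym int0.
pose h X : \bar R := (palm X E0 * (rho X * \1_(ball Y e) X)%:E)%E.
have h0 X : (0 <= h X)%E by rewrite mule_ge0// lee_fin mulr_ge0.
have mh : measurable_fun setT h.
  apply: emeasurable_funM; first exact: measurable_kernel.
  apply/measurable_EFinP/measurable_funM => //; exact: measurable_indic.
have : (\int[lam]_X h X <= 0)%E.
  rewrite -int0; apply: ge0_le_integral_nonmeasurable => X _ //.
  rewrite /h EFinM muleA muleAC lee_wpmul2r ?lee_fin//.
  have [YX|YX] := pselect (ball Y e X); last first.
    rewrite indicE memNset// mule0; apply: integral_ge0 => phi _.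
    by rewrite lee_fin; case/andP: (u01 (add_rows X phi, X)).
  rewrite indicE mem_set// mule1.
  apply: measure_le_integral => // phi.
    by rewrite lee_fin; case/andP: (u01 (add_rows X phi, X)).
  move=> Ephi; rewrite lee_fin /u indicE mem_set//; split => //=.
  exact: npoints_add_rows temp YX Ephi.
move=> hle; have : (\int[lam]_X `|h X| = 0)%E.
  under eq_integral do rewrite gee0_abs//.
  by apply/eqP; rewrite eq_le hle integral_ge0.
move=> /(ae_eq_integral_abs lam measurableT mh)[N [mN N0 hN]].
exists N; split => // X [YX rX pX]; apply: hN => /= /(_ Logic.I).
rewrite /h indicE mem_set// mulr1; apply/eqP; rewrite gt_eqF// mule_gt0// lte_fin.
Qed.

End SilentTemplates.

Section GenericTuples.
Variables (R : realType) (d j : nat).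

Lemma measurable_anchor_entry (m : 'I_j.+1) (i : 'I_d) :
  measurable_fun setT (fun Z : 'M[R]_(j, d) => anchor Z m i).
Proof.
have mp : measurable_fun setT (fun Z : 'M[R]_(j, d) => (0 : 'rV[R]_d, Z)).
  exact: measurable_fun_pair.
have := measurableT_comp (@measurable_cons_row R j d) mp.
exact: measurableT_comp (@measurable_mx_entry R j.+1 d m i).
Qed.

Lemma row_anchor_scale b (Z : 'M[R]_(j, d)) m :
  row m (anchor (b *: Z)) = b *: row m (anchor Z).
Proof.
case: (unliftP ord0 m) => [i ->|->]; first by rewrite !row_anchorS row_scale.
by rewrite !row_anchor0 scaler0.
Qed.

(** Dilation changes the distances, so [lebesgue_mx_scale_transversal] applies. *)
Lemma ae_anchor_distance : {ae lebesgue_mx R j d, forall Z, forall m l : 'I_j.+1,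
  m != l -> enorm (row m (anchor Z) - row l (anchor Z)) != 1}.
Proof.
pose S (p : 'I_j.+1 * 'I_j.+1) := [set Z : 'M[R]_(j, d) |
  enorm (row p.1 (anchor Z) - row p.2 (anchor Z)) = 1].
have mS p : measurable (S p).
  rewrite -[X in measurable X]setTI.
  have mf : measurable_fun setT (fun Z : 'M[R]_(j, d) =>
      enorm (row p.1 (anchor Z) - row p.2 (anchor Z))).
    apply: measurable_fun_enorm => i.
    rewrite (_ : (fun w => _) = (fun Z => anchor Z p.1 i - anchor Z p.2 i)).
      by apply: measurable_funB; exact: measurable_anchor_entry.
    by apply/funext => Z; rewrite !mxE.
  exact: (mf measurableT [set 1]).
have S0 p : lebesgue_mx R j d (S p) = 0%E.
  apply: lebesgue_mx_scale_transversal => // Z b b1; rewrite /S/= => Z1.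
  rewrite !row_anchor_scale -scalerBr enormZ Z1 mulr1 gtr0_norm ?(lt_trans ltr01)//.
  by move=> b1'; rewrite b1' ltxx in b1.
apply: filter_forall => m; apply: filter_forall => l.
exists (S (m, l)); split => // Z /= /not_implyP[_ /negP/negPn/eqP Z1].
exact: Z1.
Qed.

End GenericTuples.

Section VoidProbabilities.
Context (R : realType) (d : nat).

(** By local finiteness, a configuration that avoids closed balls avoids slightly
    larger ones. *)
Lemma void_ball_enlarge (mu : {measure set (config R d) -> \bar R}) m
    (X : 'M[R]_(m, d)) b :
  (0 < mu [set phi | npoints phi (eballs X b) = 0%N])%E ->
  exists l : nat, (0 < mu [set phi | npoints phi (eballs X (b + l.+1%:R^-1)) = 0%N])%E.
Proof.
have mE t : measurable [set phi : config R d | npoints phi (eballs X t) = 0%N].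
  by apply: measurable_npoints_eq; [exact: measurable_eballs|exact: bounded_eballs].
move=> pos; apply: contrapT => none.
have null l : mu.-negligible [set phi | npoints phi (eballs X (b + l.+1%:R^-1)) = 0%N].
  exists [set phi | npoints phi (eballs X (b + l.+1%:R^-1)) = 0%N]; split => //.
  apply/eqP; rewrite eq_le measure_ge0 andbT leNgt; apply/negP => h; apply: none.
  by exists l.
move: pos; rewrite (measure_negligible (mE b)) ?ltxx//.
apply: negligibleS (negligible_bigcup null) => phi /= phi0.
pose Q := fset_set (phi `&` eballs X (b + 1)).
have far (x : Q) i : b < enorm (val x - row i X).
  rewrite ltNge; apply/negP => xi.
  have := valP x; rewrite mem_npoints; last exact: bounded_eballs.
  move=> /andP[/set_mem px _].
  suff : (0 < npoints phi (eballs X b))%N by rewrite phi0.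
  by apply/npoints_gt0P; [exact: bounded_eballs|exists (val x) => //; exists i].
have near1 : \forall e \near 0^'+, forall x : Q, forall i, b + 1 * e < enorm (val x - row i X).
  by apply: filter_forall => x; apply: filter_forall => i; exact: near_right0_lt.
have [e e0 He] := near_right0P near1.
pose l := Num.truncn (e^-1).
have le : l.+1%:R^-1 < e.
  by rewrite -[ltRHS]invrK ltf_pV2 ?posrE ?invr_gt0//; exact: truncnS_gt.
exists l => //=; apply/eqP; rewrite -leqn0 leqNgt; apply/negP.
move=> /npoints_gt0P h; have [|x px [i _ xi]] := h; first exact: bounded_eballs.
have xQ : x \in Q.
  rewrite mem_npoints; last exact: bounded_eballs.
  apply/andP; split; apply/mem_set => //; exists i => //.
  by rewrite /eball/= (le_trans xi)// lerD2l invf_le1// ler1n.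
have := He l.+1%:R^-1; rewrite invr_gt0 ltr0n le => /(_ isT (FSetSub xQ) i).
by rewrite mul1r ltNge; apply/negP/negPn; exact: xi.
Qed.

Lemma rational_ball m n (X : 'M[R]_(m, n)) e : 0 < e ->
  exists a : 'M[rat]_(m, n), ball (map_mx ratr a : 'M[R]_(m, n)) e X.
Proof.
move=> e0; have aX i j : exists a : rat, `|X i j - ratr a| < e.
  have [|a] := @rat_in_itvoo R (X i j) (X i j + e); first by rewrite ltrDl.
  rewrite in_itv/= => /andP[Xa aX]; exists a.
  by rewrite distrC gtr0_norm ?subr_gt0// ltrBlDl.
have /choice[a aP] (p : 'I_m * 'I_n) : exists a : rat, `|X p.1 p.2 - ratr a| < e.
  exact: aX.
exists (\matrix_(i, j) a (i, j)); apply/ball_mxP => // i j.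
by rewrite !mxE distrC; exact: aP (i, j).
Qed.

End VoidProbabilities.

Section PositiveTemplate.
Context (R : realType) (d k : nat) (dT : measure_display) (T : measurableType dT).
Variables (P : probability T R) (Phi : {mfun T >-> config R d}).
Local Notation j := (2 * k + 1)%N.
Local Notation J := (2 * k + 1).+1.
Local Notation lam := (lebesgue_mx R J d).
Variables (rho : 'M[R]_(J, d) -> R) (palm : R.-pker 'M[R]_(J, d) ~> config R d).
Hypotheses (rhoI : joint_intensity P Phi rho) (rhoT : translation_invariant rho).
Hypothesis Palm : reduced_palm P Phi rho palm.

Lemma octahedral_translate_scale b (s : 'I_J -> 'I_k.+1 * bool) (X : 'M[R]_(J, d)) x :
  0 < b -> octahedral 1 s X -> octahedral b s (translate_mx x (b *: X)).
Proof.
move=> b0 oct m l ml; have [Xml Xadj] := oct m l ml.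
have diff : row m (translate_mx x (b *: X)) - row l (translate_mx x (b *: X)) =
    b *: (row m X - row l X).
  by rewrite !row_translate_mx !row_scale opprD addrACA subrr addr0 scalerBr.
split; last by rewrite diff enormZ gtr0_norm// -Xadj -{2}[b]mulr1 ler_pM2l.
by rewrite -subr_eq0 diff scaler_eq0 gt_eqF//= subr_eq0.
Qed.

(** There are countably many templates with rational centres.  If none had a
    positive probability, then outside a null set no octahedral tuple X with
    rho(X) > 0 would have a positive Palm void probability for a region slightly
    larger than its balls of radius b.  Translating by a suitable x yields an
    anchored tuple that avoids this null set, and gamma_beta > 0 gives one with
    positive void probability, which extends to a larger region. *)
Lemma positive_template b : (0 < k)%N -> 0 < b ->
  (0 < gamma_beta (@cross_polytope k) (b ^+ d) rho palm)%E -> (0 < d)%N ->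
  exists s (Y : 'M[R]_(J, d)) e t, [/\ bijective s, 0 < e,
    forall r, `|r - b| <= e -> octahedral_template s Y e t r &
    (0 < P [set w | hit Y e t (Phi w)])%E].
Proof.
move=> k0 b0 + d0; rewrite /gamma_beta.
have -> : (b ^+ d) `^ d%:R^-1 = b.
  by rewrite -powR_mulrn ?(ltW b0)// -powRrM mulfV ?pnatr_eq0 -?lt0n// powRr1// ltW.
move=> gammagt; apply: contrapT => none.
pose Yt (i : 'M[rat]_(J, d) * nat * nat) : 'M[R]_(J, d) := map_mx ratr i.1.1.
pose e (i : 'M[rat]_(J, d) * nat * nat) : R := i.1.2.+1%:R^-1.
pose t (i : 'M[rat]_(J, d) * nat * nat) : R := b + i.2.+1%:R^-1 / 2.
pose good i := exists2 s, bijective s &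
  forall r, `|r - b| <= e i -> octahedral_template s (Yt i) (e i) (t i) r.
pose D i := [set X | [/\ ball (Yt i) (e i) X, 0 < rho X &
    (0 < palm X [set phi | npoints phi (eballs (Yt i) (t i)) = 0%N])%E]].
have e_gt0 i : 0 < e i by rewrite invr_gt0.
have Dnull i : good i -> lam.-negligible (D i).
  move=> [s sb temp]; apply: (silent_template rhoI Palm (ltW b0)).
    by apply: (temp b); rewrite subrr normr0 ltW.
  apply/eqP; rewrite eq_le measure_ge0 andbT leNgt; apply/negP => hit_gt.
  by apply: none; exists s, (Yt i), (e i), (t i).
pose F n := if (choice.unpickle n : option ('M[rat]_(J, d) * nat * nat)) is Some i then [set X | good i /\ D i X] else set0.
have Fnull n : lam.-negligible (F n).
  rewrite /F; case: (choice.unpickle n) => [i|]; last exact: negligible_set0.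
  have [gi|ngi] := pselect (good i); first by apply: negligibleS (Dnull i gi) => X [].
  by apply: negligibleS (@negligible_set0 _ _ _ lam) => X [].
have [N [mN N0 FN]] := negligible_bigcup Fnull.
have [x xN] := lebesgue_mx_null_section mN N0.
pose A := [set Z : 'M[R]_(j, d) | N (col_mx x Z)].
have mA : measurable A.
  have mp : measurable_fun setT (fun Z : 'M[R]_(j, d) => (x, Z)) by exact: measurable_fun_pair.
  have := measurableT_comp (@measurable_cons_row R j d) mp.
  by move=> /(_ measurableT N mN); rewrite setTI.
pose V : 'M[R]_(j, d) := \matrix_(i < j) x.
have A'0 : lebesgue_mx R j d ((fun Z => b *: Z + V) @^-1` A) = 0%E.
  exact/(lebesgue_mx_affine_null V b0 mA).
have mA' : measurable ((fun Z => b *: Z + V) @^-1` A).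
  exact: measurable_affine_preimage.
have XE Z : translate_mx x (b *: anchor Z) = col_mx x (b *: Z + V).
  apply/row_matrixP => m; rewrite row_translate_mx row_scale.
  case: (unliftP ord0 m) => [i ->|->].
    rewrite row_anchorS [RHS](row_cons_rowS (x, _) i).
    by apply/rowP => l; rewrite !mxE.
  by rewrite row_anchor0 scaler0 add0r [RHS](row_cons_row0 (x, _)).
have ae_good : {ae lebesgue_mx R j d, forall Z, ~ N (translate_mx x (b *: anchor Z)) /\
    forall m l : 'I_J, m != l -> enorm (row m (anchor Z) - row l (anchor Z)) != 1}.
  apply: filterI (@ae_anchor_distance R d j).
  by exists ((fun Z => b *: Z + V) @^-1` A); split => // Z /= /contrapT; rewrite XE.
pose h Z : \bar R := ((graph_indicator (@cross_polytope k) Z * rho (b *: anchor Z))%:E *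
  palm (b *: anchor Z) [set phi | npoints phi (eballs (b *: anchor Z) b) = 0%N])%E.
have [_ rho0 _] := rhoI.
have h0 Z : (0 <= h Z)%E by rewrite mule_ge0// lee_fin mulr_ge0// ler0n.
have [|Z [XN dist] hZ] := integral_gt0_exists ae_good h0.
  rewrite ltNge; apply/negP => le0; move: gammagt; apply/negP; rewrite -leNgt.
  by rewrite mule_ge0_le0// lee_fin divr_ge0// exprn_ge0// exprn_ge0// ltW.
have [s sb oct] : exists2 s, bijective s & octahedral 1 s (anchor Z).
  apply: graph_iso_octahedral; apply: contrapT => niso; move: hZ.
  by rewrite /h /graph_indicator asboolF// mul0r mul0e ltxx.
have rhoZ : 0 < rho (b *: anchor Z).
  rewrite lt_def rho0 andbT; apply/eqP => rz; move: hZ.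
  by rewrite /h rz mulr0 mul0e ltxx.
have palmZ : (0 < palm (b *: anchor Z)
    [set phi | npoints phi (eballs (b *: anchor Z) b) = 0%N])%E.
  rewrite lt_def measure_ge0 andbT; apply/eqP => pz; move: hZ.
  by rewrite /h pz mule0 ltxx.
set X := translate_mx x (b *: anchor Z) in XN.
have octX : octahedral b s X by exact: octahedral_translate_scale.
have mE Y' t' : measurable [set phi : config R d | npoints phi (eballs (Y' : 'M[R]_(J, d)) t') = 0%N].
  by apply: measurable_npoints_eq; [exact: measurable_eballs|exact: bounded_eballs].
have palmX : (0 < palm X [set phi | npoints phi (eballs X b) = 0%N])%E.
  have [_ _ cov] := Palm; rewrite cov//.
  suff -> : [set phi | [set phi0 | npoints phi0 (eballs X b) = 0%N] (translate x phi)] =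
    [set phi | npoints phi (eballs (b *: anchor Z) b) = 0%N] by [].
  by apply/funext => phi; rewrite /= npoints_eballs_translate.
have distX m l : m != l -> enorm (row m X - row l X) != b.
  move=> ml.
  have -> : enorm (row m X - row l X) = b * enorm (row m (anchor Z) - row l (anchor Z)).
    rewrite !row_translate_mx !row_scale opprD addrACA subrr addr0.
    by rewrite -scalerBr enormZ gtr0_norm.
  apply: contra (dist m l ml) => /eqP Eb; apply/eqP.
  by apply: (mulfI (lt0r_neq0 b0)); rewrite mulr1.
have [l palml] := void_ball_enlarge palmX.
pose tl : R := b + l.+1%:R^-1 / 2.
have btl : b < tl by rewrite ltrDl divr_gt0// invr_gt0.
have half : 0 < l.+1%:R^-1 / 2 :> R by rewrite divr_gt0// invr_gt0.
have [e1 e10 He1] := near_right0P (filterI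
  (near_octahedral_template b0 btl octX distX) (@near_right0_lt R 0 d%:R _ half)).
pose i := Num.truncn (e1^-1).
have ie : i.+1%:R^-1 < e1.
  by rewrite -[ltRHS]invrK ltf_pV2 ?posrE ?invr_gt0//; exact: truncnS_gt.
have i0 : 0 < i.+1%:R^-1 :> R by rewrite invr_gt0.
have [|tempi di] := He1 i.+1%:R^-1; first by rewrite i0.
have [a aX] := rational_ball X i0.
apply: XN; apply: FN; exists (choice.pickle (a, i, l)) => //.
rewrite /F choice.pickleK; split.
  exists s => // r rb; apply: tempi => //; exact: ball_sym.
split => //; first by rewrite /X rhoT.
apply: (lt_le_trans palml); apply: le_measure; rewrite ?inE//.
move=> phi /=; apply: contraPP => /eqP; rewrite -lt0n => /npoints_gt0P pos.
have [|y py [m _ ym]] := pos; first exact: bounded_eballs.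
apply/eqP; rewrite -lt0n; apply/npoints_gt0P; first exact: bounded_eballs.
exists y => //; exists m => //; rewrite /eball/=.
have h1 : enorm (y - row m (map_mx ratr a)) <= tl := ym.
have h2 := ball_enorm (row_ball m aX); rewrite enormB in h2.
rewrite add0r in di.
rewrite (le_trans (enorm_triangle (row m (map_mx ratr a)) _ _))//.
rewrite (le_trans (lerD h1 (le_trans h2 (ltW di))))//.
by rewrite /tl -addrA -splitr.
Qed.

End PositiveTemplate.

(** * Nonvanishing of the Betti numbers *)

Section SupercriticalRegime.
Context (R : realType) (d k : nat) (dT : measure_display) (T : measurableType dT).
Variables (P : probability T R) (Phi : {mfun T >-> config R d}).
Local Notation j := (2 * k + 1)%N.
Local Notation J := (2 * k + 1).+1.
Variables (rho : 'M[R]_(J, d) -> R) (palm : R.-pker 'M[R]_(J, d) ~> config R d).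
Hypotheses (d0 : (0 < d)%N) (k0 : (0 < k)%N).
Hypotheses (st : stationary P Phi) (NA : negatively_associated P Phi).
Hypotheses (rhoI : joint_intensity P Phi rho) (rhoT : translation_invariant rho).
Local Notation p_eq0 n r := (fine (P [set w | rips_betti Phi k n r w = 0%N])).

Lemma local_thermodynamic_bound b : 0 < b -> reduced_palm P Phi rho palm ->
  (0 < gamma_beta (@cross_polytope k) (b ^+ d) rho palm)%E ->
  exists2 K, 0 < K & exists2 e, 0 < e & forall r n, 0 <= r -> `|r - b| <= e ->
    n%:R * p_eq0 n r <= K.
Proof.
move=> b0 Palm gammagt.
have [s [Y [e [t [sb e0 temp hitgt]]]]] := positive_template rhoI rhoT Palm k0 b0 gammagt d0.
have mh := measurable_config_event Phi (measurable_hit Y e t).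
have mf := measurable_config_event Phi (measurable_full Y t).
have p0 : 0 < fine (P [set w | hit Y e t (Phi w)]).
  by rewrite -lte_fin fineK// fin_num_measure.
have [M [_ YM]] := bounded_eballs Y t.
pose L := `|M| + 2.
have L0 : 0 < L by rewrite ltr_wpDl.
have YL x : eballs Y t x -> forall i, `|x ord0 i| < L.
  move=> xY i; apply: (@le_lt_trans _ _ `|x|); first exact: mx_entry_le_norm.
  apply: (@le_lt_trans _ _ (`|M| + 1)); last by rewrite ltrD2l ltr1n.
  by apply: YM => //; rewrite (le_lt_trans (ler_norm M))// ltrDl.
exists (4 * (8 * L) ^+ d / fine (P [set w | hit Y e t (Phi w)]) ^+ 2).
  by rewrite divr_gt0 ?exprn_gt0// mulr_gt0// exprn_gt0// mulr_gt0.
exists e => // r n r0 rb; rewrite ler_pdivlMr ?exprn_gt0//.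
have := betti_eq0_cell_bound n d0 k0 st NA sb r0 (temp r rb) YL L0.
rewrite mulrAC => /le_trans; apply.
have /andP[_ q1] := fine_probability_01 P mf.
by rewrite ler_piMr// mulr_ge0// exprn_ge0// mulr_ge0// ltW.
Qed.

(** The local bounds are valid on neighbourhoods, finitely many of which cover the
    segment. *)
Lemma thermodynamic_bound a c : 0 < a -> reduced_palm P Phi rho palm ->
  (forall b, 0 < b -> (0 < gamma_beta (@cross_polytope k) (b ^+ d) rho palm)%E) ->
  exists2 K, 0 < K & forall r n, a <= r <= c -> n%:R * p_eq0 n r <= K.
Proof.
move=> a0 Palm gammagt.
have [K0 [_ HK]] : \forall K \near +oo, `[a, c] `<=` [set r | forall n, n%:R * p_eq0 n r <= K].
  have /compact_near_coveringP := @segment_compact R a c.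
  move=> /(_ R +oo (fun K r => forall n, n%:R * p_eq0 n r <= K) _); apply=> b; rewrite /= in_itv/= => /andP[ab _].
  have b0 := lt_le_trans a0 ab.
  have [K K0 [e e0 H]] := local_thermodynamic_bound b0 Palm (gammagt b b0).
  exists (ball b (Num.min e b), [set K' | K <= K']).
    split; last by apply: nbhs_pinfty_ge; exact: num_real.
    by apply: nbhsx_ballx; rewrite lt_min e0.
  move=> [r K'] [/= br KK'] n; apply: le_trans KK'; move: br.
  rewrite /ball/= distrC lt_min => /andP[re rb]; apply: H; last exact: ltW.
  by move: rb; rewrite ltr_distl subrr => /andP[/ltW].
exists (`|K0| + 1); first by rewrite ltr_wpDl.
move=> r n rac; apply: HK; first by rewrite (le_lt_trans (ler_norm K0))// ltrDl.
by rewrite /= in_itv.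
Qed.

(** Scales below a are covered by the sparse bound and the others, which are bounded
    by the hypothesis on r^d, by the thermodynamic one. *)
Lemma betti_neq0_whp (rho' : 'M[R]_(J.+1, d) -> R) f f' g g' (r : nat -> R) :
  joint_intensity P Phi rho' -> translation_invariant rho' ->
  scaling_functions rho f g -> scaling_ae_continuous g ->
  scaling_functions rho' f' g' -> f' =O_ (0^'+) f ->
  reduced_palm P Phi rho palm ->
  (0 < mu0 (@cross_polytope k) g)%E ->
  (forall b, 0 < b -> (0 < gamma_beta (@cross_polytope k) b rho palm)%E) ->
  (forall n, 0 < r n) ->
  r n ^+ (d * (2 * k + 1)) * f (r n) / n%:R^-1 @[n --> \oo] --> +oo ->
  (fun n => r n ^+ d) =O_\oo (fun=> 1 : R) ->
  P [set w | rips_betti Phi k n (r n) w <> 0%N] @[n --> \oo] --> 1%E.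
Proof.
move=> rhoI' rhoT' scal gcont scal' fO Palm mu0gt gammagt r0 rinfty rO.
have mb n : measurable [set w | rips_betti Phi k n (r n) w = 0%N].
  by apply: measurable_rips_betti_eq0 => //; exact: ltW.
have notE n : [set w | rips_betti Phi k n (r n) w <> 0%N] =
    ~` [set w | rips_betti Phi k n (r n) w = 0%N] by [].
apply: cvg_probability1 => [n|eps eps0]; first by rewrite notE; exact: measurableC.
have [K K0 /near_right0P[a a0 sparse]] :=
  sparse_regime_bound d0 k0 st NA rhoI rhoT rhoI' rhoT' scal gcont scal' fO mu0gt.
have [M M0 rM] : exists2 M, 0 < M & \forall n \near \oo, `|r n ^+ d| <= M * `|1 : R|.
  by have /eqO_exP[M M0 h] := rO; exists M.
have gb b : 0 < b -> (0 < gamma_beta (@cross_polytope k) (b ^+ d) rho palm)%E.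
  by move=> b0; apply: gammagt; rewrite exprn_gt0.
have [K1 K10 thermo] := thermodynamic_bound (Num.max 1 M) a0 Palm gb.
have big : \forall n \near \oo, K / eps <= r n ^+ (d * j) * f (r n) / n%:R^-1.
  by move/cvgryPge : rinfty; exact.
near=> n.
have n0 : (0 < n)%N by near: n; exists 1%N.
rewrite notE setCK -[leLHS]fineK ?fin_num_measure// lee_fin.
have rmax : r n <= Num.max 1 M.
  rewrite le_max; have [//|r1] := leP (r n) 1; apply/orP; right.
  have : `|r n ^+ d| <= M * `|1 : R| by near: n.
  rewrite normr1 mulr1 ger0_norm ?exprn_ge0 ?(ltW (r0 n))//; apply: le_trans.
  by rewrite -(prednK d0) exprS ler_peMr ?(ltW (r0 n))// exprn_ege1// ltW.
have [ra|ar] := ltP (r n) a; last first.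
  have := thermo (r n) n; rewrite ar rmax => /(_ isT) h.
  have nK : K1 / eps <= n%:R.
    near: n; exact: nbhs_infty_ger.
  rewrite -(ler_pM2l (_ : 0 < n%:R)) ?ltr0n// (le_trans h)//.
  by rewrite -ler_pdivrMr.
have := sparse (r n); rewrite r0 ra => /(_ isT n).
have AK : K / eps <= r n ^+ (d * j) * f (r n) / n%:R^-1 by near: n.
move: AK; set z := fine _; set A := _ * f (r n) => AK h.
move: AK h; rewrite invrK [A * _]mulrC => AK h.
have A0 : 0 < n%:R * A by apply: lt_le_trans AK; rewrite divr_gt0.
rewrite -(ler_pM2l A0) (le_trans h)// -ler_pdivrMr//.
Unshelve. all: by end_near. Qed.

End SupercriticalRegime.

Theorem theorem4p5 (R : realType) (d : nat)
  (dT : measure_display) (T : measurableType dT) (P : probability T R)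
  (Phi : {mfun T >-> config R d})
  (rho : forall j : nat, 'M[R]_(j, d) -> R)
  (f : nat -> R -> R) (g : forall j : nat, 'M[R]_(j, d) -> R)
  (d_gt0 : (0 < d)%N)
  (Phi_stationary : stationary P Phi)
  (rho_intensity : forall j, (1 <= j)%N ->
     joint_intensity P Phi (rho j) /\ translation_invariant (rho j))
  (unit_intensity : forall x, rho 1%N x = 1)
  (rho_continuous : forall j, (1 <= j)%N -> ae_continuous (rho j))
  (rho_scaling : forall j,
     scaling_functions (rho j.+1) (f j.+1) (g j.+1) /\
     scaling_ae_continuous (g j.+1))
  (f_bigO : forall j, (1 <= j)%N -> f j.+1 =O_ (0^'+) f j) :
  (forall (k : nat) (r : nat -> R), (1 <= k)%N ->
     (forall n, 0 < r n) -> r n @[n --> \oo] --> 0 ->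
     (fun n => r n ^+ (d * (2 * k + 1)) * f (2 * k + 2)%N (r n))
       =o_\oo (fun n => n%:R^-1 : R) ->
     P [set w | rips_betti Phi k n (r n) w = 0%N] @[n --> \oo] --> 1%E) /\
  (forall palm : forall j, R.-pker 'M[R]_(j, d) ~> config R d,
     (forall j, (1 <= j)%N -> reduced_palm P Phi (rho j) (palm j)) ->
     negatively_associated P Phi ->
     (forall k : nat, (1 <= k)%N ->
        (0 < mu0 (@cross_polytope k) (g (2 * k + 1).+1))%E) ->
     (forall (k : nat) (beta : R), (1 <= k)%N -> 0 < beta ->
        (0 < gamma_beta (@cross_polytope k) beta
               (rho (2 * k + 1).+1) (palm (2 * k + 1).+1))%E) ->
     forall (k : nat) (r : nat -> R), (1 <= k)%N ->
     (forall n, 0 < r n) ->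
     r n ^+ (d * (2 * k + 1)) * f (2 * k + 2)%N (r n) / n%:R^-1
       @[n --> \oo] --> +oo ->
     (fun n => r n ^+ d) =O_\oo (fun=> 1 : R) ->
     P [set w | rips_betti Phi k n (r n) w <> 0%N] @[n --> \oo] --> 1%E).
Proof.
have evenE k : (2 * k + 2 = (2 * k + 1).+1)%N by rewrite addn2 addn1.
have intensity m := rho_intensity m.+1 isT.
split=> [k r k0 r0 r_cvg|palm palmP NA mu0_gt0 gamma_gt0 k r k0 r0]; rewrite evenE.
  have [rhoI rhoT] := intensity (2 * k + 1)%N.
  exact: betti_eq0_whp d_gt0 k0 rhoI rhoT (rho_scaling _).1 r0 r_cvg.
move=> r_infty r_bounded.
have [rhoI rhoT] := intensity (2 * k + 1)%N.
have [rhoI' rhoT'] := intensity (2 * k + 1).+1.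
have [scal gcont] := rho_scaling (2 * k + 1)%N.
have [scal' _] := rho_scaling (2 * k + 1).+1.
exact: (betti_neq0_whp d_gt0 k0 Phi_stationary NA rhoI rhoT rhoI' rhoT' scal gcont scal'
  (f_bigO (2 * k + 1).+1 isT) (palmP (2 * k + 1).+1 isT) (mu0_gt0 k k0)
  (fun b => gamma_gt0 k b k0) r0 r_infty r_bounded).
Qed.
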